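(* The function $\phi'_{r,1}\in C_c^\infty(G_r)$ defined by $$\phi'_{r,1}=[I_r:I_r^+]^{-1}q^{r\ell(t_\mu)/2}\sum_{\chi\in T(k_F)^\vee}Z_{V_\mu}*e_{\chi_r}$$ satisfies $\mathrm{TO}_{\delta\theta}(\phi_{r,1})=\mathrm{TO}_{\delta\theta}(\phi'_{r,1})$ for every $\delta\in G(F_r)$ whose norm in $G(F)$ is semisimple.
   Context: $F$ is a non-archimedean local field with ring of integers $\mathcal O_F$ and residue field $k_F$ of cardinality $q$; $F_r/F$ is the unramified extension of degree $r$ with ring of integers $\mathcal O_r$ and residue field $k_r$; $\theta$ generates $\mathrm{Gal}(F_r/F)$. $G$ is a split connected reductive group over $F$ (a group scheme over $\mathcal O_F$) with connected center and simply connected derived group, with split maximal torus $T$ and Borel $B\supset T$; $G_r=G(F_r)$; $I_r\subset G(\mathcal O_r)$ is the Iwahori subgroup (preimage of $B(k_r)$) and $I_r^+$ its pro-unipotent radical, so that $I_r/I_r^+\cong T(k_r)$. $\widehat G$ is the dual group over $\mathbb C$. $\mu\in X_*(T)$ is dominant and minuscule ($\langle\mu,\alpha\rangle\in\{-1,0,1\}$ for all roots $\alpha$), $(r_\mu,V_\mu)$ is the irreducible representation of $\widehat G$ with highest weight $\mu$, and $\ell(t_\mu)$ is the length of the translation $t_\mu$ in the extended affine Weyl group. Standing assumption: for each depth-zero character $\chi$ of $T(\mathcal O_F)$, the stabilizer $W_\chi$ of $\chi$ in the Weyl group is generated by the $s_\alpha$ with $\chi\circ\alpha^\vee|_{\mathcal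 O_F^\times}=1$. **Bernstein center element.** It is assumed that LLC+ holds for $G$ over $F_r$: the local Langlands correspondence $\pi\mapsto\varphi_\pi$ holds for $G$ and all its Levi subgroups, is invariant under conjugation isomorphisms between Levi subgroups, and is compatible with normalized parabolic induction in the sense that if $\pi$ is an irreducible subquotient of $i_P^G(\sigma)$ then $\varphi_\pi$ and $\varphi_\sigma$ have $\widehat G$-conjugate restrictions to the Weil group $W_{F_r}$. Under it, $Z_{V_\mu}$ is the element of the Bernstein center of $G_r$ that acts on each irreducible smooth $\pi$ by the semisimple trace $\mathrm{tr}\bigl(r_\mu\lambda(\mathrm{Frob}),V_\mu^{r_\mu\lambda(I)}\bigr)$, where $\lambda=\varphi_\pi|_{W_{F_r}}$, $\mathrm{Frob}$ is a geometric Frobenius and $I$ is the inertia subgroup. Elements of the Bernstein center are regarded as invariant essentially compact distributions, which convolve with functions in $C_c^\infty(G_r)$. The test function is $\phi_{r,1}=q^{r\ell(t_\mu)/2}(Z_{V_\mu}*1_{I_r^+})$, with Haar measure normalized by $\mathrm{vol}(I_r^+)=1$ and $1_{I_r^+}$ the characteristic function. **Depth-zero data.** $T(k_F)^\vee$ is the group of characters of $T(\mathcal O_F)$ factoring through $T(k_F)$; $\chi_r=\chi\circ N_r$ with $N_r:T(\mathcal O_r)\to T(\mathcal O_F)$ the norm; $\rho_{\chi_r}$ is the extension of $\chi_r$ to $I_r$ trivial on $I_r^+$. $e_{\chi_r}=\mathrm{vol}(I_r)^{-1}1_{I_r}^{\rho_{\chi_r}}$, where $1_{I_r}^{\rho}(x)=\rho(x)^{-1}$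 for $x\in I_r$ and $0$ otherwise. $Z_{V_\mu}*e_{\chi_r}$ lies in the center of the algebra $\mathcal H(G_r,I_r,\rho_{\chi_r})$ of $f\in C_c^\infty(G_r)$ with $f(xgy)=\rho_{\chi_r}(x)^{-1}f(g)\rho_{\chi_r}(y)^{-1}$ ($x,y\in I_r$), in which Haar measure is normalized so that $\mathrm{vol}(I_r)=1$. **Twisted orbital integrals.** $\mathrm{TO}_{\delta\theta}(\phi)=\int_{G_{\delta\theta}^\circ(F)\backslash G(F_r)}\phi(g^{-1}\delta\theta(g))\,d\bar g$, where $G_{\delta\theta}(F)=\{g\in G(F_r):g^{-1}\delta\theta(g)=\delta\}$, $G_{\delta\theta}^\circ$ is its identity component and $d\bar g$ is a quotient Haar measure. *)

(* Defs.v *)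
From HB Require Import structures.
From mathcomp Require Import all_boot all_order all_algebra.
From mathcomp Require Import complex.
From mathcomp Require mpoly.
From mathcomp Require Import all_classical all_reals all_analysis.

Set Implicit Arguments.
Unset Strict Implicit.
Unset Printing Implicit Defensive.

Import Order.TTheory GRing.Theory Num.Theory numFieldNormedType.Exports.
Local Open Scope classical_set_scope.
Local Open Scope ring_scope.

Section AbstractGroups.
Local Open Scope group_scope.
Variable gT : groupType.
Implicit Types A B H : set gT.

Definition subgroup H :=
  [/\ H 1, forall x y, H x -> H y -> H (x * y) & forall x, H x -> H x^-1].

Definition generated A : set gT :=
  [set x | forall H, subgroup H -> A `<=` H -> H x].

Definition commutator_subgroup A : set gT :=
  generated [set z | exists x y, [/\ A x, A y & z = x^-1 * y^-1 * x * y]].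

Definition solvable_set A := exists k, iter k commutator_subgroup A `<=` [set 1].

(* [A : B] = k, with representatives of the left cosets a B of B in A. *)
Definition has_index A B (k : nat) :=
  exists s : 'I_k -> gT, (forall i, A (s i)) /\
    forall x, A x -> exists! i, B ((s i)^-1 * x).

Definition index_of A B : nat := xget 0%N [set k | has_index A B k].

Definition conj_set (n : gT) A : set gT := [set n * h * n^-1 | h in A].

Definition normalizes (n : gT) A := conj_set n A = A.

End AbstractGroups.

Section Zariski.
Variables (K : fieldType) (T : Type) (N : nat) (coord : T -> 'I_N -> K).

Definition zclosed (Z : set T) :=
  exists P : set (mpoly.mpoly N K),
    forall x, Z x <-> forall p, P p -> mpoly.meval (coord x) p = 0.

Definition zconnected (X : set T) :=
  forall Z1 Z2, zclosed Z1 -> zclosed Z2 ->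
    X `<=` Z1 `|` Z2 -> X `&` Z1 `&` Z2 = set0 -> X `<=` Z1 \/ X `<=` Z2.

End Zariski.

(* An affine group scheme of finite type over O is given as a closed subgroup   *)
(* scheme of GL_n over O: a set of equations with coefficients in O in the n^2  *)
(* matrix entries, whose solutions in GL_n(S) form a group for every            *)
(* O-algebra f : O -> S.  (For the base rings used here, a discrete valuation   *)
(* ring and C, every flat affine group scheme of finite type is of this form.)  *)
Section GroupScheme.
Variable O : comUnitRingType.

Definition mx_eval (S : comUnitRingType) (f : {rmorphism O -> S}) n
    (g : 'M[S]_n) (p : mpoly.mpoly (n * n) O) : S :=
  mpoly.mmap f (fun k => mxvec g 0 k) p.

Definition mx_points n (P : set (mpoly.mpoly (n * n) O))
    (S : comUnitRingType) (f : {rmorphism O -> S}) : set 'M[S]_n :=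
  [set g | g \in unitmx /\ forall p, P p -> mx_eval f g p = 0].

Record group_scheme := GroupScheme {
  gs_dim : nat;
  gs_eqs : set (mpoly.mpoly (gs_dim * gs_dim) O);
  gs_one : forall (S : comUnitRingType) (f : {rmorphism O -> S}), mx_points gs_eqs f 1%:M;
  gs_mul : forall (S : comUnitRingType) (f : {rmorphism O -> S}) g h,
    mx_points gs_eqs f g -> mx_points gs_eqs f h -> mx_points gs_eqs f (g *m h);
  gs_inv : forall (S : comUnitRingType) (f : {rmorphism O -> S}) g,
    mx_points gs_eqs f g -> mx_points gs_eqs f (invmx g)
}.

Section Points.
Variables (G : group_scheme) (S : comUnitRingType) (f : {rmorphism O -> S}).

(* G(S) *)
Record pts := Pts {
  pt_val :> 'M[S]_(gs_dim G);
  pt_in : `[< mx_points (@gs_eqs G) f pt_val >]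
}.

HB.instance Definition _ := [isSub for pt_val].
HB.instance Definition _ := [Choice of pts by <:].

Definition pt_one : pts := Pts (asboolT (gs_one G f)).
Definition pt_mul (x y : pts) : pts :=
  Pts (asboolT (gs_mul (asboolW (pt_in x)) (asboolW (pt_in y)))).
Definition pt_inv (x : pts) : pts := Pts (asboolT (gs_inv (asboolW (pt_in x)))).

Fact pt_mulA : associative pt_mul.
Proof. by move=> x y z; apply: val_inj; rewrite /= mulmxA. Qed.
Fact pt_mul1 : left_id pt_one pt_mul.
Proof. by move=> x; apply: val_inj; rewrite /= mul1mx. Qed.
Fact pt_1mul : right_id pt_one pt_mul.
Proof. by move=> x; apply: val_inj; rewrite /= mulmx1. Qed.
Fact pt_mulV : left_inverse pt_one pt_inv pt_mul.
Proof.
by move=> x; apply: val_inj; rewrite /= mulVmx//; case: (asboolW (pt_in x)).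
Qed.
Fact pt_Vmul : right_inverse pt_one pt_inv pt_mul.
Proof.
by move=> x; apply: val_inj; rewrite /= mulmxV//; case: (asboolW (pt_in x)).
Qed.

HB.instance Definition _ :=
  isGroup.Build pts pt_mulA pt_mul1 pt_1mul pt_mulV pt_Vmul.
HB.instance Definition _ := isPointed.Build pts pt_one.

Definition pt_coord (g : pts) (k : 'I_(gs_dim G * gs_dim G)) : S :=
  mxvec (pt_val g) 0 k.

End Points.

Section Functoriality.
Variables (G : group_scheme) (S S' : comUnitRingType).
Variables (f : {rmorphism O -> S}) (f' : {rmorphism O -> S'}).
Variables (h : {rmorphism S -> S'}) (hf : forall x, h (f x) = f' x).

Fact mx_eval_map n (g : 'M[S]_n) (p : mpoly.mpoly (n * n) O) :
  mx_eval f' (map_mx h g) p = h (mx_eval f g p).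
Proof.
rewrite /mx_eval /mpoly.mmap rmorph_sum; apply: eq_bigr => m _.
rewrite rmorphM hf; congr (_ * _).
rewrite /mpoly.mmap1 rmorph_prod; apply: eq_bigr => k _.
by rewrite rmorphXn /= -map_mxvec mxE.
Qed.

Fact pts_map_in (g : pts G f) :
  `[< mx_points (@gs_eqs G) f' (map_mx h (pt_val g)) >].
Proof.
apply/asboolP; have /asboolP[gu gP] := pt_in g; split.
  by rewrite unitmxE det_map_mx; apply: rmorph_unit; rewrite -unitmxE.
by move=> p Pp; rewrite mx_eval_map gP// rmorph0.
Qed.

(* G(h) : G(S) -> G(S') *)
Definition pts_map (g : pts G f) : pts G f' := Pts (pts_map_in g).

End Functoriality.
End GroupScheme.

Section SplitTorus.
Variables (d : nat) (S : comUnitRingType).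

(* G_m^d (S) *)
Record Gm := MkGm {
  Gm_val :> 'rV[S]_d;
  Gm_unit : [forall i, Gm_val 0 i \is a GRing.unit]
}.

HB.instance Definition _ := [isSub for Gm_val].
HB.instance Definition _ := [Choice of Gm by <:].

Fact Gm_unitE (t : Gm) i : Gm_val t 0 i \is a GRing.unit.
Proof. by move/forallP: (Gm_unit t). Qed.

Fact Gm_rowP (u : 'I_d -> S) : (forall i, u i \is a GRing.unit) ->
  [forall i, (\row_j u j) 0 i \is a GRing.unit].
Proof. by move=> uP; apply/forallP => i; rewrite mxE. Qed.

Definition Gm_one : Gm := MkGm (Gm_rowP (fun _ : 'I_d => unitr1 S)).
Definition Gm_mul (s t : Gm) : Gm :=
  MkGm (@Gm_rowP (fun i => s 0 i * t 0 i)
          (fun i => etrans (unitrMl _ (Gm_unitE t i)) (Gm_unitE s i))).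
Definition Gm_inv (t : Gm) : Gm :=
  MkGm (@Gm_rowP (fun i => (t 0 i)^-1)
          (fun i => etrans (unitrV _) (Gm_unitE t i))).

Fact Gm_mulA : associative Gm_mul.
Proof.
by move=> x y z; apply/val_inj/rowP => i; rewrite /= !mxE mulrA.
Qed.
Fact Gm_mul1 : left_id Gm_one Gm_mul.
Proof. by move=> x; apply/val_inj/rowP => i; rewrite /= !mxE mul1r. Qed.
Fact Gm_1mul : right_id Gm_one Gm_mul.
Proof. by move=> x; apply/val_inj/rowP => i; rewrite /= !mxE mulr1. Qed.
Fact Gm_mulV : left_inverse Gm_one Gm_inv Gm_mul.
Proof.
by move=> x; apply/val_inj/rowP => i; rewrite /= !mxE mulVr// Gm_unitE.
Qed.
Fact Gm_Vmul : right_inverse Gm_one Gm_inv Gm_mul.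
Proof.
by move=> x; apply/val_inj/rowP => i; rewrite /= !mxE mulrV// Gm_unitE.
Qed.

HB.instance Definition _ :=
  isGroup.Build Gm Gm_mulA Gm_mul1 Gm_1mul Gm_mulV Gm_Vmul.

End SplitTorus.

Section SplitTorusMaps.
Variables (S S' : comUnitRingType).

Fact Gm_map_in (h : {rmorphism S -> S'}) d (t : Gm d S) :
  [forall i, (map_mx h (Gm_val t)) 0 i \is a GRing.unit].
Proof. by apply/forallP => i; rewrite mxE; apply/rmorph_unit/Gm_unitE. Qed.

Definition Gm_map (h : {rmorphism S -> S'}) d (t : Gm d S) : Gm d S' :=
  MkGm (Gm_map_in h t).

Fact Gm_act_in d e (M : 'M[int]_(d, e)) (t : Gm d S) j :
  \prod_i (t 0 i) ^ (M i j) \is a GRing.unit.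
Proof. by apply: rpred_prod => i _; apply/unitrXz/Gm_unitE. Qed.

(* The homomorphism G_m^d -> G_m^e with j-th coordinate \prod_i t_i^(M i j).    *)
(* Cocharacters of G_m^d are identified with row vectors l : 'rV[int]_d, the    *)
(* cocharacter being Gm_act l : G_m -> G_m^d; characters are also identified    *)
(* with row vectors a, the character being Gm_act a^T : G_m^d -> G_m.  In these *)
(* coordinates Gm_act M sends the cocharacter l to l *m M.                      *)
Definition Gm_act d e (M : 'M[int]_(d, e)) (t : Gm d S) : Gm e S :=
  MkGm (Gm_rowP (Gm_act_in M t)).

Definition Gm_char d (a : 'rV[int]_d) (t : Gm d S) : S := Gm_act a^T t 0 0.

End SplitTorusMaps.

Definition pairing d (a l : 'rV[int]_d) : int := (a *m l^T) 0 0.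

Section Reductive.
Variable O : comUnitRingType.

Section OverAField.
Variables (G : group_scheme O) (K : fieldType) (f : {rmorphism O -> K}).

Definition zcl (X : set (pts G f)) := zclosed (@pt_coord O G K f) X.
Definition zcn (X : set (pts G f)) := zconnected (@pt_coord O G K f) X.

Definition unipotent (g : pts G f) :=
  char_poly (pt_val g) = ('X - 1) ^+ gs_dim G.

Definition mx_diagonalizable n (A : 'M[K]_n) :=
  exists2 P, P \in unitmx & is_diag_mx (P *m A *m invmx P).

(* Tangent space at 1 of the closed subscheme of GL_n with equations P, i.e.    *)
(* the X such that 1 + eps X satisfies P over the dual numbers K[eps].          *)
Definition lie (P : set (mpoly.mpoly (gs_dim G * gs_dim G) O)) :
    set 'M[K]_(gs_dim G) :=
  [set X | forall p, P p ->
     \sum_k mx_eval f (1%:M : 'M[K]_(gs_dim G)) (mpoly.mderiv k p)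
            * mxvec X 0 k = 0].

End OverAField.

(* The following notions are used for algebraically closed K, when a smooth     *)
(* closed subgroup is determined by its K-points.                               *)
Section Geometric.
Variables (G : group_scheme O) (K : closedFieldType) (f : {rmorphism O -> K}).

Definition connected_reductive :=
  zcn [set: pts G f] /\
  forall U : set (pts G f), zcl U -> zcn U -> subgroup U ->
    (forall g, normalizes g U) -> (forall u, U u -> unipotent u) ->
    U `<=` [set 1%g].

Definition is_torus (X : set (pts G f)) :=
  [/\ subgroup X, zcl X, zcn X &
   exists2 P : 'M[K]_(gs_dim G), P \in unitmx &
     forall x, X x -> is_diag_mx (P *m pt_val x *m invmx P)].

Definition is_maximal_torus (X : set (pts G f)) :=
  is_torus X /\ forall Y, is_torus Y -> X `<=` Y -> Y `<=` X.

Definition connected_solvable (X : set (pts G f)) :=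
  [/\ subgroup X, zcl X, zcn X & solvable_set X].

Definition is_borel (X : set (pts G f)) :=
  connected_solvable X /\
  forall Y, connected_solvable Y -> X `<=` Y -> Y `<=` X.

End Geometric.

(* Infinitesimal lifting criterion, for a subfunctor X of G (smoothness, as all *)
(* schemes here are of finite presentation).                                    *)
Definition formally_smooth (G : group_scheme O)
    (X : forall (S : comUnitRingType) (f : {rmorphism O -> S}), set (pts G f)) :=
  forall (S S' : comUnitRingType) (f : {rmorphism O -> S})
    (f' : {rmorphism O -> S'}) (h : {rmorphism S -> S'})
    (hf : forall x, h (f x) = f' x),
    (forall y, exists x, h x = y) ->
    (forall x y, h x = 0 -> h y = 0 -> x * y = 0) ->
    forall g', X S' f' g' -> exists2 g, X S f g & pts_map hf g = g'.

Definition closed_points (G : group_scheme O)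
    (P : set (mpoly.mpoly (gs_dim G * gs_dim G) O))
    (S : comUnitRingType) (f : {rmorphism O -> S}) : set (pts G f) :=
  [set g | forall p, P p -> mx_eval f (pt_val g) p = 0].
Arguments closed_points : clear implicits.

(* A reductive group scheme G over O with a split maximal torus T, given as an  *)
(* isomorphism sr_tor of G_m^d onto T (so that X_*(T) and X^*(T) are identified *)
(* with 'rV[int]_d as explained at Gm_act), and a Borel subgroup scheme B       *)
(* containing T.  Fibrewise conditions are on geometric fibres.                 *)
Record split_reductive (d : nat) := SplitReductive {
  sr_gs :> group_scheme O;
  sr_smooth : formally_smooth (fun S (f : {rmorphism O -> S}) =>
    [set: pts sr_gs f]);
  sr_red : forall (K : closedFieldType) (f : {rmorphism O -> K}),
    connected_reductive sr_gs f;
  sr_tor : forall (S : comUnitRingType) (f : {rmorphism O -> S}),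
    Gm d S -> pts sr_gs f;
  sr_torM : forall (S : comUnitRingType) (f : {rmorphism O -> S}) (s t : Gm d S),
    sr_tor f (s * t)%g = (sr_tor f s * sr_tor f t)%g;
  sr_tor_inj : forall (S : comUnitRingType) (f : {rmorphism O -> S}), injective (sr_tor f);
  sr_tor_nat : forall (S S' : comUnitRingType) (f : {rmorphism O -> S})
    (f' : {rmorphism O -> S'}) (h : {rmorphism S -> S'})
    (hf : forall x, h (f x) = f' x) t,
    pts_map hf (sr_tor f t) = sr_tor f' (Gm_map h t);
  sr_tor_max : forall (K : closedFieldType) (f : {rmorphism O -> K}),
    is_maximal_torus (range (sr_tor f));
  sr_bor : set (mpoly.mpoly (gs_dim sr_gs * gs_dim sr_gs) O);
  sr_bor_sub : forall (S : comUnitRingType) (f : {rmorphism O -> S}),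
    subgroup (closed_points sr_gs sr_bor S f);
  sr_bor_smooth : formally_smooth (fun S (f : {rmorphism O -> S}) =>
    (closed_points sr_gs sr_bor S f));
  sr_bor_borel : forall (K : closedFieldType) (f : {rmorphism O -> K}),
    is_borel (closed_points sr_gs sr_bor K f);
  sr_bor_tor : forall (S : comUnitRingType) (f : {rmorphism O -> S}),
    range (sr_tor f) `<=` closed_points sr_gs sr_bor S f
}.

(* Root data, computed over an infinite field K (so that a character or a       *)
(* homomorphism of split tori is determined by its values on K-points).         *)
Section RootDatum.
Variables (d : nat) (G : split_reductive d).
Variables (K : fieldType) (f : {rmorphism O -> K}).

Definition weight_of_lie P (a : 'rV[int]_d) :=
  exists X : 'M[K]_(gs_dim G), [/\ X != 0, lie f P X &
    forall t : Gm d K, pt_val (sr_tor G f t) *m X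
                       = Gm_char a t *: (X *m pt_val (sr_tor G f t))].

Definition is_root (a : 'rV[int]_d) := a <> 0 /\ weight_of_lie (@gs_eqs _ G) a.

Definition is_pos_root (a : 'rV[int]_d) :=
  a <> 0 /\ weight_of_lie (@gs_eqs _ G `|` @sr_bor _ G) a.

(* n normalizes T and acts on T as Gm_act M. *)
Definition induces (n : pts G f) (M : 'M[int]_d) :=
  forall t : Gm d K, (n * sr_tor G f t * n^-1)%g = sr_tor G f (Gm_act M t).

Definition weyl (M : 'M[int]_d) := exists n, induces n M.

Definition reflection (a c : 'rV[int]_d) : 'M[int]_d := 1%:M - a^T *m c.

(* c is the coroot of a: <a, c> = 2, and the reflection t |-> t c(a(t))^-1 is   *)
(* an element of the Weyl group N_G(T)/T.                                       *)
Definition root_coroot (a c : 'rV[int]_d) :=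
  [/\ is_root a, pairing a c = 2 & weyl (reflection a c)].

Definition dominant (l : 'rV[int]_d) := forall a, is_pos_root a -> 0 <= pairing a l.

Definition minuscule (l : 'rV[int]_d) := forall a, is_root a ->
  [\/ pairing a l = -1, pairing a l = 0 | pairing a l = 1].

(* The extended affine Weyl group X_*(T) ><| W; (l, w) acts on X_*(T) (x) R by  *)
(* x |-> w x + l, hence sends the affine function a + k to                      *)
(* wa + (k - <wa, l>), where wa is the row vector a *m (w^-1)^T.  The length is *)
(* the number of positive affine roots sent to negative ones, an affine root    *)
(* a + k being positive if k > 0, or k = 0 and a > 0.                           *)
Definition affine_root (ak : 'rV[int]_d * int) := is_root ak.1.

Definition affine_pos (ak : 'rV[int]_d * int) :=
  0 < ak.2 \/ (ak.2 = 0 /\ is_pos_root ak.1).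

Definition affine_act (x : 'rV[int]_d * 'M[int]_d) (ak : 'rV[int]_d * int) :=
  let wa := ak.1 *m (invmx x.2)^T in (wa, ak.2 - pairing wa x.1).

Definition affine_length (x : 'rV[int]_d * 'M[int]_d) (n : nat) :=
  ([set ak | [/\ affine_root ak, affine_pos ak & ~ affine_pos (affine_act x ak)]]
   #= `I_n)%card.

Definition translation (l : 'rV[int]_d) : 'rV[int]_d * 'M[int]_d := (l, 1%:M).

End RootDatum.
End Reductive.
Arguments closed_points {O} G P S f.
Arguments sr_bor {O d} _ _.

(* Smallest subgroup, resp. submonoid, of a lattice containing A. *)
Definition zspan (V : zmodType) (A : set V) : set V :=
  [set x | forall H : set V, A `<=` H -> H 0 ->
     (forall y z, H y -> H z -> H (y - z)) -> H x].
Definition nspan (V : zmodType) (A : set V) : set V :=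
  [set x | forall H : set V, A `<=` H -> H 0 ->
     (forall y z, H y -> H z -> H (y + z)) -> H x].

(* Smallest subgroup of GL_d(Z) containing A. *)
Definition mx_generated d (A : set 'M[int]_d) : set 'M[int]_d :=
  [set x | forall H : set 'M[int]_d, A `<=` H -> H 1%:M ->
     (forall y z, H y -> H z -> H (y *m z)) ->
     (forall y, H y -> H (invmx y)) -> H x].

Section GlobalConditions.
Variables (O : comUnitRingType) (d : nat) (G : split_reductive O d).
Variables (K : closedFieldType) (f : {rmorphism O -> K}).

Definition connected_center :=
  zcn [set z : pts G f | forall g, (z * g = g * z)%g].

(* X_*(T \cap G_der) is spanned by the coroots. *)
Definition simply_connected_derived :=
  forall l : 'rV[int]_d,
    (forall z : Gm 1 K, commutator_subgroup [set: pts G f]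
                          (sr_tor G f (Gm_act l z))) ->
    zspan [set c | exists a, root_coroot G f a c] l.

End GlobalConditions.

Section Valuation.
Variables (K : fieldType) (v : K -> int).

(* v x >= N, with v 0 = +oo. *)
Definition vge (N : int) (x : K) := (x == 0) || (N <= v x).

Definition v_cauchy (u : nat -> K) := forall N, exists m, forall i j,
  (m <= i)%N -> (m <= j)%N -> vge N (u i - u j).

Definition v_converges (u : nat -> K) (l : K) := forall N, exists m, forall i,
  (m <= i)%N -> vge N (u i - l).

End Valuation.

(* The ring of integers and the residue field are part of the data, as lf_O     *)
(* (embedded in the field by lf_inc) and lf_k (a quotient of lf_O by lf_red).   *)
Record local_field := LocalField {
  lf_K :> fieldType;
  lf_O : idomainType;
  lf_k : finFieldType;
  lf_inc : {rmorphism lf_O -> lf_K};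
  lf_red : {rmorphism lf_O -> lf_k};
  lf_val : lf_K -> int;
  lf_valM : forall x y, x != 0 -> y != 0 -> lf_val (x * y) = lf_val x + lf_val y;
  lf_valD : forall N x y, vge lf_val N x -> vge lf_val N y ->
    vge lf_val N (x + y);
  lf_val1 : exists2 x, x != 0 & lf_val x = 1;
  lf_complete : forall u, v_cauchy lf_val u -> exists l, v_converges lf_val u l;
  lf_inc_inj : injective lf_inc;
  lf_integers : forall x, (exists a, lf_inc a = x) <-> vge lf_val 0 x;
  lf_red_surj : forall y, exists a, lf_red a = y;
  lf_red_ker : forall a, lf_red a = 0 <-> vge lf_val 1 (lf_inc a)
}.

(* E = F_r is unramified of degree r over F, and ue_theta generates Gal(E/F). *)
Record unramified_ext (F E : local_field) (r : nat) := UnramifiedExt {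
  ue_K : {rmorphism lf_K F -> lf_K E};
  ue_O : {rmorphism lf_O F -> lf_O E};
  ue_compat : forall a, lf_inc E (ue_O a) = ue_K (lf_inc F a);
  ue_unram : forall x, x != 0 -> lf_val (ue_K x) = lf_val x;
  ue_degree : exists b : 'I_r -> lf_K E, forall y,
    exists! c : {ffun 'I_r -> lf_K F}, y = \sum_i ue_K (c i) * b i;
  ue_theta : {rmorphism lf_K E -> lf_K E};
  ue_thetaO : {rmorphism lf_O E -> lf_O E};
  ue_theta_compat : forall a, lf_inc E (ue_thetaO a) = ue_theta (lf_inc E a);
  ue_theta_fix : forall x, ue_theta (ue_K x) = ue_K x;
  ue_theta_gen : forall s : {rmorphism lf_K E -> lf_K E},
    (forall x, s (ue_K x) = ue_K x) -> exists k, forall y, s y = iter k ue_theta y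
}.

HB.structure Definition TopGroup := {T of Group T & PointedTopological T}.

Definition padic_points (O : comUnitRingType) (G : group_scheme O)
  (E : local_field) (f : {rmorphism O -> lf_K E}) : Type := pts G f.

Section PadicTopology.
Variables (O : comUnitRingType) (G : group_scheme O).
Variables (E : local_field) (f : {rmorphism O -> lf_K E}).
Local Notation gT := (padic_points G f).

HB.instance Definition _ := Group.on gT.
HB.instance Definition _ := Pointed.on gT.

Definition mx_vge (N : int) m n (A : 'M[lf_K E]_(m, n)) :=
  forall i j, vge (@lf_val E) N (A i j).

Definition padic_open (U : set gT) := forall x, U x -> exists N, forall y : gT,
  mx_vge N (pt_val y - pt_val x) -> U y.

Fact padic_openT : padic_open setT.
Proof. by move=> x _; exists 0. Qed.

Fact padic_openI : setI_closed padic_open.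
Proof.
move=> U V oU oV x [Ux Vx]; have [M hM] := oU x Ux; have [N hN] := oV x Vx.
exists (Num.max M N) => y hy; split.
- apply: hM => i j; have := hy i j; rewrite /vge.
  by case: (_ == 0) => //=; rewrite ge_max => /andP[].
- apply: hN => i j; have := hy i j; rewrite /vge.
  by case: (_ == 0) => //=; rewrite ge_max => /andP[].
Qed.

Fact padic_open_bigU (I : Type) (U : I -> set gT) :
  (forall i, padic_open (U i)) -> padic_open (\bigcup_i U i).
Proof.
move=> oU x [i _ Ux]; have [N hN] := oU i x Ux.
by exists N => y hy; exists i => //; apply: hN.
Qed.

HB.instance Definition _ :=
  isOpenTopological.Build gT padic_openT padic_openI padic_open_bigU.

End PadicTopology.

Section Smooth.
Variables (R : realType) (gT : TopGroup.type).
Local Notation C := R[i].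
Implicit Types (f : gT -> C) (D : (gT -> C) -> C) (H : set gT).

(* C_c^oo *)
Definition test_function f :=
  (forall x, exists U, [/\ open U, U x & forall y, U y -> f y = f x]) /\
  exists2 A : set gT, compact A & forall x, f x != 0 -> A x.

Definition char_fun (A : set gT) : gT -> C := fun x => (`[< A x >])%:R.

(* Convolution with a distribution D, thought of as a measure on gT:            *)
(* (D * f)(g) = \int f(x^-1 g) dD(x).  If D = h dx this is the usual h * f.     *)
Definition dconv D f : gT -> C := fun g => D (fun x => f (x^-1 * g)%g).

(* Elements of the Bernstein center: invariant, essentially compact             *)
(* distributions.                                                               *)
Definition bernstein_center D :=
  [/\ forall (a : C) f1 f2, test_function f1 -> test_function f2 ->
        D (fun x => a * f1 x + f2 x) = a * D f1 + D f2,
      forall f g, test_function f -> D (fun x => f (g * x * g^-1)%g) = D f &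
      forall f, test_function f -> test_function (dconv D f)].

(* Irreducible smooth representations of a subgroup H; only the values of       *)
(* ir_act on H matter.                                                          *)
Record irrep H := Irrep {
  ir_V : lmodType C;
  ir_act : gT -> ir_V -> ir_V;
  ir_lin : forall h, H h -> forall (a : C) u v,
    ir_act h (a *: u + v) = a *: ir_act h u + ir_act h v;
  ir_one : forall v, ir_act 1%g v = v;
  ir_mul : forall h k, H h -> H k -> forall v,
    ir_act (h * k)%g v = ir_act h (ir_act k v);
  ir_smooth : forall v, exists2 U : set gT, open U /\ U 1%g &
    forall h, H h -> U h -> ir_act h v = v;
  ir_nonzero : exists v : ir_V, v <> 0;
  ir_irred : forall W : set ir_V, W 0 ->
    (forall (a : C) u v, W u -> W v -> W (a *: u + v)) ->
    (forall h v, H h -> W v -> W (ir_act h v)) ->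
    W `<=` [set 0] \/ W = setT
}.
Arguments ir_act {H} _ _ _.

(* The representations s of H and s' of n H n^-1 correspond to each other under *)
(* the isomorphism h |-> n h n^-1; for n = 1, s and s' are isomorphic.          *)
Definition conj_isomorphic H H' (n : gT) (s : irrep H) (s' : irrep H') :=
  exists J : ir_V s -> ir_V s', [/\ bijective J,
    forall (a : C) u v, J (a *: u + v) = a *: J u + J v &
    forall h v, H h -> J (ir_act s h v) = ir_act s' (n * h * n^-1)%g (J v)].

(* The action of D on the K-invariants of pi is that of the compactly supported *)
(* measure D * (1_K dg / vol(K)), i.e.                                          *)
(* v |-> \sum_(g in gT / K) (D * 1_K)(g) pi(g) v.                               *)
Definition acts_by D (p : irrep [set: gT]) (c : C) :=
  forall (K : set gT) (v : ir_V p), subgroup K -> open K -> compact K ->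
    (forall k, K k -> ir_act p k v = v) ->
    forall (n : nat) (s : 'I_n -> gT),
      (forall i j, K ((s i)^-1 * s j)%g -> i = j) ->
      (forall x, dconv D (char_fun K) x != 0 -> exists i, K ((s i)^-1 * x)%g) ->
      \sum_(i < n) dconv D (char_fun K) (s i) *: ir_act p (s i) v = c *: v.

Definition is_haar (vol : {measure set (g_sigma_algebraType (@open gT)) -> \bar R}) :=
  [/\ forall (g : gT) (A : set gT), <<s @open gT >> A ->
        vol [set (g * x)%g | x in A] = vol A,
      forall A : set gT, compact A -> (vol A < +oo)%E &
      forall U : set gT, open U -> U !=set0 -> (0 < vol U)%E].

(* A quotient Haar measure on H \ gT.  Borel sets of H \ gT are identified with *)
(* their preimages in gT, the elements of the sigma-algebra generated by the    *)
(* open left-H-invariant subsets of gT; functions on H \ gT are left-H-invariant*)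
(* functions on gT.                                                             *)
Definition left_invariant H (A : set gT) := forall h x, H h -> A x -> A (h * x)%g.

Definition quot_open H : set (set gT) := [set U | open U /\ left_invariant H U].

Definition quot H := g_sigma_algebraType (quot_open H).

Definition mul_sets (A B : set gT) : set gT :=
  [set x | exists a b, [/\ A a, B b & x = (a * b)%g]].

Definition is_quotient_haar H (nu : {measure set (quot H) -> \bar R}) :=
  [/\ forall (g : gT) (A : set gT), <<s quot_open H >> A ->
        nu [set (x * g)%g | x in A] = nu A,
      forall A : set gT, compact A -> (nu (mul_sets H A) < +oo)%E &
      forall U : set gT, quot_open H U -> U !=set0 -> (0 < nu U)%E].

(* The integral of f over H \ gT.  It is the Lebesgue integral of f as soon as  *)
(* that integral converges absolutely (for instance if f is locally constant    *)
(* with compact support in H \ gT).  Lebesgue integrals that do not converge    *)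
(* are given the value of the corresponding improper integral, the limit of the *)
(* integrals over the relatively compact subsets of H \ gT that are stable      *)
(* under the compact open subgroup K0; on absolutely convergent integrals both  *)
(* values agree.                                                                *)
Definition exhausting H (K0 : set gT) : set (set gT) :=
  [set W | mul_sets W K0 = W /\ exists2 A, compact A & W = mul_sets H A].

Definition exhaustion H (K0 : set gT) : set_system (set gT) :=
  filter_from (exhausting H K0) (fun W => [set W' | exhausting H K0 W' /\ W `<=` W']).

Definition quotient_integral_real H (K0 : set gT)
    (nu : {measure set (quot H) -> \bar R}) (f : quot H -> R) : R :=
  if `[< nu.-integrable setT (EFin \o f) >]
  then Rintegral nu setT f
  else lim ((fun W : set gT => Rintegral nu (W : set (quot H)) f)
            @ exhaustion H K0).

Definition quotient_integral H (K0 : set gT)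
    (nu : {measure set (quot H) -> \bar R}) (f : gT -> C) : C :=
  (quotient_integral_real K0 nu (fun x => complex.Re (f x))
   +i* quotient_integral_real K0 nu (fun x => complex.Im (f x)))%C.

End Smooth.
Arguments ir_act {R gT H} _ _ _.

Section PadicGroup.
Variables (F E : local_field) (r : nat) (X : unramified_ext F E r).
Variables (d : nat) (G : split_reductive (lf_O F) d).

(* Structure maps from O_F to F_r and to k_r. *)
Definition str_E : {rmorphism lf_O F -> lf_K E} :=
  GRing.RMorphism.clone _ _ (lf_inc E \o ue_O X) _.
Definition str_k : {rmorphism lf_O F -> lf_k E} :=
  GRing.RMorphism.clone _ _ (lf_red E \o ue_O X) _.

Local Notation Gr := (padic_points G str_E).

Definition incl_pts : pts G (ue_O X) -> Gr :=
  @pts_map _ G _ _ (ue_O X) str_E (lf_inc E) (fun=> erefl).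

Definition red_pts : pts G (ue_O X) -> pts G str_k :=
  @pts_map _ G _ _ (ue_O X) str_k (lf_red E) (fun=> erefl).

Fact ue_theta_str (x : lf_O F) : ue_theta X (str_E x) = str_E x.
Proof. by rewrite /= ue_compat ue_theta_fix. Qed.

Definition theta : Gr -> Gr := pts_map ue_theta_str.

Definition tor_E (t : Gm d (lf_K E)) : Gr := sr_tor G str_E t.
Definition tor_O (t : Gm d (lf_O E)) : Gr := incl_pts (sr_tor G (ue_O X) t).

Definition hyperspecial : set Gr := range incl_pts.

Definition iwahori : set Gr :=
  [set incl_pts x | x in [set x | closed_points G (sr_bor G) _ _ (red_pts x)]].

(* Preimage of the unipotent radical of B(k_r), i.e. of the set of its          *)
(* unipotent elements.                                                          *)
Definition iwahori_plus : set Gr :=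
  [set incl_pts x | x in [set x |
     closed_points G (sr_bor G) _ _ (red_pts x) /\ unipotent (red_pts x)]].

(* The cocharacter l determines the parabolic subgroup P_l = M_l U_l of the g   *)
(* such that l(z) g l(z)^-1 has a limit for z --> 0, with Levi factor M_l the   *)
(* centralizer of l and unipotent radical U_l the g for which the limit is 1.   *)
(* These are all the parabolic subgroups with Levi factor containing T; every   *)
(* parabolic subgroup and every Levi subgroup is conjugate to one of these.     *)
Definition levi (l : 'rV[int]_d) : set Gr :=
  [set g | forall z : Gm 1 (lf_K E),
     (tor_E (Gm_act l z) * g = g * tor_E (Gm_act l z))%g].

Definition unipotent_radical (l : 'rV[int]_d) : set Gr :=
  [set g | forall N, exists M, forall z : Gm 1 (lf_K E),
     M <= lf_val (Gm_val z 0 0) ->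
     mx_vge N (pt_val (tor_E (Gm_act l z) * g * (tor_E (Gm_act l z))^-1)%g
               - 1%:M)].

Variable R : realType.
Local Notation C := R[i].

(* delta_P(m) = vol(m K m^-1) / vol(K), for K compact open in U_l. *)
Definition is_modulus (l : 'rV[int]_d) (m : Gr) (x : R) :=
  exists (K : set Gr) (a b : nat),
    [/\ [/\ subgroup K, compact K &
            exists2 V : set Gr, open V & K = unipotent_radical l `&` V],
        has_index (conj_set m K) (conj_set m K `&` K) a,
        has_index K (conj_set m K `&` K) b & x = a%:R / b%:R].

(* The space of i_P^G(s), acted on by right translations. *)
Definition induced (l : 'rV[int]_d) (s : irrep R (levi l)) : set (Gr -> ir_V s) :=
  [set phi |
    (forall m u g x, levi l m -> unipotent_radical l u -> is_modulus l m x ->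
       phi (m * u * g)%g = (Num.sqrt x)%:C%C *: ir_act s m (phi g)) /\
    exists2 U : set Gr, open U /\ U 1%g &
      forall g k, U k -> phi (g * k)%g = phi g].
Arguments induced {l} s _.

(* p is isomorphic to a quotient of an invariant subspace A of i_P^G(s). *)
Definition subquotient_of_induced (l : 'rV[int]_d) (s : irrep R (levi l))
    (p : irrep R [set: Gr]) :=
  exists (A : set (Gr -> ir_V s)) (J : (Gr -> ir_V s) -> ir_V p),
    [/\ A `<=` induced s /\ A (fun=> 0),
        forall (a : C) phi psi, A phi -> A psi ->
          A (fun x => a *: phi x + psi x) /\
          J (fun x => a *: phi x + psi x) = a *: J phi + J psi,
        forall g phi, A phi -> A (fun x => phi (x * g)%g) /\
          J (fun x => phi (x * g)%g) = ir_act p g (J phi) &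
        forall v, exists2 phi, A phi & J phi = v].

Definition torus_dual : set (Gm d (lf_k F) -> C) :=
  [set chi | chi 1%g = 1 /\ forall s t, chi (s * t)%g = chi s * chi t].

(* The inflation of chi to T(O_F). *)
Definition inflate (chi : Gm d (lf_k F) -> C) (t : Gm d (lf_O F)) : C :=
  chi (Gm_map (lf_red F) t).

(* N_r : T(O_r) -> T(O_F) *)
Definition norm_T (t : Gm d (lf_O E)) : Gm d (lf_O F) :=
  xget 1%g [set u : Gm d (lf_O F) | forall i,
    ue_O X (Gm_val u 0 i) = \prod_(k < r) iter k (ue_thetaO X) (Gm_val t 0 i)].

(* rho_{chi_r}(t u) = chi_r(t), for t in T(O_r) and u in I_r^+. *)
Definition rho_chi (chi : Gm d (lf_k F) -> C) (x : Gr) : C :=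
  xget 0 [set c | exists t, iwahori_plus ((tor_O t)^-1 * x)%g /\
                            c = inflate chi (norm_T t)].

Definition e_chi (vol : {measure set (g_sigma_algebraType (@open Gr)) -> \bar R})
    (chi : Gm d (lf_k F) -> C) : Gr -> C :=
  fun x => if `[< iwahori x >]
           then ((fine (vol iwahori))^-1)%:C%C * (rho_chi chi x)^-1 else 0.

(* W_chi is generated by the s_a with chi o a^vee = 1 on O_F^*. *)
Definition stabilizer_generated_by_reflections (chi : Gm d (lf_k F) -> C) :=
  [set w | weyl G (lf_inc F) w /\
           forall t, inflate chi (Gm_act w t) = inflate chi t] =
  mx_generated [set s | exists a c, [/\ root_coroot G (lf_inc F) a c,
    forall u : Gm 1 (lf_O F), inflate chi (Gm_act c u) = 1 &
    s = reflection a c]].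

Definition q_power (l : nat) : C :=
  (Num.sqrt ((#|lf_k F|%:R : R) ^+ (r * l)))%:C%C.

Definition phi_r1 (Z : (Gr -> C) -> C) (l : nat) : Gr -> C :=
  fun g => q_power l * dconv Z (char_fun R iwahori_plus) g.

Definition phi'_r1 (vol : {measure set (g_sigma_algebraType (@open Gr)) -> \bar R})
    (Z : (Gr -> C) -> C) (l : nat) : Gr -> C :=
  fun g => (index_of iwahori iwahori_plus)%:R^-1 * q_power l *
    \sum_(chi \in torus_dual) dconv Z (e_chi vol chi) g.

Section TwistedConjugacy.
Variables (Fbar : closedFieldType) (iota : {rmorphism lf_K E -> Fbar}).

Definition str_bar : {rmorphism lf_O F -> Fbar} :=
  GRing.RMorphism.clone _ _ (iota \o str_E) _.
Definition bar_F : {rmorphism lf_K F -> Fbar} :=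
  GRing.RMorphism.clone _ _ (iota \o ue_K X) _.

Definition bar_E_pts : Gr -> pts G str_bar :=
  @pts_map _ G _ _ str_E str_bar iota (fun=> erefl).

Fact bar_F_str (x : lf_O F) : bar_F (lf_inc F x) = str_bar x.
Proof. by rewrite /= ue_compat. Qed.

Definition bar_F_pts : pts G (lf_inc F) -> pts G str_bar := pts_map bar_F_str.

Definition concrete_norm (delta : Gr) : Gr :=
  \big[*%g/1%g]_(i < r) iter i theta delta.

(* gamma in G(F) is a norm of delta: the element delta theta(delta) ...         *)
(* theta^(r-1)(delta) is conjugate to gamma over an algebraic closure.          *)
Definition is_norm (delta : Gr) (gamma : pts G (lf_inc F)) :=
  exists x : pts G str_bar,
    (x * bar_F_pts gamma * x^-1)%g = bar_E_pts (concrete_norm delta).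

Definition semisimple (gamma : pts G (lf_inc F)) :=
  mx_diagonalizable (pt_val (bar_F_pts gamma)).

(* Twisted centralizers are algebraic subgroups of Res_{E/F} G.  Its points     *)
(* over Fbar are G(Fbar (x)_F E) = G(Fbar)^r, by the isomorphism                *)
(* y (x) x |-> (y iota(theta^i x))_i of Fbar (x)_F E with Fbar^r; under it,     *)
(* 1 (x) theta is the cyclic shift (ordS i is i + 1 modulo r).                  *)
Definition res_pts := 'I_r -> pts G str_bar.

Definition res_embed (g : Gr) : res_pts := fun i => bar_E_pts (iter i theta g).

Definition res_coord (g : res_pts) : 'I_(r * (gs_dim G * gs_dim G)) -> Fbar :=
  fun k => mxvec (\matrix_(i, j) pt_coord (g i) j) 0 k.

Definition twisted_centralizer_bar (delta : Gr) : set res_pts :=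
  [set g | forall i,
    ((g i)^-1 * res_embed delta i * g (ordS i))%g = res_embed delta i].

(* G_{delta theta}^o(F): the g in G_{delta theta}(F) lying in the connected     *)
(* component of 1 of the twisted centralizer over Fbar.                         *)
Definition twisted_centralizer_id (delta : Gr) : set Gr :=
  [set g | (g^-1 * delta * theta g)%g = delta /\
    exists Y : set res_pts,
      [/\ zconnected res_coord Y, Y `<=` twisted_centralizer_bar delta,
          Y (fun=> 1%g) & Y (res_embed g)]].

End TwistedConjugacy.
End PadicGroup.
Arguments hyperspecial {F E r} X {d} G _.
Arguments iwahori {F E r} X {d} G _.
Arguments iwahori_plus {F E r} X {d} G _.
Arguments levi {F E r} X {d} G l _.
Arguments theta {F E r} X {d G} _.

Section TwistedOrbitalIntegral.
Variables (F E : local_field) (r : nat) (X : unramified_ext F E r).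
Variables (d : nat) (G : split_reductive (lf_O F) d).
Variables (Fbar : closedFieldType) (iota : {rmorphism lf_K E -> Fbar}).
Variable R : realType.
Local Notation Gr := (padic_points G (str_E X)).

Definition TO (delta : Gr)
    (nu : {measure set (quot (twisted_centralizer_id iota delta)) -> \bar R})
    (phi : Gr -> R[i]) : R[i] :=
  quotient_integral (hyperspecial X G) nu
    (fun g => phi (g^-1 * delta * theta X g)%g).

End TwistedOrbitalIntegral.

Definition is_algebraic_closure (K : fieldType) (Kbar : closedFieldType)
    (iota : {rmorphism K -> Kbar}) :=
  forall x, exists2 p : {poly K}, p != 0 & root (map_poly iota p) x.

Section WeilGroup.
Variables (E : local_field) (Fbar : closedFieldType).
Variable iota : {rmorphism lf_K E -> Fbar}.

Definition integral_elt (x : Fbar) :=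
  exists2 p : {poly lf_O E}, p \is monic & root (map_poly (iota \o lf_inc E) p) x.

(* The maximal ideal of the ring of integers of Fbar. *)
Definition residually0 (x : Fbar) :=
  integral_elt x /\ (x = 0 \/ ~ integral_elt x^-1).

(* s is an element of the Weil group of E acting on the residue field of Fbar   *)
(* as the n-th power of the arithmetic Frobenius.  Thus inertia is n = 0, and   *)
(* the geometric Frobenius elements are those with n = -1.                      *)
Definition weil (s : Fbar -> Fbar) (n : int) :=
  [/\ bijective s,
      exists h : {rmorphism Fbar -> Fbar}, forall x, h x = s x,
      forall x, s (iota x) = iota x &
      forall x, integral_elt x ->
        match n with
        | Posz k => residually0 (s x - x ^+ (#|lf_k E| ^ k))
        | Negz k => residually0 (x - (s x) ^+ (#|lf_k E| ^ k.+1))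
        end].

End WeilGroup.

Section Dual.
Variables (R : realType) (d : nat).
Local Notation C := R[i].
Variable Ghat : split_reductive C d.

Definition id_C : {rmorphism C -> C} := GRing.RMorphism.clone _ _ (@idfun C) _.

Definition Ghat_pts := pts Ghat id_C.
HB.instance Definition _ := Group.on Ghat_pts.

(* Ghat is a Langlands dual group of G: its based root datum is dual to that of *)
(* G, X_*(That) being identified with X^*(T) and X^*(That) with X_*(T).         *)
Definition dual_group (O : comUnitRingType) (G : split_reductive O d)
    (K : fieldType) (f : {rmorphism O -> K}) :=
  (forall a c, root_coroot G f a c <-> root_coroot Ghat id_C c a) /\
  (forall a c, root_coroot G f a c -> (is_pos_root G f a <-> is_pos_root Ghat id_C c)).

(* (V, rep) is an irreducible algebraic representation, V = C^m. *)
Definition algebraic_rep m (rep : Ghat_pts -> 'M[C]_m) :=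
  [/\ rep 1%g = 1%:M,
      forall g h, rep (g * h)%g = rep g *m rep h &
      forall i j, exists (p : mpoly.mpoly (gs_dim Ghat * gs_dim Ghat) C) (N : nat),
        forall g, rep g i j * \det (pt_val g) ^+ N = mpoly.meval (pt_coord g) p].

Definition irreducible_rep m (rep : Ghat_pts -> 'M[C]_m) :=
  (0 < m)%N /\
  forall U : 'M[C]_m, (forall g, ((rep g *m U)^T <= U^T)%MS) ->
    \rank U = 0%N \/ \rank U = m.

Definition weight_of_rep m (rep : Ghat_pts -> 'M[C]_m) (nu : 'rV[int]_d) :=
  exists2 v : 'cV[C]_m, v != 0 &
    forall t : Gm d C, rep (sr_tor Ghat id_C t) *m v = Gm_char nu t *: v.

Definition highest_weight m (rep : Ghat_pts -> 'M[C]_m) (mu : 'rV[int]_d) :=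
  weight_of_rep rep mu /\
  forall nu, weight_of_rep rep nu -> nspan (is_pos_root Ghat id_C) (mu - nu).

End Dual.

Section LocalLanglands.
Variables (F E : local_field) (r : nat) (X : unramified_ext F E r).
Variables (d : nat) (G : split_reductive (lf_O F) d).
Variables (R : realType) (Ghat : split_reductive R[i] d).
Variables (Fbar : closedFieldType) (iota : {rmorphism lf_K E -> Fbar}).
Local Notation C := R[i].
Local Notation Gr := (padic_points G (str_E X)).
Local Notation Gh := (Ghat_pts Ghat).
Local Notation weil := (weil iota).

(* The dual of the Levi subgroup M_l, as a subgroup of Ghat: the centralizer of *)
(* the connected center of M_l^, i.e. of the cocharacters nu of That orthogonal *)
(* to the coroots a^vee of M_l.                                                 *)
Definition levi_hat_center (l nu : 'rV[int]_d) :=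
  forall a c, root_coroot G (lf_inc F) a c -> pairing a l = 0 -> pairing nu c = 0.

Definition levi_hat (l : 'rV[int]_d) : set Gh :=
  [set g | forall nu, levi_hat_center l nu -> forall z : Gm 1 C,
     let t : Gh := sr_tor Ghat (id_C R) (Gm_act nu z) in (t * g = g * t)%g].

Definition lie_levi_hat (l : 'rV[int]_d) : set 'M[C]_(gs_dim Ghat) :=
  [set N | lie (id_C R) (@gs_eqs _ Ghat) N /\
     forall nu, levi_hat_center l nu -> forall z : Gm 1 C,
       let t := pt_val (sr_tor Ghat (id_C R) (Gm_act nu z)) in t *m N = N *m t].

(* Pairs (rho, N): homomorphisms from the Weil-Deligne group of E to Ghat (as G *)
(* is split there is no need for the L-group); rho is the restriction to the    *)
(* Weil group.                                                                  *)
Record wd_param := WDParam {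
  wd_rho : (Fbar -> Fbar) -> Gh;
  wd_N : 'M[C]_(gs_dim Ghat)
}.

(* Parameters for M_l; adm_semisimple is Frobenius-semisimplicity. *)
Record admissible (l : 'rV[int]_d) (p : wd_param) : Prop := Admissible {
  adm_levi : forall s n, weil s n -> levi_hat l (wd_rho p s);
  adm_hom : forall s n s' n', weil s n -> weil s' n' ->
    wd_rho p (s \o s') = (wd_rho p s * wd_rho p s')%g;
  adm_smooth : exists A : seq Fbar, forall s, weil s 0 ->
    (forall a, a \in A -> s a = a) -> wd_rho p s = 1%g;
  adm_semisimple : forall s n, weil s n -> mx_diagonalizable (pt_val (wd_rho p s));
  adm_lie : lie_levi_hat l (wd_N p);
  adm_nilpotent : char_poly (wd_N p) = 'X^(gs_dim Ghat);
  adm_N : forall s n, weil s n ->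
    pt_val (wd_rho p s) *m wd_N p *m invmx (pt_val (wd_rho p s))
    = (#|lf_k E|%:R ^ n) *: wd_N p
}.

(* p' = x p x^-1 *)
Definition wd_conj (x : Gh) (p p' : wd_param) :=
  (forall s n, weil s n -> wd_rho p' s = (x * wd_rho p s * x^-1)%g) /\
  wd_N p' = pt_val x *m wd_N p *m invmx (pt_val x).

Definition wd_equiv (l : 'rV[int]_d) (p p' : wd_param) :=
  exists2 x, levi_hat l x & wd_conj x p p'.

(* LLC+.  It suffices to consider Levi subgroups containing T.  The             *)
(* isomorphisms M_l -> M_l' given by conjugation in G(E) are, up to inner       *)
(* automorphisms, those given by elements n of the normalizer of T; if n        *)
(* induces w on X_*(T), the dual isomorphism is conjugation by an element nh of *)
(* Ghat inducing w on X^*(That) = X_*(T), hence the contragredient of w on      *)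
(* X_*(That).  For n = 1 this says that the parameter depends only on the       *)
(* isomorphism class of the representation.                                     *)
Record LLC_plus := LLCPlus {
  llc : forall M : set Gr, irrep R M -> wd_param;
  llc_admissible : forall l (p : irrep R (levi X G l)), admissible l (llc p);
  llc_surjective : forall l phi, admissible l phi ->
    exists p : irrep R (levi X G l), wd_equiv l (llc p) phi;
  llc_finite : forall l phi, admissible l phi ->
    exists k (s : 'I_k -> irrep R (levi X G l)), forall p : irrep R (levi X G l),
      wd_equiv l (llc p) phi -> exists i, conj_isomorphic 1%g (s i) p;
  llc_conj : forall l l' (n : Gr) w (p : irrep R (levi X G l))
      (p' : irrep R (levi X G l')) (nh : Gh),
    induces (f := str_E X) n w -> conj_set n (levi X G l) = levi X G l' ->
    conj_isomorphic n p p' -> induces (f := id_C R) nh (invmx w)^T ->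
    exists2 x, levi_hat l' x & wd_conj (x * nh)%g (llc p) (llc p');
  llc_induction : forall l (s : irrep R (levi X G l)) (p : irrep R [set: Gr]),
    subquotient_of_induced s p ->
    exists x : Gh, forall w n, weil w n ->
      wd_rho (llc p) w = (x * wd_rho (llc s) w * x^-1)%g
}.

(* c = tr(rep lambda(Phi), V^{rep lambda(I)}): the columns of B are a basis of  *)
(* the inertia invariants and A is the matrix of rep lambda(Phi) in this basis. *)
Definition semisimple_trace m (rep : Gh -> 'M[C]_m) (lambda : (Fbar -> Fbar) -> Gh)
    (Phi : Fbar -> Fbar) (c : C) :=
  exists k (B : 'M[C]_(m, k)) (A : 'M[C]_k),
    [/\ \rank B = k,
        forall v : 'cV[C]_m,
          (forall s, weil s 0 -> rep (lambda s) *m v = v) <->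
          (exists x, v = B *m x),
        rep (lambda Phi) *m B = B *m A & c = \tr A].

(* Z is the element Z_V of the Bernstein center of G_r. *)
Definition is_Z_V (L : LLC_plus) m (rep : Gh -> 'M[C]_m) (Z : (Gr -> C) -> C) :=
  bernstein_center Z /\
  forall (p : irrep R [set: Gr]) Phi c, weil Phi (-1) ->
    semisimple_trace rep (wd_rho (llc L p)) Phi c -> acts_by Z p c.

End LocalLanglands.

(* Main.v *)
(* Let tau be the projection from I_r onto I_r / I_r^+ = T(k_r), and t_s in     *)
(* T(O_r) a lift of s in T(k_r).  By orthogonality of characters and Hilbert 90 *)
(* over k_r, both [I_r : I_r^+]^-1 \sum_chi e_{chi_r} and the average over s of *)
(* z |-> 1_{I_r^+}(t_s^-1 z theta(t_s)) are supported on the z in I_r for which *)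
(* tau(z) has norm 1, and they agree there.  Elements of the Bernstein center   *)
(* commute with left and right translations, so phi' is the average of          *)
(* y |-> phi(t_s^-1 y theta(t_s)).  At y = g^-1 delta theta(g) this amounts to  *)
(* replacing g by g t_s, which preserves the integral over the quotient by      *)
(* invariance of the measure; divergent integrals are no exception, because the *)
(* sets exhausting the quotient are stable under G(O_r), which contains t_s.    *)
(* That the pro-unipotent radical is the kernel of a retraction tau on T(k_r)   *)
(* rests on the triangular form of B (Lie-Kolchin) and the Schur-Zassenhaus     *)
(* theorem in the finite groups of points of B.                                 *)
From HB Require Import structures.
From mathcomp Require Import all_boot all_order all_fingroup all_algebra all_solvable all_field.
From mathcomp Require Import complex finmap zify.
From mathcomp Require mpoly.
From mathcomp Require Import all_classical all_reals all_analysis.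
From mathcomp Require Import measurable_realfun.
Require Import Defs.
Import (canonicals) mpoly.
Import Order.TTheory GRing.Theory Num.Theory numFieldNormedType.Exports.

Set Implicit Arguments.
Unset Strict Implicit.
Unset Printing Implicit Defensive.

Local Open Scope classical_set_scope.
Local Open Scope ring_scope.

(** * Zariski closed sets and regular functions *)

(** Write A = T(k_r) and, for s in A, let t_s in T(O_r) be a lift of s. The theorem comes from one
    identity of functions: phi' is the average over s in A of the functions y -> phi(t_s^-1 y
    theta(t_s)) ([phi'_r1_average]). At y = g^-1 delta theta(g) the term of s is the integrand for
    phi at the point g t_s. Right translation by t_s preserves the quotient measure, so the twisted
    orbital integrals agree ([TO_average]).

    Both sides of the identity are convolutions with Z, and conjugation invariance makes Z commute
    with translations ([dconv_twist]). It is therefore enough to compare functions on the Iwahori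
    subgroup ([iwahori_average]). At z in I_r with image a in A, the characters contribute |A|^-1
    times the sum of the chi(N a)^-1, which by orthogonality ([dual_sumV]) is |T(k_F)|/|A| if N a =
    1 and 0 otherwise. The average of 1_{I_r^+} counts the s with s^-1 a theta(s) = 1; by Hilbert 90
    ([torus_twisted_count]) they form a coset of T(k_F) if N a = 1, and there are none otherwise.

    Three foundations support this. The projection of I_r onto A with kernel I_r^+ is
    [borel_retraction]: it combines the triangular form of B ([lie_kolchin]), a Schur-Zassenhaus
    argument over large finite fields ([semisimple_lift]) and the maximality of T ([torus_fibre]).
    For the arithmetic of F_r/F, Teichmuller lifts show that the Frobenius of k_F is a power of
    theta on k_r ([res_theta_frob]) and a residue basis shows |k_r| = q^r ([card_residue_ext]),
    whence [hilbert90]. For the integrals, the sets exhausting the quotient are stable under G(O_r),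
    which contains every t_s, so that [quotient_integral_average] covers convergent and improper
    integrals alike. *)

Section Zariski.
Variables (K : fieldType) (T : Type) (N : nat) (coord : T -> 'I_N -> K).
Local Notation zclosed := (zclosed coord).
Local Notation zconnected := (zconnected coord).

Lemma zclosed_bigcap (I : Type) (Z : I -> set T) :
  (forall i, zclosed (Z i)) -> zclosed [set x | forall i, Z i x].
Proof.
move=> /choice[P PZ]; exists [set p | exists i, P i p] => x; split.
  by move=> Zx p [i Pp]; have /PZ := Zx i; apply.
by move=> Px i; apply/PZ => p Pp; apply: Px; exists i.
Qed.

Lemma zclosedI Z1 Z2 : zclosed Z1 -> zclosed Z2 -> zclosed (Z1 `&` Z2).
Proof.
move=> c1 c2; have -> : Z1 `&` Z2 = [set x | forall b : bool, (if b then Z1 else Z2) x].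
  apply/seteqP; split => x; first by case=> ? ? [].
  by move=> h; split; [apply: (h true)|apply: (h false)].
by apply: zclosed_bigcap => -[].
Qed.

Lemma zclosedU Z1 Z2 : zclosed Z1 -> zclosed Z2 -> zclosed (Z1 `|` Z2).
Proof.
move=> [P1 h1] [P2 h2].
exists [set p | exists p1 p2, [/\ P1 p1, P2 p2 & p = p1 * p2]] => x; split.
  move=> [/h1 e|/h2 e] p [p1 [p2 [Pp1 Pp2 ->]]].
    by rewrite mpoly.mevalM (e p1) ?mul0r.
  by rewrite mpoly.mevalM (e p2) ?mulr0.
move=> e; apply: contrapT => /not_orP[] n1 n2.
have /existsNP[p1 /not_implyP[P1p1 e1]] : ~ forall p, P1 p -> mpoly.meval (coord x) p = 0.
  by move/h1.
have /existsNP[p2 /not_implyP[P2p2 e2]] : ~ forall p, P2 p -> mpoly.meval (coord x) p = 0.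
  by move/h2.
have : mpoly.meval (coord x) (p1 * p2) = 0 by apply: e; exists p1, p2.
by rewrite mpoly.mevalM => /eqP; rewrite mulf_eq0 => /orP[/eqP/e1|/eqP/e2].
Qed.

Lemma zclosed0 : zclosed set0.
Proof.
exists [set 1] => x; split => // /(_ 1 erefl).
by rewrite mpoly.meval1 => /eqP; rewrite oner_eq0.
Qed.

Lemma zclosed_bigU (I : eqType) (s : seq I) (Z : I -> set T) :
  (forall i, i \in s -> zclosed (Z i)) -> zclosed [set x | exists2 i, i \in s & Z i x].
Proof.
elim: s => [|a s IHs] cZ.
  have -> : [set x | exists2 i, i \in [::] & Z i x] = set0 by apply/seteqP; split => x [].
  exact: zclosed0.
have -> : [set x | exists2 i, i \in a :: s & Z i x]
          = Z a `|` [set x | exists2 i, i \in s & Z i x].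
  apply/seteqP; split => x.
    move=> [i i_as Zi]; move: i_as; rewrite inE => /orP[/eqP <-|i_s]; first by left.
    by right; exists i.
  move=> [Zx|[i si Zx]]; first by exists a => //; rewrite mem_head.
  by exists i => //; rewrite inE si orbT.
by apply: zclosedU; [apply: cZ; rewrite mem_head|
   apply: IHs => i si; apply: cZ; rewrite inE si orbT].
Qed.

Lemma zconnected1 x : zconnected [set x].
Proof.
move=> Z1 Z2 _ _ sub _; have [h|h] := sub x erefl; first by left=> _ ->.
by right=> _ ->.
Qed.

Lemma zconnected_in X Z1 Z2 x : zconnected X -> zclosed Z1 -> zclosed Z2 ->
  X `<=` Z1 `|` Z2 -> X `&` Z1 `&` Z2 = set0 -> X x -> Z1 x -> X `<=` Z1.
Proof.
move=> cX c1 c2 sub dis Xx Z1x; have [//|s2] := cX _ _ c1 c2 sub dis.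
have : (X `&` Z1 `&` Z2) x by split=> //; exact: s2.
by rewrite dis.
Qed.

(** Commutators and words in a connected set are exhibited below as unions of images of that set
    meeting a common connected set, so this is what makes commutator subgroups connected. *)
Lemma zconnected_bigcup_meet (I : Type) (X : set T) (Y : I -> set T) :
  zconnected X -> (forall i, zconnected (Y i)) ->
  (forall i, exists x, X x /\ Y i x) -> zconnected (X `|` \bigcup_i Y i).
Proof.
move=> cX cY meet; suff main Z1 Z2 : zclosed Z1 -> zclosed Z2 ->
    X `|` \bigcup_i Y i `<=` Z1 `|` Z2 -> (X `|` \bigcup_i Y i) `&` Z1 `&` Z2 = set0 ->
    X `<=` Z1 -> X `|` \bigcup_i Y i `<=` Z1.
  move=> Z1 Z2 c1 c2 sub dis.
  have [| |s1|s2] := cX Z1 Z2 c1 c2.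
  - by move=> x Xx; apply: sub; left.
  - by rewrite -subset0 -dis => x [[? ?] ?]; split => //; split => //; left.
  - by left; apply: (main _ _ c1 c2 sub dis s1).
  - right; apply: (main Z2 Z1) => //; first by rewrite [Z2 `|` _]setUC.
    by rewrite -dis setIAC.
move=> c1 c2 sub dis sX x [/sX//|[i _ Yx]]; have [y [Xy Yy]] := meet i.
apply: (zconnected_in (cY i) c1 c2) Yx => //.
- by move=> z Yz; apply: sub; right; exists i.
- rewrite -subset0 -dis => z [[? ?] ?]; split => //; split => //; right; by exists i.
- exact: Yy.
- exact: sX.
Qed.

End Zariski.

(** * Regular functions on an affine group *)

Section Regular.
Variables (O : comUnitRingType) (G : group_scheme O) (K : fieldType).
Variable f : {rmorphism O -> K}.
Local Notation gT := (pts G f).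
Local Notation n := (gs_dim G).

(** The coordinate ring of G inside GL_n: polynomials in the entries and 1/det. The inductive form
    makes closure under composition immediate; [regularP] clears the denominators. *)
Inductive regular : (gT -> K) -> Prop :=
| regular_cst c : regular (fun=> c)
| regular_coord i j : regular (fun g => pt_val g i j)
| regular_detV : regular (fun g => (\det (pt_val g))^-1)
| regularD u v : regular u -> regular v -> regular (fun g => u g + v g)
| regularM u v : regular u -> regular v -> regular (fun g => u g * v g).

Definition regular_mx p q (F : gT -> 'M[K]_(p, q)) := forall i j, regular (fun g => F g i j).

Lemma regular_sum (I : Type) (s : seq I) (P : pred I) (u : I -> gT -> K) :
  (forall i, regular (u i)) -> regular (fun g => \sum_(i <- s | P i) u i g).
Proof.
move=> ru; elim: s => [|a s IHs].
  under eq_fun do rewrite big_nil; exact: regular_cst.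
under eq_fun do rewrite big_cons.
by case: (P a) => //; apply: regularD.
Qed.

Lemma regular_prod (I : Type) (s : seq I) (P : pred I) (u : I -> gT -> K) :
  (forall i, regular (u i)) -> regular (fun g => \prod_(i <- s | P i) u i g).
Proof.
move=> ru; elim: s => [|a s IHs].
  under eq_fun do rewrite big_nil; exact: regular_cst.
under eq_fun do rewrite big_cons.
by case: (P a) => //; apply: regularM.
Qed.

Lemma regularX u k : regular u -> regular (fun g => u g ^+ k).
Proof.
move=> ru; elim: k => [|k IHk]; first exact: regular_cst.
by under eq_fun do rewrite exprS; apply: regularM.
Qed.

Lemma regular_mx_val : regular_mx (fun g : gT => pt_val g).
Proof. by move=> i j; apply: regular_coord. Qed.

Lemma regular_mx_cst p q (A : 'M[K]_(p, q)) : regular_mx (fun=> A).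
Proof. by move=> i j; apply: regular_cst. Qed.

Lemma regular_mxM p q r (F : gT -> 'M[K]_(p, q)) (H : gT -> 'M[K]_(q, r)) :
  regular_mx F -> regular_mx H -> regular_mx (fun g => F g *m H g).
Proof.
move=> rF rH i j; under eq_fun do rewrite mxE.
by apply: regular_sum => k; apply: regularM.
Qed.

Lemma regular_det p (F : gT -> 'M[K]_p) : regular_mx F -> regular (fun g => \det (F g)).
Proof.
move=> rF; rewrite /determinant; apply: regular_sum => s.
by apply: regularM; [apply: regular_cst|apply: regular_prod].
Qed.

Lemma regular_mx_inv : regular_mx (fun g : gT => invmx (pt_val g)).
Proof.
move=> i j; have E (g : gT) : invmx (pt_val g) i j
    = (\det (pt_val g))^-1 * ((-1) ^+ (j + i) * \det (row' j (col' i (pt_val g)))).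
  have [gu _] := asboolW (pt_in g).
  by rewrite /invmx gu !mxE.
under eq_fun do rewrite E.
apply: regularM; first exact: regular_detV.
apply: regularM; first exact: regular_cst.
apply: regular_det => a b; under eq_fun do rewrite !mxE; exact: regular_coord.
Qed.

Lemma det_pt_neq0 (g : gT) : \det (pt_val g) != 0.
Proof. by have [] := asboolW (pt_in g); rewrite unitmxE unitfE. Qed.

Lemma regularP u : regular u -> exists (p : mpoly.mpoly (n * n) K) k,
  forall g, u g * \det (pt_val g) ^+ k = mpoly.meval (pt_coord g) p.
Proof.
pose D : mpoly.mpoly (n * n) K :=
  \det (\matrix_(i, j) mpoly.mpolyX K (mpoly.mnm1 (mxvec_index i j))).
have DE (g : gT) : mpoly.meval (pt_coord g) D = \det (pt_val g).
  rewrite /D -det_map_mx; congr (\det _); apply/matrixP => i j.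
  by rewrite !mxE /= mpoly.mevalXU /pt_coord mxvecE.
elim=> {u} [c|i j||u v _ [p [k pE]] _ [q [l qE]]|u v _ [p [k pE]] _ [q [l qE]]].
- by exists (mpoly.mpolyC _ c), 0%N => g; rewrite expr0 mulr1 mpoly.mevalC.
- exists (mpoly.mpolyX K (mpoly.mnm1 (mxvec_index i j))), 0%N => g.
  by rewrite expr0 mulr1 mpoly.mevalXU /pt_coord mxvecE.
- by exists 1, 1%N => g; rewrite expr1 mulVf ?det_pt_neq0// mpoly.meval1.
- exists (p * D ^+ l + q * D ^+ k), (k + l)%N => g.
  rewrite mpoly.mevalD !mpoly.mevalM !rmorphXn /= DE -pE -qE.
  by rewrite mulrDl exprD mulrA [_ ^+ k * _ ^+ l]mulrC mulrA.
- exists (p * q), (k + l)%N => g.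
  by rewrite mpoly.mevalM -pE -qE exprD mulrACA.
Qed.

Lemma zclosed_regular u : regular u -> zclosed (@pt_coord O G K f) [set g | u g = 0].
Proof.
move=> /regularP[p [k pE]]; exists [set p] => g; split.
  by move=> ug _ ->; rewrite -pE ug mul0r.
move=> /(_ p erefl)/eqP; rewrite -pE mulf_eq0 => /orP[/eqP//|].
by rewrite expf_eq0 (negPf (det_pt_neq0 g)) andbF.
Qed.

Lemma regular_meval (F : gT -> 'M[K]_n) (p : mpoly.mpoly (n * n) K) :
  regular_mx F -> regular (fun g => mpoly.meval (fun k => mxvec (F g) 0 k) p).
Proof.
move=> rF; under eq_fun do rewrite mpoly.mevalE.
apply: regular_sum => m; apply: regularM; first exact: regular_cst.
apply: regular_prod => k; apply: regularX.
by case/mxvec_indexP: k => i j; under eq_fun do rewrite mxvecE.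
Qed.

Lemma zclosed_preim (F : gT -> 'M[K]_n) (P : set (mpoly.mpoly (n * n) K)) :
  regular_mx F ->
  zclosed (@pt_coord O G K f)
    [set g | forall p, P p -> mpoly.meval (fun k => mxvec (F g) 0 k) p = 0].
Proof.
move=> rF.
have -> : [set g | forall p, P p -> mpoly.meval (fun k => mxvec (F g) 0 k) p = 0]
  = [set g | forall q : {p | P p}, mpoly.meval (fun k => mxvec (F g) 0 k) (sval q) = 0].
  apply/seteqP; split => g h; first by case=> p Pp; apply: h.
  by move=> p Pp; apply: (h (exist _ p Pp)).
by apply: zclosed_bigcap => q; apply/zclosed_regular/regular_meval.
Qed.

(** [F] takes values in matrices, so that it has to land in G only on X. This is the form needed for
    the map [psi] in [torus_fibre], which is given by a matrix formula. *)
Lemma zcn_image (X Y : set gT) (F : gT -> 'M[K]_n) : regular_mx F ->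
  (forall x, X x -> exists2 y, Y y & pt_val y = F x) ->
  (forall y, Y y -> exists2 x, X x & pt_val y = F x) -> zcn X -> zcn Y.
Proof.
move=> rF XY YX cX Z1 Z2 [P1 h1] [P2 h2] sub dis.
pose W (P : set (mpoly.mpoly (n * n) K)) := [set g : gT | forall p, P p -> mpoly.meval (fun k => mxvec (F g) 0 k) p = 0].
have WP P x (y : gT) : pt_val y = F x ->
    W P x <-> (forall p, P p -> mpoly.meval (pt_coord y) p = 0).
  by rewrite /W /= /pt_coord => <-.
have [| | |] := cX (W P1) (W P2) (zclosed_preim P1 rF) (zclosed_preim P2 rF).
- move=> x /XY[y Yy E]; have [/h1|/h2] := sub y Yy => ?; [left|right]; exact/(WP _ _ _ E).
- rewrite -subset0 => x [[Xx w1] w2]; have [y Yy E] := XY _ Xx.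
  suff : (Y `&` Z1 `&` Z2) y by rewrite dis.
  by split; [split => //; apply/h1/(WP _ _ _ E)|apply/h2/(WP _ _ _ E)].
- move=> s1; left => y Yy; have [x Xx E] := YX _ Yy.
  by apply/h1/(WP _ _ _ E)/s1.
- move=> s2; right => y Yy; have [x Xx E] := YX _ Yy.
  by apply/h2/(WP _ _ _ E)/s2.
Qed.

(** Rigidity: the finitely many level sets of u are closed and disjoint, so a connected X lies in
    one of them. *)
Lemma zcn_finite_cst (X : set gT) u (s : seq K) : zcn X -> regular u ->
  (forall x, X x -> u x \in s) -> forall x y, X x -> X y -> u x = u y.
Proof.
move=> cX ru us x y Xx Xy.
have cZ c : zclosed (@pt_coord O G K f) [set g | u g = c].
  have -> : [set g | u g = c] = [set g | u g + - c = 0].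
    by apply/seteqP; split => g /=; [move=> ->; rewrite subrr|move=> /eqP; rewrite subr_eq0 => /eqP].
  by apply/zclosed_regular/regularD => //; apply: regular_cst.
have cs := @zclosed_bigU _ _ _ _ _ (rem (u x) (undup s)) (fun c => [set g | u g = c])
  (fun c _ => cZ c).
have sub : X `<=` [set g | u g = u x] `|`
                  [set g | exists2 c, c \in rem (u x) (undup s) & u g = c].
  move=> z Xz; case: (eqVneq (u z) (u x)) => [e|ne]; first by left.
  by right; exists (u z) => //=; rewrite mem_rem_uniq ?undup_uniq// !inE ne mem_undup us.
apply/esym/(zconnected_in cX (cZ (u x)) cs sub _ Xx erefl Xy).
rewrite -subset0 => z [[Xz /= zx]] [c]; rewrite mem_rem_uniq ?undup_uniq// !inE.
by move=> /andP[/eqP ne _] /= zc; apply: ne; rewrite -zc.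
Qed.

End Regular.

(** * Generated subgroups, commutators and connectedness *)

Section GeneratedSubgroup.
Local Open Scope group_scope.
Variable gT : groupType.
Implicit Types A S H : set gT.

Lemma generated_min S H : subgroup H -> S `<=` H -> generated S `<=` H.
Proof. by move=> sH SH x; apply. Qed.

Lemma sub_generated S : S `<=` generated S.
Proof. by move=> x Sx H _; apply. Qed.

Lemma subgroup_generated S : subgroup (generated S).
Proof.
split=> [H []//|x y hx hy H sH SH|x hx H sH SH]; have [_ hM hV] := sH.
  by apply: hM; [apply: hx|apply: hy].
by apply: hV; apply: hx.
Qed.

Lemma commutator_subgroupS A : subgroup A -> commutator_subgroup A `<=` A.
Proof.
move=> sA; have [A1 AM AV] := sA; apply: generated_min => // _ [x [y [Ax Ay ->]]].
by apply: (AM) => //; apply: (AM) => //; apply: (AM) => //; apply: AV.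
Qed.

Lemma commutator_subgroup_normal A a x : subgroup A -> A a -> commutator_subgroup A x ->
  commutator_subgroup A (a * x * a^-1).
Proof.
move=> sA Aa Nx; have [A1 AM AV] := sA; have [_ NM _] := subgroup_generated
  [set z | exists x y, [/\ A x, A y & z = x^-1 * y^-1 * x * y]].
rewrite -[a * x * a^-1](mulgVK x); apply: NM => //.
apply: sub_generated; exists a^-1, x^-1; split; last by rewrite !invgK.
  exact: AV.
by apply/AV/(commutator_subgroupS sA).
Qed.

Fixpoint words S k : set gT :=
  if k is k'.+1 then [set x | exists s a, [/\ S s, words S k' a & x = s * a]]
  else [set 1].

Lemma wordsM S j k x y : words S j x -> words S k y -> words S (j + k) (x * y).
Proof.
elim: j x => [|j IHj] x /=; first by move=> ->; rewrite mul1g.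
move=> [s [a [Ss wa ->]]] wy; exists s, (a * y); rewrite mulgA; split => //.
exact: IHj.
Qed.

Lemma wordsV S k x : (forall s, S s -> S s^-1) -> words S k x -> words S k x^-1.
Proof.
move=> SV; elim: k x => [|k IHk] x /=; first by move=> ->; rewrite invg1.
move=> [s [a [Ss wa ->]]]; rewrite invgM.
suff : words S (k + 1) (a^-1 * s^-1) by rewrite addn1.
apply: wordsM (IHk _ wa) _; exists s^-1, 1; rewrite mulg1; split => //; exact: SV.
Qed.

Lemma generated_words S : (forall s, S s -> S s^-1) ->
  generated S = \bigcup_k words S k.
Proof.
move=> SV; apply/seteqP; split.
  apply: generated_min => [|s Ss]; last by exists 1%N => //; exists s, 1; rewrite mulg1.
  split=> [|x y [j _ wx] [k _ wy]|x [k _ wx]]; first by exists 0%N.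
    by exists (j + k)%N => //; apply: wordsM.
  by exists k => //; apply: wordsV.
move=> x [k _]; have [G1 GM _] := subgroup_generated S.
elim: k x => [|k IHk] x /=; first by move=> ->.
by move=> [s [a [Ss wa ->]]]; apply: GM; [exact: sub_generated|exact: IHk].
Qed.

End GeneratedSubgroup.

Section ConnectedGroups.
Variables (O : comUnitRingType) (G : group_scheme O) (K : fieldType).
Variable f : {rmorphism O -> K}.
Local Notation gT := (pts G f).

Lemma pt_valM (x y : gT) : pt_val (x * y)%g = pt_val x *m pt_val y. Proof. by []. Qed.
Lemma pt_valV (x : gT) : pt_val x^-1%g = invmx (pt_val x). Proof. by []. Qed.
Lemma zcn_map (F : gT -> gT) (X : set gT) : regular_mx (fun g => pt_val (F g)) ->
  zcn X -> zcn [set F x | x in X].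
Proof.
move=> rF; apply: (zcn_image rF) => [x Xx|_ [x Xx <-]]; first by exists (F x) => //; exists x.
by exists x.
Qed.

Lemma zcn_commutators (A : set gT) : subgroup A -> zcn A ->
  zcn [set z | exists x y, [/\ A x, A y & z = x^-1 * y^-1 * x * y]%g].
Proof.
move=> [A1 AM AV] cA.
have -> : [set z | exists x y, [/\ A x, A y & z = x^-1 * y^-1 * x * y]%g] =
    [set 1%g] `|` \bigcup_(x : {x | A x}) [set (sval x)^-1 * y^-1 * sval x * y | y in A]%g.
  apply/seteqP; split => z.
    by move=> [x [y [Ax Ay ->]]]; right; exists (exist _ x Ax) => //; exists y.
  move=> [->|[[x Ax] _ [y Ay <-]]]; last by exists x, y.
  by exists 1%g, 1%g; rewrite invg1 !mulg1.
apply: zconnected_bigcup_meet; first exact: zconnected1.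
  move=> [x Ax]; apply: zcn_map => //=.
  do !apply: regular_mxM; by [exact: regular_mx_cst|exact: regular_mx_inv|exact: regular_mx_val].
move=> [x Ax]; exists 1%g; split => //; exists 1%g => //=.
by rewrite invg1 !mulg1 mulVg.
Qed.

Lemma zcn_generated (S : set gT) : S 1%g -> (forall s, S s -> S s^-1)%g -> zcn S ->
  zcn (generated S).
Proof.
move=> S1 SV cS; rewrite generated_words//.
have cw k : zcn (words S k).
  elim: k => [|k IHk]; first exact: zconnected1.
  have -> : words S k.+1 = words S k `|`
      \bigcup_(a : {a | words S k a}) [set s * sval a | s in S]%g.
    apply/seteqP; split => x /=.
      by move=> [s [a [Ss wa ->]]]; right; exists (exist _ a wa) => //; exists s.
    move=> [wx|[[a wa] _ [s Ss <-]]]; last by exists s, a.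
    by exists 1%g, x; rewrite mul1g.
  apply: zconnected_bigcup_meet => // -[a wa].
    apply: zcn_map => //=; apply: regular_mxM; [exact: regular_mx_val|exact: regular_mx_cst].
  by exists a; split => //; exists 1%g => //=; rewrite mul1g.
have -> : \bigcup_k words S k = [set 1%g] `|` \bigcup_k words S k.
  apply/seteqP; split => x; first by right.
  by move=> [->|//]; exists 0%N.
apply: zconnected_bigcup_meet => [|//|k]; first exact: zconnected1.
exists 1%g; split => //; elim: k => //= k IHk; exists 1%g, 1%g; by rewrite mul1g.
Qed.

Lemma zcn_commutator_subgroup (A : set gT) : subgroup A -> zcn A ->
  zcn (commutator_subgroup A).
Proof.
move=> sA cA; have [A1 AM AV] := sA; apply: zcn_generated (zcn_commutators sA cA).
  by exists 1%g, 1%g; rewrite invg1 !mulg1.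
move=> _ [x [y [Ax Ay ->]]]; exists y, x; split => //.
by rewrite !invgM !invgK !mulgA.
Qed.

Lemma regular_comp (F : gT -> gT) u : regular_mx (fun g => pt_val (F g)) ->
  regular (fun g => (\det (pt_val (F g)))^-1) -> regular u -> regular (u \o F).
Proof.
move=> rF rD; elim=> {u} [c|i j||u v _ ru _ rv|u v _ ru _ rv].
- exact: regular_cst.
- exact: rF.
- exact: rD.
- exact: regularD.
- exact: regularM.
Qed.

Lemma regular_comp_inv u : regular u -> regular (fun g : gT => u g^-1%g).
Proof.
apply: (regular_comp (F := fun g => g^-1%g)); first exact: regular_mx_inv.
under eq_fun do rewrite pt_valV det_inv invrK.
by apply: regular_det; exact: regular_mx_val.
Qed.

(** [rho] is a regular function on all of G but multiplicative only on A. This allows passing to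
    subspaces and quotients that are stable under A alone. *)
Definition regular_rep m (A : set gT) (rho : gT -> 'M[K]_m) :=
  [/\ regular_mx rho, rho 1%g = 1%:M &
      forall x y, A x -> A y -> rho (x * y)%g = rho x *m rho y].

End ConnectedGroups.

(** Take W of maximal rank with row space inside P: a vector of P outside W would enlarge it. *)
Lemma subspace_mx (K : fieldType) m (P : set 'rV[K]_m) : P 0 ->
  (forall a u v, P u -> P v -> P (a *: u + v)) ->
  exists W : 'M[K]_m, forall w : 'rV_m, P w <-> (w <= W)%MS.
Proof.
move=> P0 PL; pose good k := `[< exists W : 'M[K]_m, (forall w : 'rV_m, (w <= W)%MS -> P w)
  /\ \rank W = k >].
have g0 : exists k, good k.
  exists 0%N; apply/asboolP; exists 0; split; last by rewrite mxrank0.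
  by move=> w; rewrite submx0 => /eqP ->.
have gm k : good k -> (k <= m)%N.
  by move=> /asboolP[W [_ <-]]; apply: rank_leq_row.
have [k /asboolP[W [WP rW]] kmax] := ex_maxnP g0 gm.
exists W => w; split=> [Pw|]; last exact: WP.
have gk : good (\rank (W + w)%MS).
  apply/asboolP; exists (W + w)%MS; split=> // v /sub_addsmxP[[a b]/= ->].
  rewrite addrC [b]mx11_scalar mul_scalar_mx; apply: PL => //.
  by apply: WP; rewrite submxMl.
have := kmax _ gk; rewrite -rW => le.
have sWw : (W <= W + w)%MS by rewrite addsmxSl.
apply: submx_trans (addsmxSr W w) _.
by rewrite -(mxrank_leqif_sup sWw) eqn_leq le mxrankS.
Qed.

(** * The Lie-Kolchin theorem *)

Section LieKolchin.
Variables (O : comUnitRingType) (G : group_scheme O) (K : closedFieldType).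
Variable f : {rmorphism O -> K}.
Local Notation gT := (pts G f).

Lemma closed_roots (p : {poly K}) : p != 0 -> exists s : seq K, forall x, root p x -> x \in s.
Proof.
move=> p0; have [s pE] := closed_field_poly_normal p; exists s => x.
by rewrite pE rootZ ?lead_coef_eq0// root_prod_XsubC.
Qed.

Lemma row_base_stable m (W M : 'M[K]_m) : (W *m M <= W)%MS ->
  row_base W *m M *m pinvmx (row_base W) *m row_base W = row_base W *m M.
Proof. by move=> sW; rewrite mulmxKpV// (eqmxMr _ (eq_row_base W)) eq_row_base. Qed.

Lemma common_eigenvector_sub m (A : set gT) (rho : gT -> 'M[K]_m) (W : 'M[K]_m) :
  regular_rep A rho -> (forall a, A a -> (W *m rho a <= W)%MS) ->
  regular_rep A (fun g => row_base W *m rho g *m pinvmx (row_base W)).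
Proof.
move=> [rr r1 rM] sW; have fW := row_base_free W; split.
- by do !apply: regular_mxM => //; apply: regular_mx_cst.
- by rewrite r1 mulmx1 mulmxVp.
- move=> x y Ax Ay; have := row_base_stable (sW _ Ax); rewrite rM//.
  move: (pinvmx _) => Bi; move: (row_base W) Bi => B Bi BE.
  by rewrite !mulmxA BE.
Qed.

(** Induction on the derived length, then on m. If no proper nonzero subspace is stable, a common
    eigenvector of the commutator subgroup N has a character [psi] which conjugation by A cannot
    move: its values are among finitely many eigenvalues and A is connected. Hence N acts by
    scalars; they have determinant 1, so they are trivial since N is connected. Then A acts through
    commuting matrices, and these are scalar by irreducibility. *)
Lemma common_eigenvector k (A : set gT) : subgroup A -> zcn A ->
  iter k (@commutator_subgroup gT) A `<=` [set 1%g] ->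
  forall m (rho : gT -> 'M[K]_m), (0 < m)%N -> regular_rep A rho ->
  exists2 v : 'rV_m, v != 0 & forall a, A a -> exists c, v *m rho a = c *: v.
Proof.
elim: k A => [|k IHk] A sA cA solA.
  move=> m rho m0 [_ r1 _]; exists (const_mx 1).
    by apply/rV0Pn; exists (Ordinal m0); rewrite mxE oner_eq0.
  by move=> a /solA ->; exists 1; rewrite r1 mulmx1 scale1r.
have [A1 AM AV] := sA; pose N := commutator_subgroup A.
have sN : subgroup N := subgroup_generated _.
have NA : N `<=` A := commutator_subgroupS sA.
have solN : iter k (@commutator_subgroup gT) N `<=` [set 1%g] by rewrite -iterSr.
have cN : zcn N by apply: zcn_commutator_subgroup.
elim/ltn_ind => m IHm rho m0 Hrho; have [rr r1 rM] := Hrho.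
have [[W [sW W0 Wm]]|irr] := pselect (exists W : 'M[K]_m,
    [/\ forall a, A a -> (W *m rho a <= W)%MS, W != 0 & (\rank W < m)%N]).
  have W0' : (0 < \rank W)%N by rewrite lt0n mxrank_eq0.
  have [v v0 vE] := IHm _ Wm _ W0' (common_eigenvector_sub Hrho sW).
  exists (v *m row_base W).
    apply: contra v0 => /eqP/(congr1 (mulmx^~ (pinvmx (row_base W)))).
    by rewrite mulmxKp ?row_base_free// mul0mx => ->.
  move=> a Aa; have [c vc] := vE a Aa; exists c; rewrite scalemxAl -vc -mulmxA -{1}(row_base_stable (sW a Aa)).
  move: (pinvmx _) => Bi; move: (row_base W) Bi v {v0 vE vc} => B Bi v; by rewrite !mulmxA.
have full (W : 'M[K]_m) : (forall a, A a -> (W *m rho a <= W)%MS) -> W != 0 ->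
    forall w : 'rV_m, (w <= W)%MS.
  move=> sW W0 w; apply: submx_full; rewrite /row_full eqn_leq rank_leq_row /= leqNgt.
  by apply/negP => Wm; apply: irr; exists W.
have rV a : A a -> rho a *m rho a^-1%g = 1%:M.
  by move=> Aa; rewrite -rM// ?mulgV//; apply: AV.
have scal1 v : (v : 'rV[K]_m) != 0 -> exists j, v 0 j != 0 by move/rV0Pn.
have [v v0 vN] := IHk N sN cN solN m rho m0
  (And3 rr r1 (fun x y Nx Ny => rM x y (NA _ Nx) (NA _ Ny))).
have [psi psiE] : exists psi, forall n, N n -> v *m rho n = psi n *: v.
  have /choice[psi psiE] : forall n, exists c, N n -> v *m rho n = c *: v.
    by move=> n; have [/vN[c] ?|?] := pselect (N n); [exists c|exists 0].
  by exists psi.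
have [j vj] := scal1 v v0.
have psiJ a n : A a -> N n -> psi (a * n * a^-1)%g = psi n.
  (* u reads the eigenvalue off a nonzero coordinate of v, which turns it into a regular function of
     g. *)
  move=> Aa Nn; pose u g := (v *m (rho g *m rho n *m rho g^-1%g)) 0 j / v 0 j.
  have ru : regular u.
    apply: regularM; last exact: regular_cst.
    suff : regular_mx (fun g => v *m (rho g *m rho n *m rho g^-1%g)) by apply.
    apply: regular_mxM; first exact: regular_mx_cst.
    apply: regular_mxM; last first.
      by move=> i l; apply: (@regular_comp_inv _ _ _ _ (fun g => rho g i l)); apply: rr.
    by apply: regular_mxM => //; apply: regular_mx_cst.
  have uE x : A x -> u x = psi (x * n * x^-1)%g.
    move=> Ax; have An := NA _ Nn; rewrite /u.
    have Axn := AM _ _ Ax An; have AxV := AV _ Ax; rewrite -!rM//.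
    by rewrite psiE ?mxE ?mulfK//; apply: commutator_subgroup_normal.
  have [s sP] := closed_roots (monic_neq0 (char_poly_monic (rho n))).
  have := zcn_finite_cst cA ru (s := s) _ Aa A1; rewrite !uE// invg1 mulg1 mul1g => ->//.
  move=> x Ax; rewrite uE//; apply: sP; rewrite -eigenvalue_root_char.
  apply/eigenvalueP; exists (v *m rho x).
    have Nxn : N (x * n * x^-1)%g by apply: commutator_subgroup_normal.
    rewrite -mulmxA -rM//; last exact: NA.
    have -> : rho (x * n)%g = rho (x * n * x^-1)%g *m rho x.
      by rewrite -rM ?mulgVK//; apply: NA.
    by rewrite mulmxA (psiE _ Nxn) -scalemxAl.
  apply: contra v0 => /eqP/(congr1 (mulmx^~ (rho x^-1%g))).
  by rewrite -mulmxA rV// mulmx1 mul0mx => ->.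
have Nscal n : N n -> rho n = (psi n)%:M.
  have [W WP] := @subspace_mx _ m (fun w => forall n, N n -> w *m rho n = psi n *: w)
    (fun n _ => etrans (mul0mx _ _) (esym (scaler0 _ _)))
    (fun a w1 w2 h1 h2 n Nn => ltac:(by rewrite mulmxDl -scalemxAl h1// h2// scalerDr
       !scalerA mulrC)).
  have W0 : W != 0 by apply: contraNneq v0 => W0; have /WP := psiE; rewrite W0 submx0.
  have sW a : A a -> (W *m rho a <= W)%MS.
    move=> Aa; apply/row_subP => i; rewrite row_mul; apply/WP => n' Nn'.
    have /WP Wi : (row i W <= W)%MS by exact: row_sub.
    rewrite -mulmxA -rM//; last exact: NA.
    have Nan : N (a * n' * a^-1)%g by apply: commutator_subgroup_normal.
    have -> : rho (a * n')%g = rho (a * n' * a^-1)%g *m rho a.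
      by rewrite -rM ?mulgVK//; apply: NA.
    by rewrite mulmxA Wi// psiJ// -scalemxAl.
  move=> Nn; apply/row_matrixP => i; rewrite !rowE mul_mx_scalar.
  by have /WP -> := full W sW W0 (delta_mx 0 i).
have detN n : N n -> \det (rho n) = 1.
  suff : N `<=` [set n | A n /\ \det (rho n) = 1] by move=> h /h[].
  have detV x : A x -> \det (rho x^-1%g) * \det (rho x) = 1.
    by move=> Ax; rewrite -det_mulmx -rM ?mulVg ?r1 ?det1//; apply: AV.
  apply: generated_min => [|_ [x [y [Ax Ay ->]]]].
    split=> [|x y [Ax dx] [Ay dy]|x [Ax dx]]; first by rewrite /= r1 det1.
      by split; [apply: AM|rewrite rM// det_mulmx dx dy mulr1].
    by split; [apply: AV|rewrite -(detV x Ax) dx mulr1].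
  have AVx := AV _ Ax; have AVy := AV _ Ay; have Axy := AM _ _ AVx AVy.
  have Axyx := AM _ _ Axy Ax; split; first exact: AM.
  by rewrite !rM// !det_mulmx -mulrA mulrACA !detV// mulr1.
have N1 n : N n -> rho n = 1%:M.
  move=> Nn; rewrite Nscal//; congr _%:M.
  (* The scalar by which x in N acts is a diagonal entry of [rho x], hence regular in x, and an m-th
     root of unity because the determinant is 1. *)
  have [s sP] := closed_roots (monic_neq0 (monicXnsubC (1 : K) m0)).
  have N1g : N 1%g by have [] := sN.
  have psiE' x : N x -> rho x j j = psi x by move=> Nx; rewrite Nscal// mxE eqxx mulr1n.
  rewrite -psiE'// (zcn_finite_cst cN (rr j j) (s := s) _ Nn N1g) ?r1 ?mxE ?eqxx//.
  move=> x Nx; rewrite psiE'//; apply: sP; rewrite rootE !hornerE subr_eq0 -det_scalar.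
  by rewrite -Nscal// detN.
have comm x y : A x -> A y -> rho x *m rho y = rho y *m rho x.
  move=> Ax Ay; have Axy := AM _ _ Ax Ay; have Ayx := AM _ _ Ay Ax.
  have AV' := AV _ Ayx; have Ac := AM _ _ AV' Axy.
  have Nc : N ((y * x)^-1 * (x * y))%g.
    by apply: sub_generated; exists x, y; split => //; rewrite invgM !mulgA.
  rewrite -!rM// -[X in rho X = _](mulVKg (y * x)%g) (rM _ _ Ayx Ac).
  by rewrite (N1 _ Nc) mulmx1.
have Ascal a : A a -> exists c, forall w : 'rV_m, w *m rho a = c *: w.
  move=> Aa; have /closed_rootP[c] : size (char_poly (rho a)) != 1%N.
    by rewrite size_char_poly eqSS -lt0n.
  rewrite -eigenvalue_root_char => /eigenvalueP[w wE w0].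
  exists c => w'; apply/eigenspaceP; apply: full.
    move=> b Ab; apply/eigenspaceP; rewrite -mulmxA comm// mulmxA scalemxAl.
    by congr (_ *m _); apply/eigenspaceP.
  by apply: contraNneq w0 => E0; rewrite -submx0 -E0; apply/eigenspaceP.
exists v => // a /Ascal[c cE]; by exists c.
Qed.

(** Vectors are rows, so triangular means lower triangular: after the change of basis P the common
    eigenvector is the first basis row, the upper right block vanishes, and [drsubmx] is the action
    on the quotient, to which induction applies. *)
Lemma lie_kolchin (A : set gT) : connected_solvable A ->
  forall m (rho : gT -> 'M[K]_m), regular_rep A rho ->
  exists Q Qi : 'M[K]_m, Q *m Qi = 1%:M /\
    forall a, A a -> is_trig_mx (Q *m rho a *m Qi).
Proof.
move=> [sA _ cA [k solA]]; elim=> [|m IHm] rho Hrho.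
  by exists 1%:M, 1%:M; rewrite mulmx1; split => // a _; apply/is_trig_mxP => -[].
have [v v0 vE] := common_eigenvector sA cA solA (ltn0Sn m) Hrho.
have [rr r1 rM] := Hrho.
have rv : \rank v = 1%N by apply/eqP; rewrite rank_rV v0.
pose P := row_ebase v; pose Pi := invmx P.
have PPi : P *m Pi = 1%:M by rewrite mulmxV ?row_ebase_unit.
have PiP : Pi *m P = 1%:M by rewrite mulVmx ?row_ebase_unit.
pose e : 'rV[K]_(1 + m) := row_mx 1%:M 0.
have [c c0 vPE] : exists2 c, c != 0 & v = c *: (e *m P).
  exists (col_ebase v 0 0).
    by have := col_ebase_unit v; rewrite unitmxE unitfE det_mx11.
  rewrite -[LHS]mulmx_ebase rv [col_ebase v]mx11_scalar -mulmxA mul_scalar_mx mxE eqxx mulr1n.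
  congr (_ *: (_ *m _)); apply/rowP => i; rewrite !mxE.
  by case: splitP => l; rewrite ?ord1 => iE; rewrite !mxE iE.
pose M g : 'M[K]_(1 + m) := P *m rho g *m Pi.
have M1 : M 1%g = 1%:M by rewrite /M r1 mulmx1.
have MM x y : A x -> A y -> M (x * y)%g = M x *m M y.
  by move=> Ax Ay; rewrite /M rM// !mulmxA -[_ *m Pi *m P]mulmxA PiP mulmx1.
have eM a : A a -> ursubmx (M a) = 0.
  move=> /vE[d]; rewrite vPE -scalemxAl scalerA mulrC -scalerA => /(scalerI c0).
  move=> /(congr1 (mulmx^~ Pi)); rewrite -scalemxAl -!mulmxA PPi mulmx1 [P *m _]mulmxA.
  rewrite -/(M a) -[M a]submxK /e (@mul_row_block _ 1 1 m 1 m) !mul1mx !mul0mx !addr0 (@scale_row_mx _ 1 1 m).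
  move=> /(congr1 (@rsubmx _ 1 1 m)); rewrite !row_mxKr scaler0 => <-.
  by rewrite block_mxKur.
have rM' : regular_mx M.
  by apply: regular_mxM; [apply: regular_mxM|]; rewrite //; apply: regular_mx_cst.
have Hrho' : regular_rep A (fun g => drsubmx (M g)).
  split.
  - move=> i l; have E g : drsubmx (M g) i l = M g (rshift 1 i) (rshift 1 l) by rewrite !mxE.
    by under eq_fun do rewrite E; apply: rM'.
  - by rewrite M1 scalar_mx_block block_mxKdr.
  - move=> x y Ax Ay; rewrite MM//.
    rewrite -[M x in LHS]submxK -[M y in LHS]submxK mulmx_block block_mxKdr eM//.
    by rewrite mulmx0 add0r.
have [Q [Qi [QQi QT]]] := IHm _ Hrho'.
pose B1 : 'M[K]_(1 + m) := block_mx 1%:M 0 0 Q.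
pose B2 : 'M[K]_(1 + m) := block_mx 1%:M 0 0 Qi.
exists (B1 *m P), (Pi *m B2); split.
  rewrite mulmxA -[_ *m P *m Pi]mulmxA PPi mulmx1 /B1 /B2 (@mulmx_block _ 1 m 1 m 1 m).
  rewrite !mulmx0 !mul0mx mulmx1 QQi.
  by rewrite !addr0 add0r -scalar_mx_block.
move=> a Aa; have -> : B1 *m P *m rho a *m (Pi *m B2) = B1 *m M a *m B2.
  by rewrite /M !mulmxA.
rewrite -[M a]submxK eM// /B1 /B2 !(@mulmx_block _ 1 m 1 m 1 m) !mulmx0 !mul0mx !addr0 !add0r !mul0mx !mul1mx !mulmx1.
rewrite (@is_trig_block_mx _ 1 m 1 m)// eqxx mx11_is_trig/=.
exact: QT.
Qed.

End LieKolchin.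

(** * Borel subgroups over finite fields *)

Section FiniteGroups.
Local Open Scope group_scope.

(** In [semisimple_lift], V consists of unipotent elements and A0 of the elements diagonal in a
    given basis. The quotient by V is abelian without p-torsion, so V is a normal Hall subgroup. A
    p'-Hall subgroup A containing A0 is then a complement of V, and it is abelian because it embeds
    in the quotient. *)
Lemma abelian_p'_complement (gT : finGroupType) (p : nat) (V A0 : {group gT}) :
  prime p -> p.-group V -> (forall x y, [~ x, y] \in V) ->
  (forall x, x ^+ p \in V -> x \in V) -> p^'.-group A0 ->
  exists A : {group gT}, [/\ A0 \subset A, abelian A, p^'.-group A &
    forall x, exists a v, [/\ a \in A, v \in V & x = v * a]].
Proof.
move=> p_pr pV cV rootV pA0; set G := [set: gT]%G.
have dV : G^`(1) \subset V.
  by rewrite gen_subG; apply/fintype.subsetP => _ /imset2P[x y _ _ ->].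
have nV : normal V G by rewrite sub_der1_normal ?finset.subsetT.
have solG : solvable G.
  by rewrite (series_sol nV) (pgroup_sol pV) abelian_sol// sub_der1_abelian.
have hV : p.-Hall(G) V.
  rewrite /pHall finset.subsetT pV /= -card_quotient ?normal_norm// p'natE//.
  apply/negP => /(Cauchy p_pr)[_ /morphimP[x Nx _ ->] ox].
  suff Vx : x \in V by move: ox (prime_gt1 p_pr) => /=; rewrite coset_id// order1 => <-.
  by apply: rootV; apply: coset_idr; rewrite ?groupX// morphX// -ox expg_order.
have [A hA sA] := Hall_superset solG (finset.subsetT A0) pA0.
have /sdprodP[_ VA _ tVA] : sdprod V A = G by apply/(sdprod_normal_p'HallP nV hA).
exists A; split => //; last first.
- move=> x; have : x \in V * A by rewrite VA inE.
  by case/mulsgP => v a Vv Aa ->; exists a, v.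
- exact: pHall_pgroup hA.
- apply/commG1P/trivgP; rewrite -tVA gen_subG; apply/fintype.subsetP.
  by move=> _ /imset2P[x y Ax Ay ->]; rewrite inE cV groupR.
Qed.

Lemma finite_subgroup_type (gT : groupType) (S : set gT) (l : seq gT) :
  subgroup S -> (forall x, S x -> x \in l) ->
  exists (FT : finGroupType) (i : FT -> gT),
    [/\ injective i, forall x y, i (x * y) = (i x * i y)%g & forall x, S x <-> exists y, i y = x].
Proof.
move=> [S1 SM SV] Sl; pose s := [seq x <- l | `[< S x >]].
have sP x : x \in s <-> S x.
  by rewrite mem_filter; split=> [/andP[/asboolP]//|Sx]; rewrite Sl// andbT; apply/asboolP.
pose FT := seq_sub s.
have iP (x : FT) : S (val x) by apply/sP/valP.
pose mul (x y : FT) : FT := SeqSub (proj2 (sP _) (SM _ _ (iP x) (iP y))).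
pose one : FT := SeqSub (proj2 (sP _) S1).
pose inv (x : FT) : FT := SeqSub (proj2 (sP _) (SV _ (iP x))).
have mA : associative mul by move=> x y z; apply: val_inj; rewrite /= mulgA.
have m1 : left_id one mul by move=> x; apply: val_inj; rewrite /= mul1g.
have mV : left_inverse one inv mul by move=> x; apply: val_inj; rewrite /= mulVg.
pose M := Finite_isGroup.Build FT mA m1 mV.
pose FG : finGroupType := HB.pack FT M.
exists FG, (fun x : FT => val x); split.
- exact: val_inj.
- by [].
- move=> x; split=> [/sP xs|[y <-]]; last exact: iP.
  by exists (SeqSub xs : FT).
Qed.

End FiniteGroups.

(** * Triangular, diagonal and unipotent matrices *)

Section Matrices.
Variable K : fieldType.

Lemma char_poly_conj n (Q Qi A : 'M[K]_n) : Q *m Qi = 1%:M ->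
  char_poly (Q *m A *m Qi) = char_poly A.
Proof.
move=> QQi; have E : map_mx polyC Q *m map_mx polyC Qi = 1%:M.
  by rewrite -map_mxM QQi map_mx1.
have -> : char_poly (Q *m A *m Qi) =
    \det (map_mx polyC Q *m char_poly_mx A *m map_mx polyC Qi).
  congr (\det _); rewrite /char_poly_mx mulmxBr mulmxBl !map_mxM mul_mx_scalar.
  by rewrite -scalemxAl E scalemx1.
by rewrite !det_mulmx mulrAC -det_mulmx E det1 mul1r.
Qed.

Lemma char_poly_trig_unip n (A : 'M[K]_n) : is_trig_mx A ->
  char_poly A = ('X - 1) ^+ n <-> forall i, A i i = 1.
Proof.
move=> tA; rewrite char_poly_trig//; split=> [E i|A1].
  have /eqP : (\prod_i ('X - (A i i)%:P)).[A i i] = 0.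
    by rewrite (bigD1 i)//= hornerM hornerXsubC subrr mul0r.
  by rewrite E horner_exp -polyC1 hornerXsubC expf_eq0 subr_eq0 => /andP[_ /eqP].
by rewrite (eq_bigr (fun=> 'X - 1)) => [|i _]; rewrite ?A1// prodr_const card_ord.
Qed.

Lemma trig_mulmx_diag n (A B : 'M[K]_n) i : is_trig_mx A -> is_trig_mx B ->
  (A *m B) i i = A i i * B i i.
Proof.
move=> /is_trig_mxP tA /is_trig_mxP tB; rewrite mxE (bigD1 i)//= big1 ?addr0// => j ji.
by have [ij|ij] := ltnP i j; [rewrite tA ?mul0r|rewrite tB ?mulr0// ltn_neqAle ji].
Qed.

Lemma diag_unip n (P A : 'M[K]_n) : P \in unitmx -> is_diag_mx (P *m A *m invmx P) ->
  char_poly A = ('X - 1) ^+ n -> A = 1%:M.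
Proof.
move=> uP dA cA; have tA := is_diag_mx_is_trig dA.
have : char_poly (P *m A *m invmx P) = ('X - 1) ^+ n by rewrite char_poly_conj// mulmxV.
move=> /(char_poly_trig_unip tA) A1.
have E : P *m A *m invmx P = 1%:M.
  apply/matrixP => i j; rewrite [RHS]mxE; case: eqVneq => [<-|ij]; first exact: A1.
  exact: (is_diag_mxP dA).
by rewrite -[A](mulKmx uP) -[P *m A](mulmxKV uP) E mul1mx mulVmx.
Qed.

Lemma is_diag_lin n (P : 'M[K]_n) (a : K) (A B : 'M[K]_n) :
  is_diag_mx (P *m A *m invmx P) -> is_diag_mx (P *m B *m invmx P) ->
  is_diag_mx (P *m (a *: A + B) *m invmx P).
Proof.
move=> /is_diag_mxP dA /is_diag_mxP dB; apply/is_diag_mxP => i j ij.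
by rewrite mulmxDr mulmxDl -scalemxAr -scalemxAl mxE mxE dA// dB// mulr0 addr0.
Qed.

Lemma is_diag_span n (P : 'M[K]_n) (s : seq 'M[K]_n) A : A \in << s >>%VS ->
  (forall B, B \in s -> is_diag_mx (P *m B *m invmx P)) -> is_diag_mx (P *m A *m invmx P).
Proof.
move=> As ds; rewrite (coord_span (X := in_tuple s) As).
elim/big_rec: _ => [|i B _ dB].
  by apply/is_diag_mxP => i j _; rewrite mulmx0 mul0mx mxE.
by apply: is_diag_lin dB; apply: ds; apply: mem_nth.
Qed.

Lemma is_diag_mulmx n (A B : 'M[K]_n) : is_diag_mx A -> is_diag_mx B -> is_diag_mx (A *m B).
Proof.
move=> /is_diag_mxP dA /is_diag_mxP dB; apply/is_diag_mxP => i j ij.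
rewrite mxE big1// => l _; case: (eqVneq (val i) (val l)) => [il|il]; last by rewrite dA ?mul0r.
by rewrite dB ?mulr0// -il.
Qed.

End Matrices.

(** A is annihilated by X^m - 1, which is separable because m is invertible in K. *)
Lemma finite_order_diag (K : closedFieldType) n (A : 'M[K]_n) m : (0 < m)%N -> m%:R != 0 :> K ->
  iter m (mulmx A) 1%:M = 1%:M ->
  exists2 P, P \in unitmx & is_diag_mx (P *m A *m invmx P).
Proof.
case: n A => [|n] A m0 mK Am.
  by exists 1%:M; rewrite ?unitmx1//; apply/is_diag_mxP => -[].
have [rs rsE] := closed_field_poly_normal ('X^m - 1 : {poly K}).
have lc : lead_coef ('X^m - 1 : {poly K}) = 1 by apply/eqP; rewrite -polyC1 -monicE monicXnsubC.
rewrite lc scale1r in rsE.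
have [|P uP dP] := (proj2 (diagonalizableP A)).
  exists rs; first by rewrite -separable_prod_XsubC -rsE separable_Xn_sub_1.
  rewrite -rsE; apply: mxminpoly_min; rewrite rmorphB rmorphXn rmorph1 /= horner_mx_X.
  suff -> : A ^+ m = iter m (mulmx A) 1%:M by rewrite Am subrr.
  by elim: (m) => [|l IHl]; rewrite ?expr0// exprS IHl.
by exists P => //; move: dP; rewrite /similar_to/= conjumx.
Qed.

Lemma codiag (K : fieldType) n (s : seq 'M[K]_n) :
  {in s &, forall A B, A *m B = B *m A} ->
  (forall A, A \in s -> exists2 P, P \in unitmx & is_diag_mx (P *m A *m invmx P)) ->
  exists2 P, P \in unitmx & forall A, A \in s -> is_diag_mx (P *m A *m invmx P).
Proof.
move=> cs ds; have [|P uP /allP dP] := proj1 (codiagonalizableP s).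
  split; first by move=> A B As Bs; apply: cs.
  move=> A /ds[P uP dP]; exists P => //; by rewrite /similar_to/= conjumx.
by exists P => // A /dP; rewrite /= /similar_to/= conjumx.
Qed.

Lemma card_finField_pnat (k : finFieldType) (K : fieldType) (e : {rmorphism k -> K}) :
  [pchar K].-nat #|k|.
Proof.
have [p pp pc] := finPcharP k.
have : (p.-group [set: k]%SET)%g := abelem_pgroup (fin_ring_pchar_abelem pc).
rewrite pgroupE cardsT; apply: sub_in_pnat => i _ /eqP ->.
by rewrite (fmorph_pchar e).
Qed.

Definition frob (k : finFieldType) (K : fieldType) (e : {rmorphism k -> K}) N (x : K) : K :=
  x ^+ (#|k| ^ N).

(** * Frobenius on an algebraic closure of a finite field *)

Section Frobenius.
Variables (k : finFieldType) (K : fieldType) (e : {rmorphism k -> K}).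

Fact frob_is_zmod_morphism N : zmod_morphism (frob e N).
Proof.
move=> x y; have cN : [pchar K].-nat (#|k| ^ N)%N by rewrite pnatX card_finField_pnat.
have D (a b : K) : frob e N (a + b) = frob e N a + frob e N b by apply: exprDn_pchar.
by apply/eqP; rewrite eq_sym subr_eq -D subrK.
Qed.

Fact frob_is_monoid_morphism N : monoid_morphism (frob e N).
Proof. by split=> [|x y]; rewrite /frob ?expr1n ?exprMn. Qed.

HB.instance Definition _ N := GRing.isZmodMorphism.Build K K (frob e N)
  (frob_is_zmod_morphism N).
HB.instance Definition _ N := GRing.isMonoidMorphism.Build K K (frob e N)
  (frob_is_monoid_morphism N).

Lemma frob_base N a : frob e N (e a) = e a.
Proof.
rewrite /frob -rmorphXn; congr (e _); elim: N => [|N IHN]; first by rewrite expr1.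
by rewrite expnS exprM expf_card IHN.
Qed.

Lemma frobD N M x : frob e (N + M) x = frob e N (frob e M x).
Proof. by rewrite /frob expnD mulnC exprM. Qed.

Lemma frob_mulr N M x : frob e N x = x -> frob e (N * M) x = x.
Proof. by move=> Nx; elim: M => [|M IHM]; rewrite ?muln0 ?mulnS /frob ?expr1// -/(frob e _ x) frobD IHM. Qed.

Lemma frob1_base x : frob e 1 x = x -> exists a, x = e a.
Proof.
rewrite /frob expn1 => xq.
have : root (map_poly e ('X^#|k| - 'X)) x.
  by rewrite rmorphB rmorphXn /= map_polyX rootE !hornerE xq subrr.
rewrite finField_genPoly rmorph_prod /=.
under eq_bigr do rewrite rmorphB /= map_polyX map_polyC /=.
by rewrite -big_enum/= -(big_map e xpredT (fun z => 'X - z%:P)) root_prod_XsubC => /mapP[a _ ->]; exists a.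
Qed.

End Frobenius.

Section FrobeniusClosed.
Variables (k : finFieldType) (K : closedFieldType) (e : {rmorphism k -> K}).
Hypothesis algK : integralRange e.

(** The iterates of Frobenius keep x among the finitely many roots of a polynomial over k, so two of
    them agree, and Frobenius is injective. Consequently finitely many points of G(K) always lie in
    one finite group of points, where finite group theory applies. *)
Lemma frob_periodic x : exists N, (0 < N)%N /\ frob e N x = x.
Proof.
have [p p1 px] := algK x.
have p0 : map_poly e p != 0 by rewrite map_poly_eq0 monic_neq0.
have [s sP] := closed_roots p0.
have fs i : frob e i x \in s.
  apply: sP; suff <- : map_poly (frob e i) (map_poly e p) = map_poly e p by apply: rmorph_root.
  by apply/polyP => j; rewrite !coef_map /= frob_base.
have [inj|] := pselect (injective (fun i : 'I_(size s).+1 => frob e i x)).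
  have := @uniq_leq_size _ [seq frob e (i : nat) x | i : 'I_(size s).+1] s.
  rewrite size_map -cardE card_ord ltnn map_inj_uniq ?enum_uniq// => h.
  by have := h isT (fun y => ltac:(by case/mapP => i _ ->)).
have main (i j : nat) : (i < j)%N -> frob e i x = frob e j x ->
    exists N, (0 < N)%N /\ frob e N x = x.
  move=> ij; rewrite -(subnKC (ltnW ij)) frobD => /fmorph_inj E.
  by exists (j - i)%N; rewrite subn_gt0 ij.
move=> /existsNP[i /existsNP[j /not_implyP[E /eqP ij]]].
have := ij; rewrite neq_ltn => /orP[lt|lt]; first exact: main lt E.
exact: main lt (esym E).
Qed.

Lemma frob_periodic_seq (s : seq K) : exists N, (0 < N)%N /\ forall x, x \in s -> frob e N x = x.
Proof.
elim: s => [|a s [N [N0 Ns]]]; first by exists 1%N.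
have [M [M0 Ma]] := frob_periodic a; exists (N * M)%N; rewrite muln_gt0 N0; split => // x.
rewrite inE => /orP[/eqP ->|/Ns]; last exact: frob_mulr.
by rewrite mulnC; apply: frob_mulr.
Qed.

Lemma frob_fixed_finite N : (0 < N)%N -> exists s : seq K, forall x, frob e N x = x -> x \in s.
Proof.
move=> N0; have q1 : (1 < #|k| ^ N)%N.
  by rewrite -{1}(expn0 #|k|) ltn_exp2l// finNzRing_gt1.
have [|s sP] := @closed_roots _ ('X^(#|k| ^ N) - 'X : {poly K}).
  rewrite -size_poly_gt0 size_polyDl ?size_polyXn// size_polyN size_polyX.
  by rewrite ltnS.
by exists s => x xN; apply: sP; rewrite rootE !hornerE -/(frob e N x) xN subrr.
Qed.

End FrobeniusClosed.

Lemma finite_points (O : comUnitRingType) (G : group_scheme O) (K : fieldType)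
  (f : {rmorphism O -> K}) (s : seq K) :
  exists l : seq (pts G f), forall g : pts G f, (forall i j, pt_val g i j \in s) -> g \in l.
Proof.
pose l : seq (pts G f) :=
  pmap (fun A : 'M[seq_sub s]_(gs_dim G) => insub (map_mx val A)) (enum 'M[seq_sub s]_(gs_dim G)).
exists l => g gs; rewrite mem_pmap; apply/mapP.
exists (\matrix_(i, j) SeqSub (gs i j)); first by rewrite mem_enum.
have -> : map_mx val (\matrix_(i, j) SeqSub (gs i j)) = val g.
  by apply/matrixP => i j; rewrite !mxE.
by rewrite valK.
Qed.

Section PointsMaps.
Variables (O : comUnitRingType) (G : group_scheme O) (S S' : comUnitRingType).
Variables (f : {rmorphism O -> S}) (f' : {rmorphism O -> S'}).
Variables (h : {rmorphism S -> S'}) (hf : forall x, h (f x) = f' x).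

Lemma pts_mapM (x y : pts G f) : pts_map hf (x * y)%g = (pts_map hf x * pts_map hf y)%g.
Proof. by apply: val_inj; rewrite /= map_mxM. Qed.

Lemma pts_map1 : pts_map hf (1%g : pts G f) = 1%g.
Proof. by apply: val_inj; rewrite /= map_mx1. Qed.

Lemma pts_mapV (x : pts G f) : pts_map hf x^-1%g = (pts_map hf x)^-1%g.
Proof. by apply: (mulgI (pts_map hf x)); rewrite -pts_mapM !mulgV pts_map1. Qed.

Lemma closed_points_map P (g : pts G f) : closed_points G P S f g ->
  closed_points G P S' f' (pts_map hf g).
Proof. by move=> Pg p Pp; rewrite /= (mx_eval_map hf) Pg// rmorph0. Qed.

Lemma pts_map_inj : injective h -> injective (@pts_map O G S S' f f' h hf).
Proof.
move=> hI x y /(congr1 val)/matrixP E; apply/val_inj/matrixP => i j; apply: hI.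
by have := E i j; rewrite !mxE.
Qed.

End PointsMaps.

(** * The diagonal part of a triangularized Borel subgroup *)

Section BorelTriangular.
Variables (O : comUnitRingType) (d : nat) (G : split_reductive O d).
Variables (k : finFieldType) (K : closedFieldType) (e : {rmorphism k -> K}).
Hypothesis algK : integralRange e.
Variables (f0 : {rmorphism O -> k}) (f : {rmorphism O -> K}).
Hypothesis fE : forall x, e (f0 x) = f x.
Local Notation n := (gs_dim G).
Local Notation gT := (pts G f).
Local Notation B := (closed_points G (sr_bor G) K f).
Variables Q Qi : 'M[K]_n.
Hypothesis QQi : Q *m Qi = 1%:M.
Hypothesis QB : forall b, B b -> is_trig_mx (Q *m pt_val b *m Qi).

(** On B this is multiplicative, and its kernel is the set of unipotent elements ([bdiagM],
    [bdiag_unip]). It stands in for the quotient of B by its unipotent radical. *)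
Definition bdiag (b : gT) i := (Q *m pt_val b *m Qi) i i.

Lemma bdiagM a b i : B a -> B b -> bdiag (a * b)%g i = bdiag a i * bdiag b i.
Proof.
move=> Ba Bb; rewrite /bdiag -trig_mulmx_diag ?QB//.
by rewrite !mulmxA -[_ *m Qi *m Q]mulmxA (mulmx1C QQi) mulmx1.
Qed.

Lemma bdiag1 i : bdiag 1%g i = 1.
Proof. by rewrite /bdiag mulmx1 QQi mxE eqxx. Qed.

Lemma bdiag_unip b : B b -> unipotent b <-> forall i, bdiag b i = 1.
Proof.
by move=> /QB tb; rewrite /unipotent -(char_poly_conj (pt_val b) QQi); apply: char_poly_trig_unip.
Qed.

Let B_subgroup : subgroup B := sr_bor_sub G f.

Lemma bdiagX b m i : B b -> B (b ^+ m)%g /\ bdiag (b ^+ m)%g i = bdiag b i ^+ m.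
Proof.
move=> Bb; have [B1 BM _] := B_subgroup; elim: m => [|m [Bm IHm]].
  by rewrite expg0 bdiag1.
by rewrite expgS bdiagM// IHm exprS; split => //; apply: BM.
Qed.

Lemma pt_valX (b : gT) m : pt_val (b ^+ m)%g = iter m (mulmx (pt_val b)) 1%:M.
Proof. by elim: m => [//|m IHm]; rewrite expgS pt_valM IHm. Qed.

Lemma frob_base_f N x : frob e N (f x) = f x.
Proof. by rewrite -fE frob_base. Qed.

Definition pts_frob N : gT -> gT := pts_map (frob_base_f N).

(* By the Schur-Zassenhaus theorem in the finite group of points of B over a *)
(* large finite field, every element of B can be moved by the kernel of the  *)
(* diagonal part so as to become semisimple and to commute with a given      *)
(* diagonalizable commutative subset.                                        *)
Lemma semisimple_lift (P : 'M[K]_n) (s : seq gT) b : P \in unitmx ->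
  (forall h, h \in s -> B h /\ is_diag_mx (P *m pt_val h *m invmx P)) -> B b ->
  exists c, [/\ B c, forall i, bdiag c i = bdiag b i,
    forall h, h \in s -> (c * h = h * c)%g &
    exists2 P', P' \in unitmx & is_diag_mx (P' *m pt_val c *m invmx P')].
Proof.
move=> uP sP Bb; have [B1 BM BV] := B_subgroup.
pose ent : seq K := flatten [seq [seq pt_val g i j | i <- enum 'I_n, j <- enum 'I_n] | g <- b :: s].
have [N [N0 Nent]] := frob_periodic_seq algK ent.
have Nfix g : g \in b :: s -> pts_frob N g = g.
  move=> gs; apply/val_inj/matrixP => i j; rewrite !mxE; apply: Nent.
  apply/flattenP; exists [seq pt_val g i j | i <- enum 'I_n, j <- enum 'I_n].
    by apply/mapP; exists g.
  by apply/allpairsP; exists (i, j); rewrite !mem_enum.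
(* The points of B over the field with |k|^N elements: a finite group containing b, and containing
   s. *)
pose S := [set g | B g /\ pts_frob N g = g].
have sS : subgroup S.
  split=> [|x y [Bx Nx] [By Ny]|x [Bx Nx]].
  - by split => //; apply: pts_map1.
  - by split; [apply: BM|rewrite /pts_frob pts_mapM -/(pts_frob N x) -/(pts_frob N y) Nx Ny].
  - by split; [apply: BV|rewrite /pts_frob pts_mapV -/(pts_frob N x) Nx].
have [fixs fixsP] := frob_fixed_finite e N0.
have [l lP] := finite_points G f fixs.
have Sl x : S x -> x \in l.
  move=> [_ Nx]; apply: lP => i j; apply: fixsP.
  by have /(congr1 (fun g : gT => pt_val g i j)) := Nx; rewrite mxE.
have [FT [io [ioI ioM ioS]]] := finite_subgroup_type sS Sl.
have Sio x : S (io x) by apply/ioS; exists x.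
have Bio x : B (io x) by have [] := Sio x.
have io1 : io 1%g = 1%g by apply: (mulgI (io 1%g)); rewrite -ioM !mulg1.
have ioV x : io x^-1%g = (io x)^-1%g by apply: (mulgI (io x)); rewrite -ioM !mulgV.
have ioX x m : io (x ^+ m)%g = (io x ^+ m)%g.
  by elim: m => [//|m IHm]; rewrite !expgS ioM IHm.
have [p pp pc] := finPcharP k.
have pK : p \in [pchar K] by rewrite (fmorph_pchar e).
have pthroot (x : K) : x ^+ p = 1 -> x = 1.
  move=> xp; apply: (fmorph_inj (pFrobenius_aut pK)).
  by rewrite rmorph1 /= pFrobenius_autE.
pose V0 := [set x | [forall i, bdiag (io x) i == 1]]%SET.
have V0P x : reflect (forall i, bdiag (io x) i = 1) (x \in V0).
  by rewrite inE; apply: (iffP forallP) => h i; apply/eqP.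
have gV : group_set V0.
  apply/group_setP; split=> [|x y /V0P hx /V0P hy]; apply/V0P => i.
    by rewrite io1 bdiag1.
  by rewrite ioM bdiagM// hx hy mulr1.
pose A00 := [set x | is_diag_mx (P *m pt_val (io x) *m invmx P)]%SET.
have gA : group_set A00.
  apply/group_setP; split=> [|x y]; rewrite !inE.
    by rewrite io1 mulmx1 mulmxV// scalar_mx_is_diag.
  move=> dx dy; rewrite ioM pt_valM.
  have -> : P *m (pt_val (io x) *m pt_val (io y)) *m invmx P =
     (P *m pt_val (io x) *m invmx P) *m (P *m pt_val (io y) *m invmx P).
    by rewrite !mulmxA mulmxKV.
  exact: is_diag_mulmx.
have ordX x m : (x ^+ m)%g = 1%g -> iter m (mulmx (pt_val (io x))) 1%:M = 1%:M.
  by move=> xm; rewrite -pt_valX -ioX xm io1.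
have pV : (p.-group (Group gV))%g.
  apply/pgroupP => r rp /(Cauchy rp)[x /V0P Vx ox]; apply: contraT => rNp.
  have rK : r%:R != 0 :> K.
    by rewrite -(dvdn_pcharf pK) dvdn_prime2// eq_sym.
  have [P' uP' dP'] := finite_order_diag (prime_gt0 rp) rK (ordX x r (ltac:(by rewrite -ox expg_order))).
  have x1 : io x = 1%g by apply/val_inj/(diag_unip uP' dP'); apply/(bdiag_unip (Bio x)).
  have x1' : x = 1%g by apply: ioI; rewrite x1 io1.
  by move: ox rp; rewrite x1' order1 => <-.
have cV x y : [~ x, y]%g \in Group gV.
  apply/V0P => i; pose m z := bdiag (io z) i.
  have mM z w : m (z * w)%g = m z * m w by rewrite /m ioM bdiagM.
  have mV z : m z^-1%g * m z = 1 by rewrite -mM mulVg /m io1 bdiag1.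
  by rewrite -/(m _) /commg /conjg !mM [m x * _]mulrC [m y^-1%g * _]mulrA mV mul1r mV.
have rtV : forall x : FT, (x ^+ p)%g \in Group gV -> x \in Group gV.
  move=> x /V0P h; apply/V0P => i; apply: pthroot.
  by have := h i; rewrite ioX (proj2 (bdiagX p i (Bio x))).
(* An element of order p in A00 would be diagonal with p-th roots of unity as entries, and in
   characteristic p these are all 1. *)
have pA : (p^'.-group (Group gA))%g.
  rewrite /pgroup p'natE//; apply/negP => /(Cauchy pp)[x]; rewrite inE => dx ox.
  suff x1 : io x = 1%g.
    have x1' : x = 1%g by apply: ioI; rewrite x1 io1.
    by move: ox (prime_gt1 pp); rewrite x1' order1 => <-.
  apply: val_inj; set D := P *m _ *m _ in dx; change (pt_val (io x) = 1%:M).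
  have DE m : P *m pt_val (io (x ^+ m)%g) *m invmx P = iter m (mulmx D) 1%:M.
    elim: m => [|m IHm]; first by rewrite expg0 io1 mulmx1 mulmxV.
    by rewrite expgS ioM pt_valM /= -IHm /D !mulmxA mulmxKV.
  have D1 : D = 1%:M.
    have Dp : iter p (mulmx D) 1%:M = 1%:M by rewrite -DE -ox expg_order io1 mulmx1 mulmxV.
    apply/matrixP => i j; rewrite [RHS]mxE; case: eqVneq => [<-|ij]; last exact: (is_diag_mxP dx).
    apply: pthroot.
    have : forall m, is_diag_mx (iter m (mulmx D) 1%:M) /\ (iter m (mulmx D) 1%:M) i i = D i i ^+ m.
      elim=> [|m [IHd IHm]]; first by rewrite scalar_mx_is_diag mxE eqxx.
      rewrite /= is_diag_mulmx//; split => //.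
      by rewrite trig_mulmx_diag ?is_diag_mx_is_trig// IHm exprS.
    by move=> /(_ p)[_ <-]; rewrite Dp mxE eqxx.
  by rewrite -[pt_val _](mulKmx uP) -[P *m _](mulmxKV uP) -/D D1 mul1mx mulVmx.
have [A [sA abA pA' dec]] := abelian_p'_complement pp pV cV rtV pA.
have [y yb] : exists y, io y = b by apply/ioS; split => //; apply: Nfix; rewrite mem_head.
have [a [v [Aa /V0P Vv yE]]] := dec y.
exists (io a); split => //.
- by move=> i; rewrite -yb yE ioM bdiagM// Vv mul1r.
- move=> h hs; have [Bh dh] := sP h hs.
  have [z zh] : exists z, io z = h by apply/ioS; split => //; apply: Nfix; rewrite inE hs orbT.
  have Az : z \in A by apply: (fintype.subsetP sA); rewrite inE zh.
  by rewrite -zh -!ioM; congr io; apply: (centsP abA).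
(* The order of A is prime to p, so its elements are diagonalizable. *)
- apply: (finite_order_diag (cardG_gt0 A)).
    by rewrite -(dvdn_pcharf pK) -p'natE.
  by apply: ordX; apply/eqP; rewrite -order_dvdn order_dvdG.
Qed.

End BorelTriangular.

Section BorelTorus.
Variables (O : comUnitRingType) (d : nat) (G : split_reductive O d).
Variables (k : finFieldType) (K : closedFieldType) (e : {rmorphism k -> K}).
Hypothesis algK : integralRange e.
Variables (f0 : {rmorphism O -> k}) (f : {rmorphism O -> K}).
Hypothesis fE : forall x, e (f0 x) = f x.
Local Notation n := (gs_dim G).
Local Notation gT := (pts G f).
Local Notation B := (closed_points G (sr_bor G) K f).
Variables Q Qi : 'M[K]_n.
Hypothesis QQi : Q *m Qi = 1%:M.
Hypothesis QB : forall b, B b -> is_trig_mx (Q *m pt_val b *m Qi).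
Local Notation bdiag := (@bdiag O d G K f Q Qi).

Definition diagonal_in (P : 'M[K]_n) (g : gT) := is_diag_mx (P *m pt_val g *m invmx P).

(* A maximal diagonalizable subgroup of B containing T meets every fibre of  *)
(* the diagonal part map, because of semisimple_lift.                        *)
Lemma maximal_diagonal : exists2 P : 'M[K]_n, P \in unitmx &
  (forall t, diagonal_in P (sr_tor G f t)) /\
  (forall b, B b -> exists c, [/\ B c, diagonal_in P c & forall i, bdiag c i = bdiag b i]).
Proof.
have Btor t : B (sr_tor G f t) by apply: (@sr_bor_tor _ _ G _ f); exists t.
have [[_ _ _ [P0 uP0 P0T]] _] := sr_tor_max G f.
pose good m := `[< exists P (s : seq gT), [/\ P \in unitmx,
   forall t, diagonal_in P (sr_tor G f t), forall h, h \in s -> B h /\ diagonal_in P h,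
   free [seq pt_val h | h <- s] & size s = m] >].
have g0 : exists m, good m.
  exists 0%N; apply/asboolP; exists P0, [::]; split => //; last by rewrite nil_free.
  by move=> t; apply: P0T; exists t.
have gbound m : good m -> (m <= n * n)%N.
  move=> /asboolP[P [s [_ _ _ /eqP fs <-]]].
  have -> : (n * n)%N = \dim (fullv : {vspace 'M[K]_n}) by rewrite dimvf dim_matrix.
  by rewrite -(size_map (fun h : gT => pt_val h)) -fs; apply/dimvS/subvf.
have [m /asboolP[P [s [uP PT Ps fs sm]]] mmax] := ex_maxnP g0 gbound.
(* By maximality of m, an element of B that is diagonal in a basis diagonalizing both T and s lies
   in the linear span of s. *)
have span P' h : P' \in unitmx -> (forall t, diagonal_in P' (sr_tor G f t)) ->
    (forall h, h \in s -> B h /\ diagonal_in P' h) -> B h -> diagonal_in P' h ->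
    pt_val h \in << [seq pt_val h | h <- s] >>%VS.
  move=> uP' P'T P's Bh Ph; apply: contraT => hs.
  have : good m.+1.
    apply/asboolP; exists P', (h :: s); split => //=.
    - by move=> g; rewrite inE => /orP[/eqP ->|/P's].
    - by rewrite free_cons hs fs.
    - by rewrite sm.
  by move=> /mmax; rewrite ltnn.
exists P => //; split => // b Bb.
have [c [Bc cb cs [P1 uP1 dP1]]] := semisimple_lift algK fE QQi QB uP Ps Bb.
exists c; split => //.
have diagP' A : A \in pt_val c :: [seq pt_val h | h <- s] ->
    exists2 P, P \in unitmx & is_diag_mx (P *m A *m invmx P).
  rewrite inE => /orP[/eqP ->|/mapP[h hs ->]]; first by exists P1.
  by exists P => //; have [] := Ps h hs.
have comP : {in pt_val c :: [seq pt_val h | h <- s] &, forall A C, A *m C = C *m A}.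
  have ch h : h \in s -> pt_val c *m pt_val h = pt_val h *m pt_val c.
    by move=> /cs /(congr1 (fun g : gT => pt_val g)).
  have hh h h' : h \in s -> h' \in s -> pt_val h *m pt_val h' = pt_val h' *m pt_val h.
    move=> /Ps[_ dh] /Ps[_ dh'].
    have /codiagonalizableP[cc _] : exists2 P, P \in unitmx &
        all [pred A | mxred.similar_diag P A] [:: pt_val h; pt_val h'].
      exists P => //=; rewrite /mxred.similar_to /= !conjumx//.
      by rewrite -/(diagonal_in P h) -/(diagonal_in P h') dh dh'.
    by apply: cc; rewrite !inE eqxx ?orbT.
  move=> A C; rewrite !inE => /orP[/eqP ->|/mapP[h hs ->]] /orP[/eqP ->|/mapP[h' hs' ->]] //.
  - exact: ch.
  - by rewrite ch.
  - exact: hh.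
(* P' diagonalizes c and s. The torus lies in the span of s, so it is diagonal in P' as well;
   maximality applied to P' then puts c in that span, and c is diagonal in P. *)
have [P' uP' dP'] := codiag comP diagP'.
have ds h : h \in s -> diagonal_in P' h.
  by move=> hs; apply: dP'; rewrite inE map_f ?orbT.
have dspan g : pt_val g \in << [seq pt_val h | h <- s] >>%VS -> diagonal_in P' g.
  by move=> gs; apply: (is_diag_span gs) => _ /mapP[h hs ->]; apply: ds.
have dspan' g : pt_val g \in << [seq pt_val h | h <- s] >>%VS -> diagonal_in P g.
  by move=> gs; apply: (is_diag_span gs) => _ /mapP[h /Ps[_ hs] ->].
apply: dspan'; apply: (span P') => //.
- by move=> t; apply/dspan/(span P).
- by move=> h hs; split; [have [] := Ps h hs|exact: ds].
- by apply: dP'; rewrite mem_head.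
Qed.

(** The group H of elements of B diagonal in the basis of [maximal_diagonal] is closed, and it is
    connected as the image of B under the regular map [psi]. So H is a torus containing T, hence
    equal to T by maximality, and it meets every fibre of [bdiag]. *)
Lemma torus_fibre b : B b -> exists t, forall i, bdiag (sr_tor G f t) i = bdiag b i.
Proof.
move=> Bb; have [P uP [PT lift]] := maximal_diagonal.
have Btor t : B (sr_tor G f t) by apply: (@sr_bor_tor _ _ G _ f); exists t.
have [B1 BM BV] := sr_bor_sub G f.
pose H := [set g | B g /\ diagonal_in P g].
have [[[_ Bcl Bcn _] _] [_ Tmax]] := (sr_bor_borel G f, sr_tor_max G f).
have PPi : P *m invmx P = 1%:M by rewrite mulmxV.
(* The last nonzero entry of a column of M = Q P^-1, an eigenvector of the   *)
(* triangular matrices, picks out the corresponding eigenvalue.              *)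
have [j jE] : exists j : 'I_n -> 'I_n, forall h, H h -> forall i,
    (P *m pt_val h *m invmx P) i i = bdiag h (j i).
  suff /choice[j jE] : forall i, exists j, forall h, H h ->
      (P *m pt_val h *m invmx P) i i = bdiag h j.
    by exists j => h Hh i; apply: jE.
  move=> i; pose M := P *m Qi.
  have [l Ml lmin] : exists2 l, M i l != 0 & forall l' : 'I_n, (l < l')%N -> M i l' = 0.
    have ex : exists l : nat, [exists l' : 'I_n, (l' == l :> nat) && (M i l' != 0)].
      have : row i M != 0.
        apply/eqP => /(congr1 (mulmx^~ (Q *m invmx P))); rewrite mul0mx -row_mul /M.
        rewrite !mulmxA -[P *m Qi *m Q]mulmxA (mulmx1C QQi) mulmx1 PPi.
        by move=> /rowP/(_ i)/eqP; rewrite !mxE eqxx oner_eq0.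
      by move=> /rV0Pn[l]; rewrite mxE => Ml; exists l; apply/existsP; exists l; rewrite eqxx.
    have bd l : [exists l' : 'I_n, (l' == l :> nat) && (M i l' != 0)] -> (l <= n)%N.
      by move=> /existsP[l' /andP[/eqP <- _]]; apply: ltnW.
    have [l0 /existsP[l /andP[/eqP <- Ml]] lmax] := ex_maxnP ex bd.
    exists l => // l' ll'; apply/eqP; apply: contraTT ll' => Ml'.
    by rewrite -leqNgt; apply: lmax; apply/existsP; exists l'; rewrite eqxx.
  exists l => h [Bh dh].
  have E : (P *m pt_val h *m invmx P) *m M = M *m (Q *m pt_val h *m Qi).
    by rewrite /M !mulmxA mulmxKV// -[P *m Qi *m Q]mulmxA (mulmx1C QQi) mulmx1.
  have := congr1 (fun A : 'M[K]_n => A i l) E; rewrite mxE (bigD1 i)//= big1 ?addr0; last first.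
    by move=> a ai; rewrite (is_diag_mxP dh) ?mul0r// eq_sym.
  rewrite [RHS]mxE (bigD1 l)//= big1 ?addr0 => [|a al].
    by rewrite mulrC => /(mulfI Ml).
  have [la|al'] := ltnP l a; first by rewrite lmin ?mul0r.
  by rewrite (is_trig_mxP (QB Bh)) ?mulr0// ltn_neqAle al.
(* A regular retraction of B onto H: g goes to the element of H with the same diagonal part. *)
pose psi g := invmx P *m diag_mx (\row_i bdiag g (j i)) *m P.
have psiH h : H h -> psi h = pt_val h.
  move=> Hh; have [Bh dh] := Hh; rewrite /psi.
  have -> : diag_mx (\row_i bdiag h (j i)) = P *m pt_val h *m invmx P.
    apply/matrixP => a b'; rewrite mxE; case: eqVneq => [<-|ab].
      by rewrite mulr1n mxE jE.
    by rewrite mulr0n (is_diag_mxP dh).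
  by rewrite !mulmxA mulVmx// mul1mx mulmxKV.
have psiB g : B g -> exists2 h, H h & pt_val h = psi g.
  move=> Bg; have [c [Bc dc cg]] := lift g Bg; exists c; first by split.
  rewrite -psiH//; congr (_ *m diag_mx _ *m _).
  by apply/rowP => i; rewrite !mxE cg.
have rpsi : regular_mx psi.
  apply: regular_mxM; last exact: regular_mx_cst.
  apply: regular_mxM; first exact: regular_mx_cst.
  move=> a b'; under eq_fun do rewrite mxE.
  case: (eqVneq a b') => _; last by under eq_fun do rewrite mulr0n; exact: regular_cst.
  under eq_fun do rewrite mulr1n mxE.
  suff rQ : regular_mx (fun g : gT => Q *m pt_val g *m Qi) by apply: rQ.
  apply: regular_mxM; last exact: regular_mx_cst.
  by apply: regular_mxM; [exact: regular_mx_cst|exact: regular_mx_val].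
have tH : is_torus H.
  split.
  - split=> [|x y [Bx dx] [By dy]|x [Bx dx]].
    + by split => //; rewrite /diagonal_in mulmx1 PPi scalar_mx_is_diag.
    + split; first exact: BM.
      have -> : diagonal_in P (x * y)%g =
          is_diag_mx ((P *m pt_val x *m invmx P) *m (P *m pt_val y *m invmx P)).
        by rewrite /diagonal_in pt_valM !mulmxA mulmxKV.
      exact: is_diag_mulmx.
    + split; first exact: BV.
      have ux : pt_val x \in unitmx by have [] := asboolW (pt_in x).
      pose D := P *m pt_val x *m invmx P; pose D' := P *m invmx (pt_val x) *m invmx P.
      have DD' : D *m D' = 1%:M by rewrite /D /D' !mulmxA mulmxKV// mulmxK.
      apply/is_diag_mxP => a b' ab; rewrite pt_valV -/D'.
      have := congr1 (fun A : 'M[K]_n => A a b') DD'.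
      rewrite mxE (bigD1 a)//= big1 ?addr0; last first.
        by move=> l la; rewrite (is_diag_mxP dx) ?mul0r// eq_sym.
      rewrite [RHS]mxE -(inj_eq val_inj) (negPf ab) => /eqP; rewrite mulf_eq0 => /orP[/eqP Daa|/eqP//].
      have := congr1 (fun A : 'M[K]_n => A a a) DD'.
      rewrite mxE (bigD1 a)//= big1 ?addr0; last first.
        by move=> l la; rewrite (is_diag_mxP dx) ?mul0r// eq_sym.
      by rewrite Daa mul0r => /esym; rewrite mxE eqxx => /eqP; rewrite oner_eq0.
  - have -> : H = B `&` [set g | forall ab : {ab : 'I_n * 'I_n | ab.1 != ab.2 :> nat},
        (P *m pt_val g *m invmx P) (val ab).1 (val ab).2 = 0].
      apply/seteqP; split => g [Bg dg]; split => //.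
        by move=> [[a b'] /= ab]; apply: (is_diag_mxP dg).
      by apply/is_diag_mxP => a b' ab; apply: (dg (exist _ (a, b') ab)).
    apply: zclosedI => //; apply: zclosed_bigcap => -[[a b'] ab].
    apply: zclosed_regular.
    suff rP : regular_mx (fun g : gT => P *m pt_val g *m invmx P) by apply: rP.
    apply: regular_mxM; last exact: regular_mx_cst.
    by apply: regular_mxM; [exact: regular_mx_cst|exact: regular_mx_val].
  - apply: (zcn_image rpsi _ _ Bcn) => [x /psiB//|y Hy].
    by exists y; [case: Hy|rewrite psiH].
  - by exists P => // x [].
have HT : H `<=` range (sr_tor G f).
  by apply: Tmax => // _ [t _ <-]; split.
have [c [Bc dc cb]] := lift b Bb.
have [|t _ tc] := HT c; first by split.
by exists t; rewrite tc.
Qed.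

(** The quotient of the two torus elements is unipotent and diagonalizable, hence trivial. *)
Lemma torus_bdiag_inj s t : (forall i, bdiag (sr_tor G f s) i = bdiag (sr_tor G f t) i) -> s = t.
Proof.
move=> E; have Btor u : B (sr_tor G f u) by apply: (@sr_bor_tor _ _ G _ f); exists u.
have [[_ _ _ [P0 uP0 P0T]] _] := sr_tor_max G f.
have [B1 BM BV] := sr_bor_sub G f.
have torV u : sr_tor G f u^-1%g = (sr_tor G f u)^-1%g.
  have tor1 : sr_tor G f 1%g = 1%g.
    by apply: (mulgI (sr_tor G f 1%g)); rewrite -sr_torM !mulg1.
  by apply: (mulgI (sr_tor G f u)); rewrite -sr_torM !mulgV tor1.
apply: (@sr_tor_inj _ _ G _ f); apply: (mulgI (sr_tor G f t)^-1%g); rewrite mulVg.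
apply: val_inj; apply: (diag_unip uP0); first by apply: P0T; exists (t^-1 * s)%g; rewrite // sr_torM torV.
apply/(bdiag_unip QQi QB) => [|i]; first by apply: (BM) => //; apply: BV.
have BVt := BV _ (Btor t).
have := bdiag1 (G := G) f QQi i; rewrite -(mulVg (sr_tor G f t)) !(bdiagM QQi QB)//.
by rewrite E.
Qed.

End BorelTorus.

(** [tau x] is the torus element with the same diagonal part as x, which exists over K by
    [torus_fibre]. It is rational over k: write x = t u with u unipotent; Frobenius fixes x and
    keeps u unipotent, so t and its Frobenius image have the same diagonal part and coincide by
    [torus_bdiag_inj]. *)
Lemma borel_retraction_closure (O : comUnitRingType) (d : nat) (G : split_reductive O d)
  (k : finFieldType) (f0 : {rmorphism O -> k}) (K : closedFieldType)
  (e : {rmorphism k -> K}) (algK : integralRange e)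
  (f : {rmorphism O -> K}) (fE : forall x, e (f0 x) = f x) :
  exists tau : pts G f0 -> Gm d k,
    [/\ forall x y, closed_points G (sr_bor G) k f0 x -> closed_points G (sr_bor G) k f0 y ->
          tau (x * y)%g = (tau x * tau y)%g,
        forall t, tau (sr_tor G f0 t) = t &
        forall x, closed_points G (sr_bor G) k f0 x -> unipotent x <-> tau x = 1%g].
Proof.
pose B0 := closed_points G (sr_bor G) k f0; pose B := closed_points G (sr_bor G) K f.
have [BS _] := sr_bor_borel G f.
have [Q [Qi [QQi QB]]] := lie_kolchin BS (And3 (@regular_mx_val _ _ _ f) erefl
  (fun x y _ _ => erefl)).
have Btor t : B (sr_tor G f t) by apply: (@sr_bor_tor _ _ G _ f); exists t.
have B0tor t : B0 (sr_tor G f0 t) by apply: (@sr_bor_tor _ _ G _ f0); exists t.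
pose up : pts G f0 -> pts G f := pts_map fE.
have Bup x : B0 x -> B (up x) by apply: closed_points_map.
have upM x y : up (x * y)%g = (up x * up y)%g by apply: pts_mapM.
have uptor t : up (sr_tor G f0 t) = sr_tor G f (Gm_map e t) by apply: sr_tor_nat.
have [B1 BM BV] := sr_bor_sub G f.
have fib x : B0 x -> exists s, forall i,
    bdiag Q Qi (sr_tor G f (Gm_map e s)) i = bdiag Q Qi (up x) i.
  move=> B0x; have Bx := Bup _ B0x; have [t tE] := torus_fibre algK fE QQi QB Bx.
  pose F := pts_map (frob_base_f fE 1) : pts G f -> pts G f.
  have FM y z : F (y * z)%g = (F y * F z)%g by apply: pts_mapM.
  have FB y : B y -> B (F y) by apply: closed_points_map.
  have Ftor : F (sr_tor G f t) = sr_tor G f (Gm_map (frob e 1) t) by apply: sr_tor_nat.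
  have Fx : F (up x) = up x.
    by apply/val_inj/matrixP => i j; rewrite !mxE /= frob_base.
  pose u := ((sr_tor G f t)^-1 * up x)%g.
  have Bu : B u := BM _ _ (BV _ (Btor t)) Bx.
  have xE : up x = (sr_tor G f t * u)%g by rewrite mulVKg.
  have u1 : unipotent u.
    apply/(bdiag_unip QQi QB Bu) => i.
    have Bt := Btor t; have BVt := BV _ Bt; rewrite (bdiagM QQi QB _ BVt Bx) -tE.
    have := bdiag1 (G := G) f QQi i.
    by rewrite -(mulVg (sr_tor G f t)) (bdiagM QQi QB _ BVt Bt).
  have Fu1 : unipotent (F u).
    move: u1; rewrite /unipotent /= -map_char_poly => ->; by rewrite rmorphXn rmorphB /= map_polyX rmorph1.
  have tfix : Gm_map (frob e 1) t = t.
    apply: (torus_bdiag_inj QQi QB) => i; rewrite -Ftor tE -Fx xE FM.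
    rewrite !(bdiagM QQi QB)//; [|exact: FB|by apply: FB].
    by rewrite (proj1 (bdiag_unip QQi QB (FB _ Bu)) Fu1) mulr1.
  have /choice[s sE] : forall i, exists a, t 0 i = e a.
    move=> i; apply: (@frob1_base _ _ e).
    by have := congr1 (fun u : Gm d K => u 0 i) tfix; rewrite /= mxE.
  have su : [forall i, (\row_i s i) 0 i \is a GRing.unit].
    apply/forallP => i; rewrite mxE unitfE -(fmorph_eq0 e) -sE -unitfE; exact: Gm_unitE.
  exists (MkGm su) => i; rewrite -tE; congr (bdiag _ _ (sr_tor G f _) _).
  by apply/val_inj/rowP => a; rewrite !mxE -sE.
have /choice[tau tauE] : forall x, exists s, B0 x -> forall i,
    bdiag Q Qi (sr_tor G f (Gm_map e s)) i = bdiag Q Qi (up x) i.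
  move=> x; have [/fib[s sE]|nBx] := pselect (B0 x); first by exists s.
  by exists 1%g.
have eI s t : Gm_map e s = Gm_map e t -> s = t.
  move=> /(congr1 val)/rowP E; apply/val_inj/rowP => i; apply: (fmorph_inj e).
  by have := E i; rewrite !mxE.
have tauU x s : B0 x -> (forall i, bdiag Q Qi (sr_tor G f (Gm_map e s)) i = bdiag Q Qi (up x) i) ->
    tau x = s.
  move=> Bx E; apply/eI/(torus_bdiag_inj QQi QB) => i.
  by rewrite tauE// E.
have mapM s t : Gm_map e (s * t)%g = (Gm_map e s * Gm_map e t)%g.
  by apply/val_inj/rowP => i; rewrite !mxE rmorphM.
have [_ B0M _] := sr_bor_sub G f0.
exists tau; split.
- move=> x y Bx By; apply: tauU; first exact: B0M.
  move=> i; have Bx1 := Bup _ Bx; have By1 := Bup _ By.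
  have Bt := Btor (Gm_map e (tau x)); have Bt' := Btor (Gm_map e (tau y)).
  rewrite mapM sr_torM upM !(bdiagM QQi QB)//.
  by rewrite !tauE.
- by move=> t; apply: tauU => // i; rewrite uptor.
- move=> x Bx; have Bx' := Bup _ Bx.
  have upU : unipotent x <-> unipotent (up x).
    rewrite /unipotent /= -map_char_poly.
    have -> : ('X - 1) ^+ gs_dim G = map_poly e (('X - 1) ^+ gs_dim G).
      by rewrite rmorphXn rmorphB /= map_polyX rmorph1.
    by split=> [->//|]; apply: map_poly_inj.
  have tor1 : sr_tor G f (Gm_map e 1%g) = 1%g.
    have -> : Gm_map e 1%g = (1%g : Gm d K) by apply/val_inj/rowP => i; rewrite !mxE rmorph1.
    by apply: (mulgI (sr_tor G f 1%g)); rewrite -sr_torM !mulg1.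
  rewrite upU (bdiag_unip QQi QB Bx'); split=> [E|E i].
    by apply: tauU => // i; rewrite tor1 bdiag1// E.
  by rewrite -tauE// E tor1 bdiag1.
Qed.

(* The quotient of a Borel subgroup by its unipotent radical is T, already on *)
(* points over a finite field.                                                *)
Lemma borel_retraction (O : comUnitRingType) (d : nat) (G : split_reductive O d)
  (k : finFieldType) (f0 : {rmorphism O -> k}) :
  exists tau : pts G f0 -> Gm d k,
    [/\ forall x y, closed_points G (sr_bor G) k f0 x -> closed_points G (sr_bor G) k f0 y ->
          tau (x * y)%g = (tau x * tau y)%g,
        forall t, tau (sr_tor G f0 t) = t &
        forall x, closed_points G (sr_bor G) k f0 x -> unipotent x <-> tau x = 1%g].
Proof.
have [K [e algK]] := countable_algebraic_closure k.
exact: (borel_retraction_closure G algK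
  (f := GRing.RMorphism.clone _ _ (e \o f0) _) (fun=> erefl)).
Qed.

(** * Unramified extensions of local fields *)

Section LocalField.
Variable L : local_field.
Local Notation K := (lf_K L).
Local Notation O := (lf_O L).
Local Notation k := (lf_k L).
Local Notation v := (@lf_val L).
Local Notation inc := (lf_inc L).
Local Notation red := (lf_red L).

Lemma lf_val_1 : v 1 = 0.
Proof. by have := lf_valM (oner_neq0 K) (oner_neq0 K); rewrite mulr1 => /eqP; rewrite addrC -subr_eq subrr => /eqP. Qed.

Lemma lf_val_N1 : v (-1) = 0.
Proof.
have N1 : (-1 : K) != 0 by rewrite oppr_eq0 oner_neq0.
have := lf_valM N1 N1; rewrite mulrNN mulr1 lf_val_1 => /esym/eqP.
by rewrite -mulr2n mulrn_eq0 => /eqP.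
Qed.

Lemma vge0 N : vge v N 0. Proof. by rewrite /vge eqxx. Qed.

Lemma vgeM M N x y : vge v M x -> vge v N y -> vge v (M + N) (x * y).
Proof.
rewrite /vge mulf_eq0; case: (eqVneq x 0) => //= x0; case: (eqVneq y 0) => //= y0.
by move=> hM hN; rewrite lf_valM// lerD.
Qed.

Lemma vge_le M N x : M <= N -> vge v N x -> vge v M x.
Proof. by rewrite /vge; case: (x == 0) => //= MN; apply: le_trans. Qed.

Lemma vgeN N x : vge v N (- x) = vge v N x.
Proof.
rewrite /vge oppr_eq0; case: (eqVneq x 0) => //= x0.
by rewrite -mulN1r lf_valM// ?lf_val_N1 ?add0r// oppr_eq0 oner_neq0.
Qed.

Lemma vge_sum (I : Type) (s : seq I) (P : pred I) (u : I -> K) N :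
  (forall i, P i -> vge v N (u i)) -> vge v N (\sum_(i <- s | P i) u i).
Proof. by move=> h; elim/big_ind: _ => //; [exact: vge0|move=> x y; apply: lf_valD]. Qed.

Lemma vge_oo x : (forall n : nat, vge v n%:Z x) -> x = 0.
Proof.
move=> h; apply/eqP; apply: contraT => x0.
have := h (`|v x|.+1); rewrite /vge (negPf x0)/= leNgt => /negP; case.
by apply: le_lt_trans (ler_norm _) _; rewrite -abszE ltz_nat.
Qed.

Lemma lf_valV x : x != 0 -> v x^-1 = - v x.
Proof.
move=> x0; apply/eqP; rewrite -addr_eq0 -lf_valM ?invr_eq0//.
by rewrite mulVf// lf_val_1.
Qed.

Definition Dge (n : nat) (a : O) := vge v n%:Z (inc a).

Lemma Dge0 a : Dge 0 a. Proof. by apply/lf_integers; exists a. Qed.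

Lemma DgeD n a b : Dge n a -> Dge n b -> Dge n (a + b).
Proof. by rewrite /Dge rmorphD; apply: lf_valD. Qed.

Lemma DgeN n a : Dge n (- a) = Dge n a.
Proof. by rewrite /Dge rmorphN vgeN. Qed.

Lemma Dge_zero n : Dge n 0. Proof. by rewrite /Dge rmorph0 vge0. Qed.

Lemma DgeM m n a b : Dge m a -> Dge n b -> Dge (m + n) (a * b).
Proof. by rewrite /Dge rmorphM PoszD; apply: vgeM. Qed.

Lemma Dge_mulr n a b : Dge n b -> Dge n (a * b).
Proof. exact: (DgeM (Dge0 a)). Qed.

Lemma Dge_le m n a : (m <= n)%N -> Dge n a -> Dge m a.
Proof. by move=> mn; apply: vge_le; rewrite lez_nat. Qed.

Lemma Dge_oo a : (forall n, Dge n a) -> a = 0.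
Proof. by move=> h; apply: (@lf_inc_inj L); rewrite rmorph0; apply: vge_oo. Qed.

Lemma Dge1P a : Dge 1 a <-> red a = 0.
Proof. by split=> /lf_red_ker. Qed.

Lemma Dge_sum (I : Type) (s : seq I) (P : pred I) (u : I -> O) n :
  (forall i, P i -> Dge n (u i)) -> Dge n (\sum_(i <- s | P i) u i).
Proof. by move=> h; elim/big_ind: _ => //; [exact: Dge_zero|move=> x y; apply: DgeD]. Qed.

Lemma lf_unitP a : a \is a GRing.unit <-> red a != 0.
Proof.
split=> [ua|ra].
  by rewrite -unitfE; apply: rmorph_unit.
have a0 : inc a != 0.
  by apply: contra ra => /eqP a0; apply/eqP/Dge1P; rewrite /Dge a0 vge0.
have [b bE] : exists b, inc b = (inc a)^-1.
  apply/lf_integers; rewrite /vge invr_eq0 (negPf a0)/= lf_valV//.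
  have := Dge0 a; have /Dge1P/negP : red a <> 0 by apply/eqP.
  rewrite /Dge /vge (negPf a0)/= -ltNge => h1 h2.
  by rewrite oppr_ge0 -ltzD1.
apply/unitrP; exists b; split; apply: (@lf_inc_inj L); rewrite rmorphM rmorph1 bE.
  by rewrite mulVf.
by rewrite mulfV.
Qed.

Lemma lf_complete_K (u : nat -> K) : (forall m : nat, vge v m%:Z (u m.+1 - u m)) ->
  exists l, forall m : nat, vge v m%:Z (l - u m).
Proof.
move=> hu; have step (m i : nat) : (m <= i)%N -> vge v m%:Z (u i - u m).
  move=> mi; rewrite -(subnKC mi); elim: (i - m)%N => [|j IHj].
    by rewrite addn0 subrr vge0.
  rewrite addnS -(subrK (u (m + j)%N) (u _.+1)) -addrA; apply: lf_valD => //.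
  by apply: vge_le (hu _); rewrite lez_nat leq_addr.
have [l ul] : exists l, v_converges v u l.
  apply: lf_complete => N; exists `|N|%N => i j Ni Nj.
  have NN : N <= `|N|%N by rewrite abszE ler_norm.
  apply: (vge_le NN); rewrite -(subrK (u `|N|%N) (u i)) -addrA; apply: lf_valD; first exact: step.
  by rewrite -opprB vgeN; apply: step.
exists l => m; have [i hi] := ul m; have := hi (maxn i m) (leq_maxl _ _).
rewrite -vgeN opprB => h.
rewrite -(subrK (u (maxn i m)) l) -addrA; apply: lf_valD => //.
by apply: step; apply: leq_maxr.
Qed.

Lemma lf_complete_O (u : nat -> O) : (forall m, Dge m (u m.+1 - u m)) ->
  exists l, forall m, Dge m (l - u m).
Proof.
move=> hu; have [m|l lu] := @lf_complete_K (inc \o u).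
  by rewrite /= -rmorphB; apply: hu.
have [l' l'E] : exists l', inc l' = l.
  apply/lf_integers; rewrite -(subrK (inc (u 0%N)) l); apply: lf_valD; first exact: lu.
  by apply/lf_integers; exists (u 0%N).
by exists l' => m; rewrite /Dge rmorphB l'E; apply: lu.
Qed.

Lemma lf_uniformizer : exists p : O, inc p != 0 /\ v (inc p) = 1.
Proof.
have [x x0 vx] := lf_val1 L.
have [p pE] : exists p, inc p = x by apply/lf_integers; rewrite /vge vx orbT.
by exists p; rewrite pE.
Qed.

Section Uniformizer.
Variable p : O.
Hypotheses (p0 : inc p != 0) (vp : v (inc p) = 1).

Lemma lf_valX n : v (inc p ^+ n) = n%:Z.
Proof.
elim: n => [|n IHn]; first by rewrite expr0 lf_val_1.
by rewrite exprS lf_valM ?expf_neq0// IHn vp -PoszD.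
Qed.

Lemma DgeP n a : Dge n a <-> exists b, a = p ^+ n * b.
Proof.
split=> [|[b ->]]; last first.
  rewrite mulrC; apply: Dge_mulr; rewrite /Dge rmorphXn /vge lf_valX.
  by rewrite lexx orbT.
move=> Da; have pn0 : inc p ^+ n != 0 by rewrite expf_neq0.
have [b bE] : exists b, inc b = inc a / inc p ^+ n.
  apply/lf_integers; rewrite -(subrr (n%:Z)); apply: vgeM => //.
  by rewrite /vge lf_valV// lf_valX lexx orbT.
exists b; apply: (@lf_inc_inj L); rewrite rmorphM rmorphXn bE mulrC mulfVK//.
Qed.

Lemma lf_fraction x : exists n a, x = inc a / inc p ^+ n.
Proof.
have pn0 n : inc p ^+ n != 0 by rewrite expf_neq0.
exists `|v x|%N; have [a aE] : exists a, inc a = x * inc p ^+ `|v x|.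
  apply/lf_integers; rewrite /vge mulf_eq0 (negPf (pn0 _)) orbF.
  case: (eqVneq x 0) => //= x0; rewrite lf_valM// lf_valX abszE.
  by rewrite addrC -lerBlDr sub0r -normrN ler_norm.
by exists a; rewrite aE mulfK.
Qed.

(** Total boundedness of the ring of integers, from the finiteness of the residue field; it feeds
    the compactness proof through [ultra_matrix_limit]. *)
Lemma residue_cover n : exists s : seq O, forall a, exists2 b, b \in s & Dge n (a - b).
Proof.
elim: n => [|n [s sP]]; first by exists [:: 0] => a; exists 0; rewrite ?inE ?eqxx// Dge0.
have /choice[lift liftE] := @lf_red_surj L.
exists [seq b + p ^+ n * lift c | b <- s, c <- enum k] => a.
have [b bs /DgeP[c cE]] := sP a.
exists (b + p ^+ n * lift (red c)).
  by apply/allpairsP; exists (b, red c); rewrite mem_enum.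
rewrite opprD addrA cE -mulrBr -addn1; apply: DgeM; first by apply/DgeP; exists 1; rewrite mulr1.
by apply/Dge1P; rewrite rmorphB liftE subrr.
Qed.

End Uniformizer.

Lemma prim_root_residue : exists g : k, (#|k|.-1).-primitive_root g.
Proof.
have q1 : (0 < #|k|.-1)%N by rewrite -subn1 subn_gt0 finNzRing_gt1.
pose rs := [seq x <- enum k | x != 0].
have rsP x : (x \in rs) = (x != 0) by rewrite mem_filter mem_enum andbT.
have : has (#|k|.-1).-primitive_root rs.
  apply: has_prim_root => //.
  - apply/allP => x; rewrite rsP => x0; apply/unity_rootP; apply: (mulfI x0).
    by rewrite -exprS prednK ?expf_card ?mulr1// (ltn_trans _ (finNzRing_gt1 k)).
  - by rewrite filter_uniq ?enum_uniq.
  - rewrite size_filter -[X in (X <= _)%N]/(#|k|.-1) cardE.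
    rewrite -(count_predC (fun x : k => x == 0) (enum k)).
    by rewrite count_uniq_mem ?enum_uniq// mem_enum.
by move=> /hasP[g _ gP]; exists g.
Qed.

(** z is the limit of a^(|k|^m) for any lift a of g. Raising to the power |k| improves a congruence
    by one step, because the cofactor of x - y in x^|k| - y^|k| reduces to |k| y^(|k|-1) = 0. *)
Lemma teichmuller (g : k) : exists z : O, red z = g /\ z ^+ #|k| = z.
Proof.
have [a ag] := lf_red_surj g; pose u m := a ^+ (#|k| ^ m).
have powD n x y : Dge n.+1 (x - y) -> Dge n.+2 (x ^+ #|k| - y ^+ #|k|).
  move=> D; rewrite subrXX -[n.+2]addn1; apply: DgeM => //.
  apply/Dge1P; rewrite rmorph_sum /=.
  have /Dge1P : Dge 1 (x - y) by apply: Dge_le D.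
  rewrite rmorphB => /eqP; rewrite subr_eq0 => /eqP xy.
  rewrite (eq_bigr (fun=> red y ^+ #|k|.-1)) => [|i _].
    rewrite sumr_const card_ord -mulr_natr.
    have [p pp pc] := finPcharP k.
    suff -> : #|k|%:R = 0 :> k by rewrite mulr0.
    apply/eqP; rewrite -(dvdn_pcharf pc).
    have [e e0 ->] : exists2 e, (0 < e)%N & #|k| = (p ^ e)%N.
      have : (p.-group [set: k]%SET)%g := abelem_pgroup (fin_ring_pchar_abelem pc).
      rewrite pgroupE cardsT => /p_natP[e E]; exists e => //.
      by rewrite lt0n; apply: contraTneq (finNzRing_gt1 k) => e0; rewrite E e0.
    by rewrite dvdn_exp.
  rewrite rmorphM !rmorphXn xy -exprD; congr (_ ^+ _).
  by rewrite subnK// -ltnS prednK// (leq_ltn_trans _ (ltn_ord i)).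
have us m : Dge m.+1 (u m.+1 - u m).
  have uS i : u i.+1 = u i ^+ #|k| by rewrite /u expnSr exprM.
  elim: m => [|m IHm]; last by rewrite (uS m.+1) [X in _ - X](uS m); apply: powD.
  by apply/Dge1P; rewrite rmorphB /u expn1 expn0 rmorphXn expf_card expr1 subrr.
have [z zE] := @lf_complete_O u (fun m => Dge_le (leqnSn m) (us m)).
exists z; split.
  have D1 : Dge 1 (z - a).
    rewrite -(subrK (u 1%N) z) -addrA; apply: DgeD; first exact: zE.
    by have := us 0%N; rewrite {2}/u expn0 expr1.
  by move/Dge1P: D1; rewrite rmorphB ag => /eqP; rewrite subr_eq0 => /eqP.
apply/eqP; rewrite -subr_eq0; apply/eqP; apply: Dge_oo => n.
have h1 : Dge n (z ^+ #|k| - u n.+2).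
  rewrite /u expnSr exprM -/(u n.+1); apply: Dge_le (powD n _ _ (zE n.+1)).
  by rewrite ltnW.
rewrite -(subrK (u n.+2) (z ^+ _)) -addrA; apply: DgeD => //.
by rewrite -opprB DgeN; apply: Dge_le (zE n.+2); rewrite ltnW.
Qed.

End LocalField.

(** * Frobenius as a power of theta *)

Section Extension.
Variables (F E : local_field) (r : nat) (X : unramified_ext F E r).
Local Notation OF := (lf_O F).
Local Notation OE := (lf_O E).
Local Notation kF := (lf_k F).
Local Notation kE := (lf_k E).
Local Notation iF := (lf_inc F).
Local Notation iE := (lf_inc E).
Local Notation uK := (ue_K X).
Local Notation uO := (ue_O X).
Local Notation thO := (ue_thetaO X).
Local Notation th := (ue_theta X).

Lemma vge_ue N x : vge (@lf_val E) N (uK x) = vge (@lf_val F) N x.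
Proof. by rewrite /vge fmorph_eq0; case: (eqVneq x 0) => //= x0; rewrite ue_unram. Qed.

Lemma Dge_ue n a : Dge n (uO a) = Dge n a.
Proof. by rewrite /Dge ue_compat vge_ue. Qed.

Lemma thetaO_ue a : thO (uO a) = uO a.
Proof. by apply: (@lf_inc_inj E); rewrite ue_theta_compat ue_compat ue_theta_fix. Qed.

(* By successive approximation, as OF is complete. *)
Lemma approx_span (p : OF) m (x : 'I_m -> OE) (Y : set OE) :
  iF p != 0 -> lf_val (iF p) = 1 ->
  (forall y, Y y -> exists (c : 'I_m -> OF) y', Y y' /\ y = \sum_i uO (c i) * x i + uO p * y') ->
  forall y, Y y -> exists c : 'I_m -> OF, y = \sum_i uO (c i) * x i.
Proof.
move=> p0 vp step y0 Yy0; have ip0 : iE (uO p) != 0 by rewrite ue_compat fmorph_eq0.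
have vip : lf_val (iE (uO p)) = 1 by rewrite ue_compat ue_unram.
have /choice[nxt nxtP] : forall y, exists cy : ('I_m -> OF) * OE, Y y ->
    Y cy.2 /\ y = \sum_i uO (cy.1 i) * x i + uO p * cy.2.
  move=> y; have [/step[c [y' h]]|nY] := pselect (Y y); first by exists (c, y').
  by exists (fun=> 0, 0).
pose ys n := iter n (fun y => (nxt y).2) y0.
have Yys n : Y (ys n) by elim: n => [//|n IHn] /=; have [] := nxtP _ IHn.
pose C n i := \sum_(j < n) p ^+ j * (nxt (ys j)).1 i.
have yE n : y0 = \sum_i uO (C n i) * x i + uO p ^+ n * ys n.
  elim: n => [|n {1}->].
    by rewrite big1 ?add0r ?mul1r// => i _; rewrite /C big_ord0 rmorph0 mul0r.
  have [_ {1}->] := nxtP _ (Yys n); rewrite mulrDr addrA mulrA -exprSr; congr (_ + _).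
  rewrite big_distrr /= -big_split /=; apply: eq_bigr => i _.
  by rewrite /C big_ord_recr /= rmorphD rmorphM rmorphXn mulrDl mulrA.
have /choice[c cE] : forall i, exists l, forall n, Dge n (l - C n i).
  move=> i; apply: lf_complete_O => n; rewrite /C big_ord_recr /= addrAC subrr add0r.
  by rewrite mulrC; apply: Dge_mulr; apply/(DgeP p0 vp); exists 1; rewrite mulr1.
exists c; apply/eqP; rewrite -subr_eq0; apply/eqP/Dge_oo => n.
rewrite {1}(yE n) addrAC -sumrB; apply: DgeD; last first.
  by apply/(DgeP ip0 vip); exists (ys n).
apply: Dge_sum => i _; rewrite -mulrBl mulrC -rmorphB; apply: Dge_mulr.
by rewrite Dge_ue -opprB DgeN.
Qed.

Definition res_lift L (x : lf_k L) : lf_O L := projT1 (cid (lf_red_surj x)).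

Lemma res_liftK L (x : lf_k L) : lf_red L (res_lift x) = x.
Proof. by rewrite /res_lift; case: cid. Qed.

Definition res_ext (x : kF) : kE := lf_red E (uO (res_lift x)).

Lemma res_extE a : res_ext (lf_red F a) = lf_red E (uO a).
Proof.
apply/eqP; rewrite -subr_eq0 -!rmorphB /=; apply/eqP/Dge1P.
by rewrite Dge_ue; apply/Dge1P; rewrite rmorphB res_liftK subrr.
Qed.

Definition res_theta (x : kE) : kE := lf_red E (thO (res_lift x)).

(** A uniformizer of F is fixed by theta and remains a uniformizer of E. Hence theta acts on
    residues. *)
Lemma Dge_theta n a : Dge n a -> Dge n (thO a).
Proof.
have [p [p0 vp]] := lf_uniformizer F.
have ip0 : iE (uO p) != 0 by rewrite ue_compat fmorph_eq0.
have vip : lf_val (iE (uO p)) = 1 by rewrite ue_compat ue_unram.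
move=> /(DgeP ip0 vip)[b ->]; apply/(DgeP ip0 vip); exists (thO b).
by rewrite rmorphM rmorphXn /= thetaO_ue.
Qed.

Lemma res_thetaE a : res_theta (lf_red E a) = lf_red E (thO a).
Proof.
apply/eqP; rewrite -subr_eq0 -!rmorphB /=; apply/eqP/Dge1P/Dge_theta.
by apply/Dge1P; rewrite rmorphB res_liftK subrr.
Qed.

Fact res_ext_zmod_morphism : zmod_morphism res_ext.
Proof. by move=> x y; rewrite -[x]res_liftK -[y]res_liftK -rmorphB !res_extE -!rmorphB. Qed.
Fact res_ext_monoid_morphism : monoid_morphism res_ext.
Proof.
split=> [|x y]; first by rewrite -(rmorph1 (lf_red F)) res_extE !rmorph1.
by rewrite -[x]res_liftK -[y]res_liftK -rmorphM !res_extE -!rmorphM.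
Qed.
HB.instance Definition _ := GRing.isZmodMorphism.Build kF kE res_ext res_ext_zmod_morphism.
HB.instance Definition _ := GRing.isMonoidMorphism.Build kF kE res_ext res_ext_monoid_morphism.

Fact res_theta_zmod_morphism : zmod_morphism res_theta.
Proof. by move=> x y; rewrite -[x]res_liftK -[y]res_liftK -rmorphB !res_thetaE -!rmorphB. Qed.
Fact res_theta_monoid_morphism : monoid_morphism res_theta.
Proof.
split=> [|x y]; first by rewrite -(rmorph1 (lf_red E)) res_thetaE !rmorph1.
by rewrite -[x]res_liftK -[y]res_liftK -rmorphM !res_thetaE -!rmorphM.
Qed.
HB.instance Definition _ := GRing.isZmodMorphism.Build kE kE res_theta res_theta_zmod_morphism.
HB.instance Definition _ := GRing.isMonoidMorphism.Build kE kE res_theta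
  res_theta_monoid_morphism.

Lemma iter_res_theta m a : iter m res_theta (lf_red E a) = lf_red E (iter m thO a).
Proof. by elim: m => //= m ->; rewrite res_thetaE. Qed.

Lemma iter_thetaO m a : iE (iter m thO a) = iter m th (iE a).
Proof. by elim: m => //= m IHm; rewrite ue_theta_compat IHm. Qed.

Section Teichmuller.
Variables (g : kE) (z : OE).
Hypotheses (gP : (#|kE|.-1).-primitive_root g) (zg : lf_red E z = g) (zQ : z ^+ #|kE| = z).
Local Notation Q := #|kE|.
Local Notation q := #|kF|.

Lemma teich_neq0 : z != 0.
Proof.
apply/eqP => z0; have := prim_expr_order gP; rewrite -zg z0 rmorph0 expr0n.
have := prim_order_gt0 gP; case: (Q.-1) => // n _ /eqP; by rewrite eq_sym oner_eq0.
Qed.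

Lemma teich_prim : (Q.-1).-primitive_root (iE z).
Proof.
have Q1 := prim_order_gt0 gP.
have zQ1 : z ^+ Q.-1 = 1.
  apply: (mulfI teich_neq0); rewrite -exprS prednK ?mulr1//.
  by rewrite (ltn_trans _ (finNzRing_gt1 kE)).
have izQ : iE z ^+ Q.-1 = 1 by rewrite -rmorphXn zQ1 rmorph1.
have [m mP mQ] := prim_order_exists Q1 izQ.
suff -> : Q.-1 = m by [].
apply/eqP; rewrite eqn_dvd mQ andbT (prim_order_dvd gP) -zg -rmorphXn.
suff -> : z ^+ m = 1 by rewrite rmorph1.
by apply: (@lf_inc_inj E); rewrite rmorphXn rmorph1 (prim_expr_order mP).
Qed.

(** Every nonzero residue is a power of g, so modulo a uniformizer of F each element of OE is 0 or a
    power of z; [approx_span] does the rest. *)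
Lemma teich_span_O a : exists c : 'I_Q.-1 -> OF, a = \sum_i uO (c i) * z ^+ i.
Proof.
have [p [p0 vp]] := lf_uniformizer F.
have ip0 : iE (uO p) != 0 by rewrite ue_compat fmorph_eq0.
have vip : lf_val (iE (uO p)) = 1 by rewrite ue_compat ue_unram.
apply: (@approx_span p _ (fun i => z ^+ i) setT p0 vp) => // y _.
have D1 b : lf_red E b = 0 -> exists y', b = uO p * y'.
  by move=> /Dge1P/(DgeP ip0 vip)[y' ->]; exists y'.
have [/eqP/D1[y' ->]|ry] := boolP (lf_red E y == 0).
  by exists (fun=> 0), y'; split => //; rewrite big1 ?add0r// => i _; rewrite rmorph0 mul0r.
have ry1 : lf_red E y ^+ Q.-1 = 1.
  apply: (mulfI ry); rewrite -exprS prednK ?expf_card ?mulr1//.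
  by rewrite (ltn_trans _ (finNzRing_gt1 kE)).
have [i iy] := prim_rootP gP ry1.
have [y' E'] := D1 (y - z ^+ i) ltac:(by rewrite rmorphB rmorphXn zg iy subrr).
exists (fun j => (j == i)%:R), y'; split => //; rewrite -E' (bigD1 i)//= eqxx rmorph1 mul1r.
rewrite big1 ?addr0; first by rewrite addrC subrK.
by move=> j ji; rewrite (negPf ji) rmorph0 mul0r.
Qed.

Definition hval (h : {poly lf_K F}) (x : lf_K E) : lf_K E := (map_poly uK h).[x].

Lemma teich_span y : exists h, y = hval h (iE z).
Proof.
have [p [p0 vp]] := lf_uniformizer F.
have ip0 : iE (uO p) != 0 by rewrite ue_compat fmorph_eq0.
have vip : lf_val (iE (uO p)) = 1 by rewrite ue_compat ue_unram.
have [n [a ->]] := lf_fraction ip0 vip y; have [c ->] := teich_span_O a.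
exists ((iF p ^+ n)^-1 *: \sum_i (iF (c i) *: 'X^i)).
rewrite /hval linearZ /= hornerZ fmorphV rmorphXn /= -ue_compat mulrC; congr (_ * _).
rewrite !rmorph_sum /= horner_sum; apply: eq_bigr => i _.
by rewrite linearZ /= hornerZ map_polyXn hornerXn rmorphM rmorphXn /= ue_compat.
Qed.

(* X^(Q-1) - 1 splits into Teichmuller factors, so the minimal polynomial of z *)
(* over F reduces to a polynomial over kF, whose roots are permuted by the     *)
(* Frobenius of kF.                                                            *)
Lemma hval_frob h : hval h (iE z) = 0 -> hval h (iE z ^+ q) = 0.
Proof.
move=> hz; have zP := teich_prim; have Q1 := prim_order_gt0 gP.
pose w : {poly lf_K F} := 'X^(Q.-1) - 1; pose m := gcdp h w.
have w0 : w != 0 by apply: monic_neq0; rewrite /w -polyC1 monicXnsubC.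
have m0 : m != 0 by rewrite gcdp_eq0 negb_and w0 orbT.
pose m1 := (lead_coef m)^-1 *: m.
have m1m : m1 \is monic by rewrite monicE lead_coefZ mulVf// lead_coef_eq0.
have mwE : map_poly uK w = \prod_(i <- index_iota 0 Q.-1) ('X - (iE z ^+ i)%:P).
  by rewrite factor_Xn_sub_1// rmorphB rmorphXn /= map_polyX rmorph1.
have m1E : m1 %= m by rewrite eqp_scale// invr_eq0 lead_coef_eq0.
have rm1 : root (map_poly uK m1) (iE z).
  rewrite /m1 linearZ /= rootZ ?fmorph_eq0 ?invr_eq0 ?lead_coef_eq0//.
  rewrite gcdp_map root_gcd; apply/andP; split; first exact/eqP.
  by rewrite rmorphB rmorphXn /= map_polyX rmorph1 rootE !hornerE prim_expr_order// subrr.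
have : map_poly uK m1 %| \prod_(i <- index_iota 0 Q.-1) ('X - (iE z ^+ i)%:P).
  by rewrite -mwE dvdp_map (eqp_dvdl _ m1E) dvdp_gcdr.
move=> /dvdp_prod_XsubC[msk]; set s := mask msk _ => ms.
have m1s : map_poly uK m1 = \prod_(i <- s) ('X - (iE z ^+ i)%:P).
  by apply/eqP; rewrite -eqp_monic ?monic_map ?monic_prod_XsubC.
pose R : {poly OE} := \prod_(i <- s) ('X - (z ^+ i)%:P).
have RE : map_poly iE R = map_poly uK m1.
  rewrite m1s rmorph_prod /=; apply: eq_bigr => i _.
  by rewrite rmorphB /= map_polyX map_polyC /= rmorphXn.
have Rz : R.[z] = 0.
  by apply: (@lf_inc_inj E); rewrite rmorph0 -horner_map RE; apply/rootP.
pose Rb := map_poly (lf_red E) R.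
have RbE : Rb = \prod_(i <- s) ('X - (g ^+ i)%:P).
  rewrite /Rb rmorph_prod /=; apply: eq_bigr => i _.
  by rewrite rmorphB /= map_polyX map_polyC /= rmorphXn zg.
have Rbfrob : map_poly (frob res_ext 1) Rb = Rb.
  apply/polyP => l; rewrite coef_map /=.
  suff [a ->] : exists a, Rb`_l = res_ext a by rewrite frob_base.
  have El : iE R`_l = uK m1`_l by rewrite -!coef_map RE.
  have [a aE] : exists a, iF a = m1`_l.
    by apply/lf_integers; rewrite -vge_ue -El; apply: Dge0.
  exists (lf_red F a); rewrite res_extE coef_map; congr (lf_red E _).
  by apply: (@lf_inc_inj E); rewrite El ue_compat aE.
have : root Rb (g ^+ q).
  have rg : root Rb g by rewrite rootE -zg horner_map Rz rmorph0.
  have := rmorph_root (frob res_ext 1) rg; by rewrite Rbfrob /= /frob expn1.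
rewrite RbE -(big_map (fun i => g ^+ i) xpredT (fun u => 'X - u%:P)) root_prod_XsubC.
move=> /mapP[i si /eqP]; rewrite (eq_prim_root_expr gP) -(eq_prim_root_expr zP) => /eqP qi.
have : root (map_poly uK m1) (iE z ^+ q).
  rewrite m1s -(big_map (fun i => iE z ^+ i) xpredT (fun u => 'X - u%:P)) root_prod_XsubC.
  by apply/mapP; exists i.
have : map_poly uK m1 %| map_poly uK h by rewrite dvdp_map (eqp_dvdl _ m1E) dvdp_gcdl.
by move=> /dvdpP[c cE] /eqP rq; rewrite /hval cE hornerM rq mulr0.
Qed.

(** By [teich_span] every element is h(z) with h over F, and h(z) -> h(z^q) is well defined by
    [hval_frob]. *)
Lemma frobenius_lift : exists s : {rmorphism lf_K E -> lf_K E},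
  (forall x, s (uK x) = uK x) /\ s (iE z) = iE z ^+ q.
Proof.
have /choice[P PE] := teich_span.
pose s y := hval (P y) (iE z ^+ q).
have hvalB h1 h2 x : hval (h1 - h2) x = hval h1 x - hval h2 x.
  by rewrite /hval rmorphB /= hornerD hornerN.
have hvalM h1 h2 x : hval (h1 * h2) x = hval h1 x * hval h2 x.
  by rewrite /hval rmorphM /= hornerM.
have sE y h : y = hval h (iE z) -> s y = hval h (iE z ^+ q).
  move=> yh; apply/eqP; rewrite -subr_eq0 -hvalB; apply/eqP/hval_frob.
  by rewrite hvalB -PE -yh subrr.
have hvalC c x : hval c%:P x = uK c by rewrite /hval map_polyC hornerC.
have sZ : zmod_morphism s.
  by move=> x y; rewrite (sE (x - y) (P x - P y)) ?hvalB// -!PE.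
have sM : monoid_morphism s.
  split=> [|x y]; first by rewrite (sE 1 1%:P) ?hvalC rmorph1.
  by rewrite (sE (x * y) (P x * P y)) ?hvalM// -!PE.
pose M1 := GRing.isZmodMorphism.Build (lf_K E) (lf_K E) s sZ.
pose M2 := GRing.isMonoidMorphism.Build (lf_K E) (lf_K E) s sM.
pose sR : {rmorphism lf_K E -> lf_K E} := HB.pack s M1 M2.
exists sR; split=> [x|] /=; first by rewrite (sE _ x%:P) ?hvalC.
by rewrite (sE _ 'X) /hval map_polyX hornerX.
Qed.

End Teichmuller.

(** As theta generates the Galois group, the lift of Frobenius is one of its powers; on residues it
    is enough to compare at the generator g. *)
Lemma res_theta_frob : exists m, forall x, iter m res_theta x = frob res_ext 1 x.
Proof.
have [g gP] := prim_root_residue E; have [z [zg zQ]] := teichmuller g.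
have [s [sF sz]] := frobenius_lift gP zg zQ.
have [m sm] := ue_theta_gen sF; exists m => x.
have iterM : forall a b, iter m res_theta (a * b) = iter m res_theta a * iter m res_theta b.
  by move=> a b; elim: (m) => //= l ->; rewrite rmorphM.
have iter1 : iter m res_theta 1 = 1 by elim: (m) => //= l ->; rewrite rmorph1.
have gm : iter m res_theta g = frob res_ext 1 g.
  rewrite -zg iter_res_theta /frob expn1 -rmorphXn; congr (lf_red E _).
  by apply: (@lf_inc_inj E); rewrite iter_thetaO -sm sz rmorphXn.
have [->|x0] := eqVneq x 0.
  by rewrite rmorph0; elim: (m) => //= l ->; rewrite rmorph0.
have x1 : x ^+ #|kE|.-1 = 1.
  apply: (mulfI x0); rewrite -exprS prednK ?expf_card ?mulr1//.
  by rewrite (ltn_trans _ (finNzRing_gt1 kE)).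
have [[i /= _] ->] := prim_rootP gP x1.
by elim: i => [|i IHi]; rewrite ?expr0 ?iter1 ?rmorph1// !exprS iterM gm IHi rmorphM.
Qed.

Lemma res_theta_fixed x : res_theta x = x -> exists a, x = res_ext a.
Proof.
move=> xf; have [m mE] := res_theta_frob; apply: (@frob1_base _ _ res_ext).
by rewrite -mE; elim: (m) => //= l ->.
Qed.

(** The residue of a fixed element is fixed, hence in kF by [res_theta_fixed]. Subtracting a lift
    from OF and dividing by a uniformizer of F leaves a fixed element, so [approx_span] applies with
    the single generator 1. *)
Lemma theta_fixed a : thO a = a -> exists b, a = uO b.
Proof.
have [p [p0 vp]] := lf_uniformizer F.
have ip0 : iE (uO p) != 0 by rewrite ue_compat fmorph_eq0.
have vip : lf_val (iE (uO p)) = 1 by rewrite ue_compat ue_unram.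
move=> fa; have [|c ->] := @approx_span p 1 (fun=> 1) [set a | thO a = a] p0 vp _ a fa.
  move=> y fy; have [c cE] : exists c, lf_red E y = res_ext c.
    by apply: res_theta_fixed; rewrite res_thetaE fy.
  have /Dge1P/(DgeP ip0 vip)[y' y'E] : lf_red E (y - uO (res_lift c)) = 0.
    by rewrite rmorphB cE subrr.
  exists (fun=> res_lift c), y'; rewrite big_ord1 mulr1; split; last first.
    by rewrite -[X in X * y']expr1 -y'E addrC subrK.
  have pz : uO p ^+ 1 != 0 by rewrite expr1; apply: contra ip0 => /eqP ->; rewrite rmorph0.
  apply: (mulfI pz); rewrite -{1}(thetaO_ue p) -rmorphXn -rmorphM -y'E.
  by rewrite rmorphB fy thetaO_ue.
by rewrite big_ord1 mulr1; exists (c ord0).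
Qed.

End Extension.

(** * The residue degree equals r *)

Section ResidueDegree.
Variables (F E : local_field) (r : nat) (X : unramified_ext F E r).
Local Notation OF := (lf_O F).
Local Notation OE := (lf_O E).
Local Notation kF := (lf_k F).
Local Notation kE := (lf_k E).
Local Notation iF := (lf_inc F).
Local Notation iE := (lf_inc E).
Local Notation uK := (ue_K X).
Local Notation uO := (ue_O X).
Local Notation Q := #|kE|.
Local Notation q := #|kF|.
Local Notation res_ext := (res_ext X).
Local Notation res_theta := (res_theta X).

Lemma residue_basis : exists f (x : nat -> kE),
  (forall c : 'I_f -> kF, \sum_i res_ext (c i) * x i = 0 -> forall i, c i = 0) /\
  (forall y, exists c : 'I_f -> kF, y = \sum_i res_ext (c i) * x i).
Proof.
pose indep f (x : nat -> kE) :=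
  forall c : 'I_f -> kF, \sum_i res_ext (c i) * x i = 0 -> forall i, c i = 0.
pose good f := `[< exists x, indep f x >].
have g0 : exists f, good f by exists 0%N; apply/asboolP; exists (fun=> 0) => c _ [].
have gb f : good f -> (f <= Q)%N.
  move=> /asboolP[x xi]; apply: ltnW; apply: (leq_trans (ltn_expl f (finNzRing_gt1 kF))).
  rewrite -(card_ord f) -card_ffun.
  apply: (@leq_card _ _ (fun c : {ffun 'I_f -> kF} => \sum_i res_ext (c i) * x i)).
  move=> c c' cc'; apply/ffunP => i; apply/eqP; rewrite -subr_eq0; apply/eqP.
  apply: (xi (fun i => c i - c' i)).
  under eq_bigr do rewrite rmorphB mulrBl.
  by rewrite sumrB cc' subrr.
have [f /asboolP[x xi] fmax] := ex_maxnP g0 gb.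
exists f, x; split => // y; apply: contrapT => ny.
suff : good f.+1 by move=> /fmax; rewrite ltnn.
apply/asboolP; exists (fun n => if n == f then y else x n) => c.
rewrite big_ord_recr /= eqxx => s0.
have s0' : \sum_(i < f) res_ext (c (widen_ord (leqnSn f) i)) * x i + res_ext (c ord_max) * y = 0.
  rewrite -[RHS]s0; congr (_ + _); apply: eq_bigr => i _.
  by rewrite /= ltn_eqF.
have cm : c ord_max = 0.
  apply/eqP; apply: contraT => cm0; exfalso; apply: ny.
  exists (fun i => - (c ord_max)^-1 * c (widen_ord (leqnSn f) i)).
  have rc : res_ext (c ord_max) != 0 by rewrite fmorph_eq0.
  apply: (mulfI rc); move/eqP: s0'; rewrite addrC addr_eq0 => /eqP ->.
  rewrite big_distrr -sumrN /=; apply: eq_bigr => i _.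
  by rewrite rmorphM rmorphN fmorphV /= !mulrA mulrN mulfV// mulN1r mulNr.
move: s0'; rewrite cm rmorph0 mul0r addr0 => /xi c0 i.
case: (unliftP ord_max i) => [j ->|-> //].
by rewrite -(c0 j); congr c; apply: ord_inj; rewrite lift_max.
Qed.

(* Lifts of a residue basis form a basis of E over F, as E/F is unramified. *)
Lemma card_residue_ext : Q = (q ^ r)%N.
Proof.
have [f [x [xi xs]]] := residue_basis.
have Qf : Q = (q ^ f)%N.
  rewrite -(card_ord f) -card_ffun; symmetry.
  pose phi (c : {ffun 'I_f -> kF}) := \sum_i res_ext (c i) * x i.
  have phiI : injective phi.
    move=> c c' cc'; apply/ffunP => i; apply/eqP; rewrite -subr_eq0; apply/eqP.
    apply: (xi (fun i => c i - c' i)); under eq_bigr do rewrite rmorphB mulrBl.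
    by rewrite sumrB -/(phi c) cc' subrr.
  rewrite -(card_codom phiI); apply: eq_card => y; rewrite inE.
  apply/codomP; have [c cE] := xs y; exists [ffun i => c i].
  by rewrite cE /phi; apply: eq_bigr => i _; rewrite ffunE.
suff -> : r = f by [].
have [p [p0 vp]] := lf_uniformizer F.
have ip0 : iE (uO p) != 0 by rewrite ue_compat fmorph_eq0.
have vip : lf_val (iE (uO p)) = 1 by rewrite ue_compat ue_unram.
pose B (i : 'I_f) : OE := res_lift (x i).
have spanO y : exists c : 'I_f -> OF, y = \sum_i uO (c i) * B i.
  apply: (@approx_span _ _ _ X p _ B setT p0 vp) => // {}y _.
  have [c cE] := xs (lf_red E y).
  have /Dge1P/(DgeP ip0 vip)[y' y'E] : lf_red E (y - \sum_i uO (res_lift (c i)) * B i) = 0.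
    rewrite rmorphB cE rmorph_sum /=; apply/eqP; rewrite subr_eq0; apply/eqP.
    by apply: eq_bigr => i _; rewrite rmorphM /= res_liftK.
  exists (fun i => res_lift (c i)), y'; split => //.
  by rewrite -[X in X * y']expr1 -y'E addrC subrK.
(* A relation reduces to one among the residue basis, so all its coefficients are divisible by p;
   divide by p and repeat. *)
have indO n : forall c : 'I_f -> OF, \sum_i uO (c i) * B i = 0 -> forall i, Dge n (c i).
  elim: n => [|n IHn] c sc i; first exact: Dge0.
  have /xi rc : \sum_i res_ext (lf_red F (c i)) * x i = 0.
    transitivity (lf_red E (\sum_i uO (c i) * B i)); last by rewrite sc rmorph0.
    rewrite rmorph_sum /=.
    apply: eq_bigr => j _.
    by rewrite rmorphM /= res_liftK res_extE.
  have /choice[c' c'E] : forall j, exists b, c j = p * b.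
    by move=> j; have /Dge1P/(DgeP p0 vp)[b bE] := rc j; exists b.
  rewrite c'E -addn1 addnC; apply: DgeM; first by apply/(DgeP p0 vp); exists 1; rewrite mulr1.
  apply: IHn; have pz : uO p != 0 by apply: contra ip0 => /eqP ->; rewrite rmorph0.
  apply: (mulfI pz); rewrite mulr0 -[RHS]sc big_distrr /=; apply: eq_bigr => j _.
  by rewrite c'E rmorphM mulrA.
have indF (c : 'I_f -> lf_K F) : \sum_i uK (c i) * iE (B i) = 0 -> forall i, c i = 0.
  move=> sc; have /choice[na naE] : forall i, exists na : nat * OF, c i = iF na.2 / iF p ^+ na.1.
    by move=> i; have [n [a aE]] := lf_fraction p0 vp (c i); exists (n, a).
  pose N := \max_i (na i).1.
  have cN i : c i * iF p ^+ N = iF ((na i).2 * p ^+ (N - (na i).1)).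
    have Ni : ((na i).1 <= N)%N by apply: (leq_bigmax (F := fun i => (na i).1)).
    rewrite rmorphM rmorphXn naE -[X in _ * _ ^+ X = _](subnKC Ni).
    by rewrite exprD mulrA divfK ?expf_neq0.
  have s0 : \sum_i uO ((na i).2 * p ^+ (N - (na i).1)) * B i = 0.
    apply: (@lf_inc_inj E); rewrite rmorph0 rmorph_sum /=.
    transitivity (uK (iF p ^+ N) * \sum_i uK (c i) * iE (B i)); last by rewrite sc mulr0.
    rewrite big_distrr /=; apply: eq_bigr => i _.
    by rewrite rmorphM /= ue_compat -cN rmorphM /= mulrA [uK (c i) * _]mulrC.
  move=> i; have pN : iF p ^+ N != 0 by rewrite expf_neq0.
  apply: (mulIf pN); rewrite mul0r cN.
  suff -> : (na i).2 * p ^+ (N - (na i).1) = 0 by rewrite rmorph0.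
  by apply: Dge_oo => n; apply: (indO n _ s0).
have spanF y : exists c : 'I_f -> lf_K F, y = \sum_i uK (c i) * iE (B i).
  have [n [a ->]] := lf_fraction ip0 vip y; have [c ->] := spanO a.
  exists (fun i => iF (c i) / iF p ^+ n).
  rewrite rmorph_sum /= big_distrl /=; apply: eq_bigr => i _.
  by rewrite rmorphM !ue_compat rmorphM fmorphV rmorphXn /= mulrAC.
have [b bP] := ue_degree X.
have /choice[M ME] : forall i, exists c : 'I_r -> lf_K F, iE (B i) = \sum_j uK (c j) * b j.
  by move=> i; have [c [cE _]] := bP (iE (B i)); exists c.
have /choice[N NE] := fun j => spanF (b j).
have indb (c : 'I_r -> lf_K F) : \sum_i uK (c i) * b i = 0 -> forall i, c i = 0.
  move=> sc i; have [c0 [_ c0U]] := bP 0.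
  have e1 : c0 = [ffun i => c i].
    apply: c0U; rewrite (eq_bigr (fun j => uK (c j) * b j)) ?sc// => j _.
    by rewrite ffunE.
  have e2 : c0 = [ffun=> 0].
    by apply: c0U; rewrite big1// => j _; rewrite ffunE rmorph0 mul0r.
  by have := congr1 (fun u : {ffun 'I_r -> lf_K F} => u i) e2; rewrite e1 !ffunE.
(* Independence of u1 forces M1 M2 = 1, hence m1 <= m2; this is applied in both directions. *)
have change m1 m2 (u1 : 'I_m1 -> lf_K E) (u2 : 'I_m2 -> lf_K E)
    (M1 : 'I_m1 -> 'I_m2 -> lf_K F) (M2 : 'I_m2 -> 'I_m1 -> lf_K F) :
    (forall i, u1 i = \sum_j uK (M1 i j) * u2 j) ->
    (forall j, u2 j = \sum_i uK (M2 j i) * u1 i) ->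
    (forall c, \sum_i uK (c i) * u1 i = 0 -> forall i, c i = 0) -> (m1 <= m2)%N.
  move=> E1 E2 ind; apply: (@mulmx1_min _ _ _ (\matrix_(i, j) M1 i j) (\matrix_(j, i) M2 j i)).
  apply/matrixP => i l; apply/eqP; rewrite -subr_eq0; apply/eqP.
  have := ind (fun l => (\sum_j M1 i j * M2 j l) - (i == l)%:R).
  rewrite !mxE; under [in X in _ -> X]eq_bigr do rewrite !mxE.
  apply; under eq_bigr do rewrite rmorphB mulrBl rmorph_sum /= big_distrl /=.
  rewrite sumrB exchange_big /= [X in _ - X](bigD1 i)//= eqxx rmorph1 mul1r [X in _ - (_ + X)]big1 ?addr0.
    apply/eqP; rewrite subr_eq0 [u1 i]E1; apply/eqP; apply: eq_bigr => j _.
    rewrite E2 big_distrr /=; apply: eq_bigr => a _.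
    by rewrite rmorphM mulrA.
  by move=> a ai; rewrite eq_sym (negPf ai) rmorph0 mul0r.
apply/eqP; rewrite eqn_leq (change _ _ _ _ N M NE ME indb).
exact: (change _ _ _ _ M N ME NE indF).
Qed.

Lemma deg_gt0 : (0 < r)%N.
Proof.
rewrite lt0n; apply/eqP => r0; have := finNzRing_gt1 kE.
by rewrite card_residue_ext r0.
Qed.

End ResidueDegree.

Lemma prod_shift (R : comPzRingType) (u : nat -> R) n : u n = u 0%N ->
  \prod_(i < n) u i.+1 = \prod_(i < n) u i.
Proof.
case: n => [|n] un; first by rewrite !big_ord0.
by rewrite big_ord_recr [RHS]big_ord_recl /= un mulrC.
Qed.

(** * The norm of residue fields and Hilbert 90 *)

Section ResidueNorm.
Variables (F E : local_field) (r : nat) (X : unramified_ext F E r).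
Local Notation kF := (lf_k F).
Local Notation kE := (lf_k E).
Local Notation Q := #|kE|.
Local Notation q := #|kF|.
Local Notation res_ext := (res_ext X).
Local Notation res_theta := (res_theta X).

Lemma expf_card_ext (x : kE) : x ^+ (q ^ r) = x.
Proof. by rewrite -(card_residue_ext X) expf_card. Qed.

Lemma expf_card_extM (x : kE) m : x ^+ (q ^ (r * m)) = x.
Proof.
elim: m => [|m IHm]; first by rewrite muln0 expr1.
by rewrite mulnS expnD exprM expf_card_ext.
Qed.

Lemma residue_gen : exists g : kE, (Q.-1).-primitive_root g /\
  forall x, x != 0 -> exists i, x = g ^+ i.
Proof.
have [g gP] := prim_root_residue E; exists g; split => // x x0.
have x1 : x ^+ Q.-1 = 1.
  apply: (mulfI x0); rewrite -exprS prednK ?expf_card ?mulr1//.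
  by rewrite (ltn_trans _ (finNzRing_gt1 kE)).
by have [i ->] := prim_rootP gP x1; exists i.
Qed.

(** The polynomial with roots g^(q^i), i < r, is invariant under Frobenius, so its coefficients lie
    in kF and theta permutes its roots. Thus theta sends the generator g to some g^(q^j). *)
Lemma res_theta_pow : exists j, forall x, res_theta x = x ^+ (q ^ j).
Proof.
have [g [gP gen]] := residue_gen.
have r0 := deg_gt0 X.
pose h : {poly kE} := \prod_(i < r) ('X - (g ^+ (q ^ i))%:P).
have hfrob : map_poly (frob res_ext 1) h = h.
  rewrite rmorph_prod /= /h -(@prod_shift _ (fun i => 'X - (g ^+ (q ^ i))%:P)).
    apply: eq_bigr => i _.
    by rewrite rmorphB /= map_polyX map_polyC /= /frob expn1 -exprM expnSr.
  by rewrite expf_card_ext expr1.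
have hth : map_poly res_theta h = h.
  apply/polyP => l; rewrite coef_map /=.
  have [|a ->] := @frob1_base _ _ res_ext h`_l; first by rewrite -{2}hfrob coef_map.
  by rewrite /= -[a]res_liftK res_extE res_thetaE thetaO_ue.
have : root h (res_theta g).
  rewrite -hth; apply: rmorph_root; apply/rootP; rewrite /h (bigD1 (Ordinal r0))//=.
  by rewrite hornerM hornerXsubC expr1 subrr mul0r.
rewrite /h -(big_mkord xpredT (fun i => 'X - (g ^+ (q ^ i))%:P)).
rewrite -(big_map (fun i => g ^+ (q ^ i)) xpredT (fun u => 'X - u%:P)) root_prod_XsubC.
move=> /mapP[j _ gj]; exists j => x.
have [->|/gen[i ->]] := eqVneq x 0.
  by rewrite rmorph0 expr0n expn_eq0 -[q == _]negbK -lt0n (ltn_trans _ (finNzRing_gt1 kF)).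
by rewrite rmorphXn /= gj -!exprM mulnC.
Qed.

Definition res_norm (x : kE) := \prod_(i < r) iter i res_theta x.

(* res_theta generates the cyclic group of powers of the Frobenius, so the    *)
(* norm is the usual one.                                                     *)
Lemma res_normE x : res_norm x = x ^+ (\sum_(i < r) q ^ i)%N.
Proof.
have [j jE] := res_theta_pow; have [k kE'] := res_theta_frob X.
have [g [gP gen]] := residue_gen; have r0 := deg_gt0 X.
have iterE m y : iter m res_theta y = y ^+ (q ^ (j * m)).
  elim: m => [|m IHm]; first by rewrite muln0 expr1.
  by rewrite /= IHm jE -exprM -expnD mulnS addnC.
have modr (y : kE) m : y ^+ (q ^ m) = y ^+ (q ^ (m %% r)).
  by rewrite {1}(divn_eq m r) addnC expnD exprM mulnC expf_card_extM.
have q1 := finNzRing_gt1 kF.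
(* On kE theta is the j-th power of Frobenius, Frobenius is the k-th power of theta, and Frobenius
   has order r. So i -> j i permutes the exponents modulo r. *)
have jk : (j * k = 1 %[mod r])%N.
  have [r1|r1] : r = 1%N \/ (1 < r)%N by move: r0; case: (r) => [|[|n]] _ //; [left|right].
    by rewrite r1 !modn1.
  have : g ^+ (q ^ (j * k)) == g ^+ q.
    by rewrite -iterE kE' /frob expn1.
  rewrite modr -[q in X in _ == X]expn1 (eq_prim_root_expr gP) (card_residue_ext X).
  have small a : (a < r)%N -> (q ^ a < (q ^ r).-1)%N.
    move=> ar; rewrite -ltnS prednK ?expn_gt0 ?(ltn_trans _ q1)//.
    have h1 : (q ^ a <= q ^ r.-1)%N by rewrite leq_exp2l// -ltnS prednK.
    have h2 : (q ^ r = q * q ^ r.-1)%N by rewrite -expnS prednK.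
    have h3 : (1 < q ^ r.-1)%N.
      by rewrite -(expn0 q) ltn_exp2l// -subn1 subn_gt0.
    rewrite h2; apply: (@leq_trans (2 * q ^ r.-1)%N); last by rewrite leq_mul2r q1 orbT.
    by rewrite mul2n -addnn -addn2 addnC; apply: leq_add.
  rewrite (modn_small (small _ (ltn_pmod (j * k) r0))) (modn_small (small _ r1)).
  move=> /eqP /(expnI q1) ->.
  by rewrite modn_small.
rewrite /res_norm (eq_bigr (fun i : 'I_r => x ^+ (q ^ ((j * i) %% r)))); last first.
  by move=> i _; rewrite iterE modr.
have hlt (i : 'I_r) : ((j * i) %% r < r)%N by rewrite ltn_mod.
pose pm (i : 'I_r) : 'I_r := Ordinal (hlt i).
have pmI : injective pm.
  move=> a b /(congr1 val) /= ab; apply: val_inj => /=.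
  rewrite -(modn_small (ltn_ord a)) -(modn_small (ltn_ord b)).
  have inv (c : 'I_r) : (c %% r = k * ((j * c) %% r) %% r)%N.
    by rewrite modnMmr mulnA [(k * j)%N]mulnC -modnMml jk modnMml mul1n.
  by rewrite (inv a) (inv b) ab.
have -> : (\sum_(i < r) q ^ i = \sum_(i < r) q ^ (pm i))%N by rewrite (reindex_inj pmI).
by rewrite expr_sum.
Qed.

Lemma res_norm_theta (y : kE) : y != 0 -> res_norm (y / res_theta y) = 1.
Proof.
move=> y0; have [j jE] := res_theta_pow.
have tr : iter r res_theta y = y.
  have iterE m : iter m res_theta y = y ^+ (q ^ (j * m)).
    elim: m => [|m IHm]; first by rewrite muln0 expr1.
    by rewrite /= IHm jE -exprM -expnD mulnS addnC.
  by rewrite iterE mulnC expf_card_extM.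
have iter0 i : iter i res_theta y != 0 by elim: i => //= i IHi; rewrite fmorph_eq0.
have iterV i : iter i res_theta (y / res_theta y) = iter i res_theta y / iter i.+1 res_theta y.
  elim: i => //= i ->; by rewrite rmorphM fmorphV.
rewrite /res_norm (eq_bigr (fun i : 'I_r => iter i res_theta y / iter i.+1 res_theta y)) => [|i _];
  last exact: iterV.
rewrite prodf_div (@prod_shift _ (fun i => iter i res_theta y)) ?tr// divff//.
by apply/prodf_neq0 => i _.
Qed.

(** With x = g^e, norm 1 means that q - 1 divides e, so x = z^q / z for some z. Since z^q =
    theta^k(z), the product w of the theta^i(z) for i < k telescopes to x = theta(w) / w, and y =
    w^-1. *)
Lemma hilbert90 (x : kE) : x != 0 -> res_norm x = 1 ->
  exists2 y, y != 0 & x = y / res_theta y.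
Proof.
move=> x0; have [g [gP gen]] := residue_gen; have r0 := deg_gt0 X.
have [e ->] := gen x x0; have q1 := finNzRing_gt1 kF.
have [k kE'] := res_theta_frob X.
rewrite res_normE -exprM => /eqP; rewrite -(prim_order_dvd gP) (card_residue_ext X).
have -> : (q ^ r).-1 = (q.-1 * \sum_(i < r) q ^ i)%N by rewrite predn_exp.
rewrite dvdn_pmul2r; last first.
  by rewrite (bigD1 (Ordinal r0))//= expn0 addn_gt0.
move=> /dvdnP[e' ->].
set z := g ^+ e'; have z0 : z != 0 by rewrite expf_neq0// (prim_root_eq0 gP) -lt0n -subn1 subn_gt0 finNzRing_gt1.
have iter0 i : iter i res_theta z != 0 by elim: i => //= i IHi; rewrite fmorph_eq0.
pose w := \prod_(i < k) iter i res_theta z.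
have w0 : w != 0 by apply/prodf_neq0 => i _.
exists w^-1; first by rewrite invr_eq0.
have -> : g ^+ (e' * q.-1) = z ^+ q / z.
  apply: (mulIf z0); rewrite divfK// exprM -/z -exprSr prednK//.
  by rewrite (ltn_trans _ q1).
have <- : iter k res_theta z = z ^+ q by rewrite kE' /frob expn1.
have key : iter k res_theta z * w = res_theta w * z.
  rewrite /w rmorph_prod /=; case: (k) => [|l]; first by rewrite !big_ord0 mulr1 mul1r.
  rewrite big_ord_recl [X in _ = X * _]big_ord_recr /= mulrCA [RHS]mulrC.
  by congr (_ * _); rewrite mulrC.
apply: (mulIf z0); rewrite divfK//; apply: (mulIf w0).
by rewrite key fmorphV invrK [w^-1 * _]mulrC -!mulrA [z * w]mulrC mulKf.
Qed.

End ResidueNorm.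

(** * The norm on points of the torus *)

Section TorusNorm.
Variables (F E : local_field) (r : nat) (X : unramified_ext F E r).
Local Notation OF := (lf_O F).
Local Notation OE := (lf_O E).
Local Notation kF := (lf_k F).
Local Notation kE := (lf_k E).
Local Notation Q := #|kE|.
Local Notation q := #|kF|.
Local Notation uO := (ue_O X).
Local Notation iE := (lf_inc E).
Local Notation thO := (ue_thetaO X).
Local Notation res_theta := (res_theta X).
Local Notation res_norm := (res_norm X).

Lemma iter_res_theta_r x : iter r res_theta x = x.
Proof.
have [j jE] := res_theta_pow X.
have iterE m : iter m res_theta x = x ^+ (q ^ (j * m)).
  elim: m => [|m IHm]; first by rewrite muln0 expr1.
  by rewrite /= IHm jE -exprM -expnD mulnS addnC.
by rewrite iterE mulnC expf_card_extM.
Qed.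

Lemma iter_rmorphE (R : pzRingType) (h : {rmorphism R -> R}) m :
  [/\ forall a b, iter m h (a * b) = iter m h a * iter m h b,
      forall (I : finType) (u : I -> R), iter m h (\sum_i u i) = \sum_i iter m h (u i) &
      forall a n, iter m h (a ^+ n) = iter m h a ^+ n].
Proof.
split; elim: m => //= m IHm.
- by move=> a b; rewrite IHm rmorphM.
- by move=> I u; rewrite IHm rmorph_sum.
- by move=> a n; rewrite IHm rmorphXn.
Qed.

(** The powers of the Teichmuller lift z generate OE over OF, and theta^r(z) is a power of z. Powers
    of z are told apart by their residues, on which theta^r is the identity. *)
Lemma iter_thetaO_r a : iter r thO a = a.
Proof.
have [g gP] := prim_root_residue E; have [z [zg zQ]] := teichmuller g.
have [c ->] := teich_span_O X gP zg a.
have zP := teich_prim gP zg zQ; have z0 := teich_neq0 gP zg.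
have zQ1 : z ^+ Q.-1 = 1.
  by apply: (@lf_inc_inj E); rewrite rmorphXn rmorph1 (prim_expr_order zP).
have tz1 : iE (thO z) ^+ Q.-1 = 1 by rewrite -rmorphXn -rmorphXn zQ1 !rmorph1.
have [[i /= _] tzi] := prim_rootP zP tz1.
have tz : thO z = z ^+ i by apply: (@lf_inc_inj E); rewrite tzi rmorphXn.
have itz m : iter m thO z = z ^+ (i ^ m).
  elim: m => [|m IHm]; first by rewrite expr1.
  by rewrite /= IHm rmorphXn /= tz -exprM expnS.
have iz : iter r thO z = z.
  have : g ^+ (i ^ r) == g ^+ 1.
    by rewrite expr1 -zg -rmorphXn -itz -iter_res_theta iter_res_theta_r.
  rewrite (eq_prim_root_expr gP) -(eq_prim_root_expr zP) -!rmorphXn => /eqP.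
  by move=> /(@lf_inc_inj E); rewrite itz expr1.
have [iM iS iX] := iter_rmorphE thO r.
have iu m b : iter m thO (uO b) = uO b by elim: m => //= m ->; rewrite thetaO_ue.
by rewrite iS; apply: eq_bigr => l _; rewrite iM iX iz iu.
Qed.

Variable d : nat.

(** The product of conjugates is fixed by theta, so it descends by [theta_fixed]. This makes the
    choice in [norm_T] a genuine one, rather than its default value 1. *)
Lemma norm_T_exists (t : Gm d OE) : exists u : Gm d OF,
  forall i, uO (Gm_val u 0 i) = \prod_(k < r) iter k thO (Gm_val t 0 i).
Proof.
have /choice[u uE] : forall i, exists b, uO b = \prod_(k < r) iter k thO (Gm_val t 0 i).
  move=> i; set P := \prod_(k < r) _.
  have [|b bE] := @theta_fixed _ _ _ X P; last by exists b.
  rewrite /P rmorph_prod /=; apply: (@prod_shift _ (fun k => iter k thO (Gm_val t 0 i))).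
  exact: iter_thetaO_r.
have uu i : u i \is a GRing.unit.
  apply/lf_unitP; rewrite -(fmorph_eq0 (res_ext X)) /= res_extE uE.
  apply/lf_unitP/rpred_prod => k _; elim: (k : nat) => [|m IHm] /=; first exact: Gm_unitE.
  exact: rmorph_unit.
exists (MkGm (Gm_rowP uu)) => i.
by rewrite mxE uE.
Qed.

Lemma norm_TE (t : Gm d OE) i :
  uO (Gm_val (norm_T X t) 0 i) = \prod_(k < r) iter k thO (Gm_val t 0 i).
Proof. by rewrite /norm_T; have := norm_T_exists t; move/xgetPex => /(_ 1%g); apply. Qed.

Lemma red_norm_T (t : Gm d OE) i :
  res_ext X (Gm_map (lf_red F) (norm_T X t) 0 i) = res_norm (Gm_map (lf_red E) t 0 i).
Proof.
rewrite !mxE res_extE norm_TE rmorph_prod; apply: eq_bigr => k _.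
by rewrite iter_res_theta.
Qed.

Lemma Gm_lift L (s : Gm d (lf_k L)) : exists t, Gm_map (lf_red L) t = s.
Proof.
have su i : res_lift (s 0 i) \is a GRing.unit.
  by apply/lf_unitP; rewrite res_liftK -unitfE; apply: Gm_unitE.
by exists (MkGm (Gm_rowP su)); apply/val_inj/rowP => i; rewrite !mxE res_liftK.
Qed.

End TorusNorm.

(** * The topology of p-adic points *)

Section MatrixValuation.
Variable E : local_field.
Local Notation K := (lf_K E).
Local Notation inc := (lf_inc E).
Local Notation red := (lf_red E).

Lemma mx_vgeM M N m n p (A : 'M[K]_(m, n)) (B : 'M[K]_(n, p)) :
  mx_vge M A -> mx_vge N B -> mx_vge (M + N) (A *m B).
Proof. by move=> hA hB i j; rewrite mxE; apply: vge_sum => l _; apply: vgeM. Qed.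

Lemma mx_vgeD N m n (A B : 'M[K]_(m, n)) : mx_vge N A -> mx_vge N B -> mx_vge N (A + B).
Proof. by move=> hA hB i j; rewrite mxE; apply: lf_valD. Qed.

Lemma mx_vgeN N m n (A : 'M[K]_(m, n)) : mx_vge N A -> mx_vge N (- A).
Proof. by move=> hA i j; rewrite mxE vgeN. Qed.

Lemma mx_vgeB N m n (A B : 'M[K]_(m, n)) : mx_vge N A -> mx_vge N B -> mx_vge N (A - B).
Proof. by move=> hA hB; apply/mx_vgeD/mx_vgeN. Qed.

Lemma mx_vge_le M N m n (A : 'M[K]_(m, n)) : M <= N -> mx_vge N A -> mx_vge M A.
Proof. by move=> MN hA i j; apply: vge_le (hA i j). Qed.

Lemma mx_vge_bound m n (A : 'M[K]_(m, n)) : exists M : nat, mx_vge (- M%:Z) A.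
Proof.
exists (\sum_i \sum_j `|lf_val (A i j)|)%N => i j.
apply: vge_le (_ : vge (@lf_val E) (- `|lf_val (A i j)|%N%:Z) (A i j)).
  by rewrite lerN2 lez_nat (bigD1 i)//= (bigD1 j)//= -addnA leq_addr.
by rewrite /vge abszE lerNl -normrN ler_norm orbT.
Qed.

Lemma mx_vge_1 n : mx_vge 0 (1%:M : 'M[K]_n).
Proof.
by move=> i j; rewrite mxE; case: eqP => _; rewrite ?vge0// /vge lf_val_1 lexx orbT.
Qed.

Lemma mx_integral m n (A : 'M[K]_(m, n)) :
  mx_vge 0 A -> exists A', map_mx inc A' = A.
Proof.
move=> hA; have /choice[u uE] : forall ij, exists a, inc a = A ij.1 ij.2.
  by move=> [i j]; apply/lf_integers/hA.
by exists (\matrix_(i, j) u (i, j)); apply/matrixP => i j; rewrite !mxE uE.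
Qed.

Lemma mx_vge_inc m n (A : 'M[lf_O E]_(m, n)) : mx_vge 0 (map_mx inc A).
Proof. by move=> i j; rewrite mxE; apply: Dge0. Qed.

Lemma mx_vge1_red m n (A : 'M[lf_O E]_(m, n)) :
  mx_vge 1 (map_mx inc A) <-> map_mx red A = 0.
Proof.
split=> [h|/matrixP h i j]; last by rewrite mxE; apply/Dge1P; have := h i j; rewrite !mxE.
by apply/matrixP => i j; rewrite !mxE; apply/Dge1P; have := h i j; rewrite mxE.
Qed.

Lemma mx_vge1_inv n (M : 'M[K]_n) : mx_vge 1 (M - 1%:M) -> mx_vge 0 (invmx M).
Proof.
move=> h; have [A AE] : exists A, map_mx inc A = M.
  apply: mx_integral; rewrite -(subrK 1%:M M); apply: mx_vgeD; last exact: mx_vge_1.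
  by apply: mx_vge_le h.
have rA : map_mx red A = 1%:M.
  apply/eqP; rewrite -subr_eq0 -(map_mx1 red) -map_mxB; apply/eqP/mx_vge1_red.
  by rewrite map_mxB AE map_mx1.
have uA : A \in unitmx.
  by rewrite unitmxE; apply/lf_unitP; rewrite -det_map_mx rA det1 oner_eq0.
have -> : invmx M = map_mx inc (invmx A).
  have E1 : map_mx inc (invmx A) *m M = 1%:M by rewrite -AE -map_mxM mulVmx// map_mx1.
  have uM : M \in unitmx by have [] := mulmx1_unit E1.
  by rewrite -[RHS](mulmxK uM) E1 mul1mx.
exact: mx_vge_inc.
Qed.

Lemma mx_vge_oo m n (A : 'M[K]_(m, n)) : (forall N : nat, mx_vge N%:Z A) -> A = 0.
Proof. by move=> h; apply/matrixP => i j; rewrite mxE; apply: vge_oo => N; apply: h. Qed.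

End MatrixValuation.

Section PadicTopology.
Variables (O : comUnitRingType) (G : group_scheme O) (E : local_field).
Variable f : {rmorphism O -> lf_K E}.
Local Notation gT := (padic_points G f).

Definition congruence (n : nat) : set gT := [set g | mx_vge n%:Z (pt_val g - 1%:M)].

Lemma padic_openE (U : set gT) : open U = padic_open U. Proof. by []. Qed.

Lemma pvalM (x y : gT) : pt_val (x * y)%g = pt_val x *m pt_val y. Proof. by []. Qed.
Lemma pval1 : pt_val (1%g : gT) = 1%:M. Proof. by []. Qed.

(** The multiplicative form of the topology, suited to translations. The level n.+1 is at least 1,
    which makes congruence elements and their inverses integral ([congruence_int]). *)
Lemma padic_openP (U : set gT) :
  open U <-> forall x, U x -> exists n, forall k, congruence n.+1 k -> U (x * k)%g.
Proof.
rewrite padic_openE; split=> oU x Ux.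
  have [N hN] := oU x Ux; have [M hM] := mx_vge_bound (pt_val x).
  exists (`|N| + M)%N => k kn; apply: hN.
  have -> : pt_val (x * k)%g - pt_val x = pt_val x *m (pt_val k - 1%:M).
    by rewrite pvalM mulmxBr mulmx1.
  have := mx_vgeM hM kn; apply: mx_vge_le.
  by lia.
have [n hn] := oU x Ux; have [M hM] := mx_vge_bound (pt_val x^-1%g).
exists (n.+1%:Z + M%:Z) => y hy; rewrite -(mulVKg x y); apply: hn.
rewrite /congruence /=.
have -> : pt_val (x^-1 * y)%g - 1%:M = pt_val x^-1%g *m (pt_val y - pt_val x).
  by rewrite pvalM mulmxBr -!pvalM mulVg.
by have := mx_vgeM hM hy; rewrite addrC addrK.
Qed.

Lemma congruence_le m n : (m <= n)%N -> congruence n `<=` congruence m.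
Proof. by move=> mn g; apply: mx_vge_le; rewrite lez_nat. Qed.

Lemma congruence_int n k : congruence n.+1 k -> mx_vge 0 (pt_val k) /\ mx_vge 0 (pt_val k^-1%g).
Proof.
move=> hk; split; last by apply: mx_vge1_inv; apply: mx_vge_le hk; rewrite lez_nat.
rewrite -(subrK 1%:M (pt_val k)); apply: mx_vgeD; last exact: mx_vge_1.
exact: mx_vge_le hk.
Qed.

Lemma congruenceV n k : congruence n.+1 k -> congruence n.+1 k^-1%g.
Proof.
move=> hk; have [_ iV] := congruence_int hk; rewrite /congruence /=.
have -> : pt_val k^-1%g - 1%:M = - (pt_val k^-1%g *m (pt_val k - 1%:M)).
  by rewrite mulmxBr mulmx1 -pvalM mulVg pval1 opprB.
by apply: mx_vgeN; rewrite -(add0r (Posz n.+1)); apply: mx_vgeM.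
Qed.

Lemma congruenceJ n (x : gT) : exists m, forall k, congruence m.+1 k ->
  congruence n (x * k * x^-1)%g.
Proof.
have [M hM] := mx_vge_bound (pt_val x); have [M' hM'] := mx_vge_bound (pt_val x^-1%g).
exists (M + M' + n)%N => k hk; rewrite /congruence /=.
have -> : pt_val (x * k * x^-1)%g - 1%:M = pt_val x *m (pt_val k - 1%:M) *m pt_val x^-1%g.
  by rewrite !pvalM mulmxBr mulmxBl mulmx1 -(pvalM x x^-1%g) mulgV.
have := mx_vgeM (mx_vgeM hM hk) hM'; apply: mx_vge_le.
by rewrite -addn1 !PoszD; lia.
Qed.

Lemma open_preim_mulr (U : set gT) b : open U -> open [set x | U (x * b)%g].
Proof.
move=> /padic_openP oU; apply/padic_openP => x /= /oU[n hn].
have [m hm] := congruenceJ n.+1 b^-1%g; exists m => k /hm; rewrite invgK => /hn.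
by rewrite !mulgA mulgK.
Qed.

Lemma open_preim_mull (U : set gT) a : open U -> open [set x | U (a * x)%g].
Proof.
move=> /padic_openP oU; apply/padic_openP => x /= /oU[n hn].
by exists n => k /hn; rewrite mulgA.
Qed.

Lemma open_preim_inv (U : set gT) : open U -> open [set x | U x^-1%g].
Proof.
move=> /padic_openP oU; apply/padic_openP => x /= /oU[n hn].
have [m hm] := congruenceJ n.+1 x; exists m => k /congruenceV/hm/hn.
by rewrite invgM !mulgA mulVg mul1g.
Qed.

Lemma open_congruence n : open (congruence n.+1).
Proof.
apply/padic_openP => x hx; exists n => k hk; rewrite /congruence /=.
have -> : pt_val (x * k)%g - 1%:M = pt_val x *m (pt_val k - 1%:M) + (pt_val x - 1%:M).
  by rewrite pvalM mulmxBr mulmx1 addrA subrK.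
apply: mx_vgeD => //; rewrite -(add0r (Posz n.+1)); apply: mx_vgeM => //.
by have [] := congruence_int hx.
Qed.

Lemma open_right_invariant (U : set gT) n :
  (forall x k, U x -> congruence n.+1 k -> U (x * k)%g) -> open U.
Proof. by move=> h; apply/padic_openP => x Ux; exists n => k; apply: h. Qed.

(** Bounding the inverse too keeps limits invertible, which is what makes these sets compact. They
    exhaust the group, and N = 0 gives G(O_r) ([hyperspecialE]). *)
Definition bounded_pts (N : nat) : set gT :=
  [set g | mx_vge (- N%:Z) (pt_val g) /\ mx_vge (- N%:Z) (pt_val g^-1%g)].

Lemma bounded_pts_cover g : exists N, bounded_pts N g.
Proof.
have [M hM] := mx_vge_bound (pt_val g); have [M' hM'] := mx_vge_bound (pt_val g^-1%g).
exists (M + M')%N; split; [apply: mx_vge_le hM|apply: mx_vge_le hM'];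
  by rewrite lerN2 lez_nat ?leq_addl ?leq_addr.
Qed.

Lemma bounded_pts_le M N : (M <= N)%N -> bounded_pts M `<=` bounded_pts N.
Proof.
by move=> MN g [h1 h2]; split; [apply: mx_vge_le h1|apply: mx_vge_le h2];
  rewrite lerN2 lez_nat.
Qed.

End PadicTopology.

Lemma ultra_finite_union (T : Type) (I : finType) (S : I -> set T) (U : set_system T) :
  UltraFilter U -> U (\bigcup_i S i) -> exists i, U (S i).
Proof.
move=> UU USi; apply: contrapT => nS.
have : \near U, forall i, (~` S i) U.
  apply: filter_forall => i; have [US|//] := in_ultra_setVsetC (S i) UU.
  by exfalso; apply: nS; exists i.
move=> US; apply: (@filter_not_empty _ U _); apply: filterS (filterI USi US).
by move=> x [[i _ Six] /(_ i)].
Qed.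

(** * Compactness of bounded sets of points *)

Section PadicCompact.
Variables (O : comUnitRingType) (G : group_scheme O) (E : local_field).
Variables (f : {rmorphism O -> lf_K E}) (f0 : {rmorphism O -> lf_O E}).
Hypothesis fE : forall x, lf_inc E (f0 x) = f x.
Local Notation K := (lf_K E).
Local Notation n := (gs_dim G).
Local Notation gT := (padic_points G f).
Local Notation inc := (lf_inc E).

(** A Lipschitz bound on a ball of matrices; through [lipschitz_eval] the equations of G pass to
    limits. *)
Definition lipschitz N (phi : 'M[K]_n -> K) := exists C : nat,
  (forall A, mx_vge (- N%:Z) A -> vge (@lf_val E) (- C%:Z) (phi A)) /\
  (forall (e : nat) A B, mx_vge (- N%:Z) A -> mx_vge (- N%:Z) B ->
     mx_vge e%:Z (A - B) -> vge (@lf_val E) (e%:Z - C%:Z) (phi A - phi B)).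

Lemma lipschitz_cst N c : lipschitz N (fun=> c).
Proof.
exists `|lf_val c|%N; split=> [A _|e A B _ _ _]; last by rewrite subrr vge0.
by rewrite /vge abszE lerNl -normrN ler_norm orbT.
Qed.

Lemma lipschitz_coord N i j : lipschitz N (fun A => A i j).
Proof.
exists N; split=> [A hA|e A B _ _ hAB]; first exact: hA.
by have := hAB i j; rewrite !mxE; apply: vge_le; rewrite lerBlDr lerDl.
Qed.

Lemma lipschitzD N u w : lipschitz N u -> lipschitz N w -> lipschitz N (fun A => u A + w A).
Proof.
move=> [C [bC lC]] [D [bD lD]]; exists (C + D)%N; split=> [A hA|e A B hA hB hAB].
  by apply: lf_valD; [apply: vge_le (bC A hA)|apply: vge_le (bD A hA)]; lia.
rewrite opprD addrACA; apply: lf_valD.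
  by apply: vge_le (lC _ _ _ hA hB hAB); lia.
by apply: vge_le (lD _ _ _ hA hB hAB); lia.
Qed.

Lemma lipschitzM N u w : lipschitz N u -> lipschitz N w -> lipschitz N (fun A => u A * w A).
Proof.
move=> [C [bC lC]] [D [bD lD]]; exists (C + D)%N; split=> [A hA|e A B hA hB hAB].
  by have := vgeM (bC A hA) (bD A hA); apply: vge_le; lia.
have -> : u A * w A - u B * w B = (u A - u B) * w A + u B * (w A - w B).
  by rewrite mulrBl mulrBr addrA subrK.
apply: lf_valD.
  by have := vgeM (lC _ _ _ hA hB hAB) (bD A hA); apply: vge_le; lia.
by have := vgeM (bC B hB) (lD _ _ _ hA hB hAB); apply: vge_le; lia.
Qed.

Lemma lipschitz_eval N p : lipschitz N (fun A => mx_eval f A p).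
Proof.
rewrite /mx_eval /mpoly.mmap /mpoly.mmap1.
have sumL (I : Type) (s : seq I) (u : I -> 'M[K]_n -> K) :
    (forall i, lipschitz N (u i)) -> lipschitz N (fun A => \sum_(i <- s) u i A).
  move=> h; elim: s => [|a s IHs].
    by under eq_fun do rewrite big_nil; apply: lipschitz_cst.
  by under eq_fun do rewrite big_cons; apply: lipschitzD.
have prodL (I : Type) (s : seq I) (u : I -> 'M[K]_n -> K) :
    (forall i, lipschitz N (u i)) -> lipschitz N (fun A => \prod_(i <- s) u i A).
  move=> h; elim: s => [|a s IHs].
    by under eq_fun do rewrite big_nil; apply: lipschitz_cst.
  by under eq_fun do rewrite big_cons; apply: lipschitzM.
have expL u m : lipschitz N u -> lipschitz N (fun A => u A ^+ m).
  move=> h; elim: m => [|m IHm]; first exact: lipschitz_cst.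
  by under eq_fun do rewrite exprS; apply: lipschitzM.
apply: sumL => m; apply: lipschitzM; first exact: lipschitz_cst.
apply: prodL => k; apply: expL; case/mxvec_indexP: k => i j.
by under eq_fun do rewrite mxvecE; apply: lipschitz_coord.
Qed.

(** Bounded matrices fall into finitely many classes modulo p^e, and an ultrafilter selects one for
    each e; the selected classes are compatible, and completeness gives the limit. *)
Lemma ultra_matrix_limit N (U : set_system gT) (m : gT -> 'M[K]_n) : UltraFilter U ->
  U [set g | mx_vge (- N%:Z) (m g)] ->
  exists L, forall e : nat, U [set g | mx_vge e%:Z (m g - L)].
Proof.
move=> UU UN; have [p [p0 vp]] := lf_uniformizer E.
have pN0 : inc p ^+ N != 0 by rewrite expf_neq0.
have step (e : nat) : exists M, U [set g | mx_vge e%:Z (m g - M)].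
  have [s sP] := residue_cover p0 vp (e + N).
  pose S (B : 'M[seq_sub s]_n) : set gT :=
    [set g | mx_vge e%:Z (m g - map_mx (fun b => inc (val b) / inc p ^+ N) B)].
  have [|B UB] := @ultra_finite_union _ _ S U UU; last by exists (map_mx (fun b => inc (val b) / inc p ^+ N) B).
  apply: filterS UN => g gN.
  have /choice[b bP] : forall ij : 'I_n * 'I_n, exists b : seq_sub s,
      vge (@lf_val E) e%:Z (m g ij.1 ij.2 - inc (val b) / inc p ^+ N).
    move=> [i j] /=; have [a aE] : exists a, inc a = m g i j * inc p ^+ N.
      apply/lf_integers; have := vgeM (gN i j) (_ : vge (@lf_val E) N%:Z (inc p ^+ N)).
      by rewrite addNr; apply; rewrite /vge lf_valX// lexx orbT.
    have [b bs Db] := sP a; exists (SeqSub bs) => /=.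
    have -> : m g i j - inc b / inc p ^+ N = inc (a - b) * (inc p ^+ N)^-1.
      by rewrite rmorphB aE mulrBl mulfK.
    have := vgeM Db (_ : vge (@lf_val E) (- N%:Z) (inc p ^+ N)^-1).
    rewrite PoszD addrK; apply.
    by rewrite /vge lf_valV// lf_valX// lexx orbT.
  exists (\matrix_(i, j) b (i, j)) => //= i j.
  by rewrite !mxE; apply: (bP (i, j)).
have /choice[M MP] := step.
have near e : mx_vge e%:Z (M e.+1 - M e).
  have [g [g1 g2]] := @filter_ex _ U _ _ (filterI (MP e) (MP e.+1)).
  have -> : M e.+1 - M e = (m g - M e) - (m g - M e.+1).
    by rewrite opprB [RHS]addrC addrA subrK.
  by apply: mx_vgeB => //; apply: mx_vge_le g2; rewrite lez_nat.
have /choice[L LP] : forall ij : 'I_n * 'I_n, exists l, forall e : nat,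
    vge (@lf_val E) e%:Z (l - M e ij.1 ij.2).
  move=> [i j]; apply: (@lf_complete_K E (fun e => M e i j)) => e.
  by have := near e i j; rewrite !mxE.
exists (\matrix_(i, j) L (i, j)) => e; apply: filterS (MP e) => g /= ge.
have -> : m g - \matrix_(i, j) L (i, j) = (m g - M e) - (\matrix_(i, j) L (i, j) - M e).
  by rewrite opprB addrA subrK.
by apply: mx_vgeB => // i j; rewrite !mxE; apply: (LP (i, j)).
Qed.

(** Along an ultrafilter g and g^-1 have limits L and L' as matrices. Then L L' = 1 and L satisfies
    the equations of G, by approximation to every order. *)
Lemma compact_bounded_pts N : compact (@bounded_pts O G E f N).
Proof.
rewrite compact_ultra => U UU UA.
have UA1 : U [set g : gT | mx_vge (- N%:Z) (pt_val g)] by apply: filterS UA => g [].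
have UA2 : U [set g : gT | mx_vge (- N%:Z) (pt_val g^-1%g)] by apply: filterS UA => g [].
have [L LU] := ultra_matrix_limit UU UA1; have [L' LU'] := ultra_matrix_limit UU UA2.
have wit e : exists g : gT, [/\ mx_vge (- N%:Z) (pt_val g), mx_vge (- N%:Z) (pt_val g^-1%g),
    mx_vge e%:Z (pt_val g - L) & mx_vge e%:Z (pt_val g^-1%g - L')].
  have [g [[g1 g2] [g3 g4]]] := @filter_ex _ U _ _ (filterI UA (filterI (LU e) (LU' e))).
  by exists g.
have bnd (A B : 'M[K]_n) : mx_vge (- N%:Z) A -> mx_vge 0 (A - B) -> mx_vge (- N%:Z) B.
  move=> hA hAB; have -> : B = A - (A - B) by rewrite opprB addrC subrK.
  by apply: mx_vgeB => //; apply: mx_vge_le hAB; rewrite oppr_le0.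
have LN : mx_vge (- N%:Z) L by have [g [g1 _ g3 _]] := wit 0%N; apply: bnd g1 g3.
have LN' : mx_vge (- N%:Z) L' by have [g [_ g2 _ g4]] := wit 0%N; apply: bnd g2 g4.
have LL' : L *m L' = 1%:M.
  apply/eqP; rewrite -subr_eq0; apply/eqP/mx_vge_oo => e.
  have [g [g1 g2 g3 g4]] := wit (e + N)%N.
  have -> : L *m L' - 1%:M = - ((pt_val g - L) *m L' + pt_val g *m (pt_val g^-1%g - L')).
    by rewrite mulmxBl mulmxBr -(pvalM g g^-1%g) mulgV [X in _ = - X]addrC addrA subrK opprB.
  apply/mx_vgeN/mx_vgeD.
    by have := mx_vgeM g3 LN'; apply: mx_vge_le; lia.
  by have := mx_vgeM g1 g4; apply: mx_vge_le; lia.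
have uL : L \in unitmx by have [] := mulmx1_unit LL'.
have LV : invmx L = L' by rewrite -[LHS]mulmx1 -LL' mulKmx.
have LP : mx_points (@gs_eqs O G) f L.
  split=> // p Pp; apply: vge_oo => e; have [C [_ lC]] := lipschitz_eval N p.
  have [g [g1 _ g3 _]] := wit (e + C)%N; have /asboolP[_ gP] := pt_in g.
  rewrite -[mx_eval f L p]opprK vgeN -[- _]add0r -(gP p Pp).
  by have := lC _ _ _ g1 LN g3; apply: vge_le; lia.
pose l : gT := Pts (asboolT LP); exists l; split.
  by split=> //; rewrite /= LV.
move=> V; rewrite nbhsE => -[W [oW Wl] WV]; apply: filterS WV _.
have [e he] := oW l Wl; apply: filterS (LU `|e|%N) => g hg; apply: he => /=.
by apply: mx_vge_le hg; lia.
Qed.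

Definition integral_pts : set gT :=
  range (@pts_map _ G _ _ f0 f inc fE).

Lemma integral_ptsE : integral_pts = bounded_pts 0.
Proof.
apply/seteqP; split=> [_ [x _ <-]|g [g1 g2]].
  split; first by rewrite oppr0; apply: mx_vge_inc.
  by rewrite oppr0 -(pts_mapV fE); apply: mx_vge_inc.
rewrite oppr0 in g1 g2; have [A AE] := mx_integral g1; have [A' AE'] := mx_integral g2.
have AA' : A *m A' = 1%:M.
  apply/matrixP => i j; apply: (@lf_inc_inj E).
  have := congr1 (fun M : 'M[K]_n => M i j) (erefl (pt_val (g * g^-1)%g)).
  rewrite {1}pvalM -AE -AE' -map_mxM mxE => ->.
  by rewrite mulgV !mxE rmorphMn rmorph1.
have uA : A \in unitmx by have [] := mulmx1_unit AA'.
have AP : mx_points (@gs_eqs O G) f0 A.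
  split=> // p Pp; apply: (@lf_inc_inj E); rewrite rmorph0 -(mx_eval_map fE) AE.
  by have /asboolP[_ ->] := pt_in g.
by exists (Pts (asboolT AP)) => //; apply: val_inj.
Qed.

End PadicCompact.

(** * Test functions and the Bernstein center *)

Section TestFunctions.
Variables (R : realType) (O : comUnitRingType) (G : group_scheme O) (E : local_field).
Variables (f : {rmorphism O -> lf_K E}).
Local Notation gT := (padic_points G f).
Local Notation C := R[i].
Implicit Types h : gT -> C.

Lemma test_function_comp h (phi psi : gT -> gT) : test_function h ->
  (forall U, open U -> open (phi @^-1` U)) -> (forall U, open U -> open (psi @^-1` U)) ->
  cancel phi psi -> test_function (h \o phi).
Proof.
move=> [lh [A cA hA]] ophi opsi phiK; split=> [x|].
  have [U [oU Ux UE]] := lh (phi x); exists (phi @^-1` U); split=> //; first exact: ophi.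
  by move=> y Uy; apply: UE.
exists (psi @` A); last by move=> x /hA Ax; exists (phi x).
apply: continuous_compact => //; apply: continuous_subspaceT.
by move=> x; move: x; apply/continuousP.
Qed.

Lemma test_function_mulV h a b : test_function h -> test_function (fun x => h (a * x^-1 * b)%g).
Proof.
have oV (c e : gT) U : open U -> open [set x | U (c * x^-1 * e)%g].
  move=> /(open_preim_mulr (b := e))/(open_preim_mull (a := c))/open_preim_inv.
  by [].
move=> th; apply: (@test_function_comp h _ (fun y => b * y^-1 * a)%g th).
- by move=> U; apply: oV.
- by move=> U; apply: oV.
- by move=> x; rewrite !invgM invgK !mulgA mulgV mul1g mulgVK.
Qed.

Lemma test_function_lin h1 h2 a : test_function h1 -> test_function h2 ->
  test_function (fun x => a * h1 x + h2 x).
Proof.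
move=> [l1 [A1 c1 s1]] [l2 [A2 c2 s2]]; split=> [x|].
  have [U [oU Ux UE]] := l1 x; have [V [oV Vx VE]] := l2 x.
  exists (U `&` V); split=> [|//|y [/UE -> /VE ->]//]; exact: openI.
exists (A1 `|` A2); first exact: compactU.
move=> x hx; have [h1x|] := eqVneq (h1 x) 0; last by move/s1; left.
by right; apply: s2; move: hx; rewrite h1x mulr0 add0r.
Qed.

Lemma test_function0 : test_function ((fun=> 0) : gT -> C).
Proof.
split=> [x|]; first by exists setT; split=> //; apply: openT.
by exists set0; [exact: compact0|move=> x; rewrite eqxx].
Qed.

Lemma test_functionZ h a : test_function h -> test_function (fun x => a * h x).
Proof.
move=> th; have -> : (fun x => a * h x) = (fun x => a * h x + (fun=> 0 : C) x).
  by apply/funext => x; rewrite addr0.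
exact: test_function_lin test_function0.
Qed.

Lemma test_function_sum (I : Type) (s : seq I) (u : I -> gT -> C) :
  (forall i, test_function (u i)) -> test_function (fun x => \sum_(i <- s) u i x).
Proof.
move=> tu; elim: s => [|i s IHs].
  by under eq_fun do rewrite big_nil; apply: test_function0.
have -> : (fun x => \sum_(j <- i :: s) u j x) = (fun x => 1 * u i x + \sum_(j <- s) u j x).
  by apply/funext => x; rewrite big_cons mul1r.
exact: test_function_lin.
Qed.

Lemma test_function_right_invariant h m (A : set gT) :
  (forall x k, congruence m.+1 k -> h (x * k)%g = h x) ->
  compact A -> (forall x, h x != 0 -> A x) -> test_function h.
Proof.
move=> hk cA hA; split; last by exists A.
move=> x; exists [set y | congruence m.+1 (x^-1 * y)%g]; split.
- exact/open_preim_mull/open_congruence.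
- by rewrite /= mulVg /congruence /= subrr => i j; rewrite mxE vge0.
- by move=> y /(hk x); rewrite mulVKg.
Qed.

Variables (D : (gT -> C) -> C) (hD : bernstein_center D).

Lemma bernstein_lin h1 h2 a : test_function h1 -> test_function h2 ->
  D (fun x => a * h1 x + h2 x) = a * D h1 + D h2.
Proof. by have [h _ _] := hD; apply: h. Qed.

Lemma bernstein0 : D (fun=> 0) = 0.
Proof.
by have := bernstein_lin 1 test_function0 test_function0; rewrite !mul1r addr0 => /eqP; rewrite -subr_eq subrr => /eqP.
Qed.

Lemma bernstein_sum (I : Type) (s : seq I) (u : I -> gT -> C) (a : C) :
  (forall i, test_function (u i)) ->
  D (fun x => a * \sum_(i <- s) u i x) = a * \sum_(i <- s) D (u i).
Proof.
move=> tu; have Z h : test_function h -> D (fun x => a * h x) = a * D h.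
  move=> th; have -> : (fun x => a * h x) = (fun x => a * h x + (fun=> 0 : C) x).
    by apply/funext => x; rewrite addr0.
  by rewrite (bernstein_lin _ th test_function0) bernstein0 addr0.
rewrite Z; last exact: test_function_sum.
congr (_ * _); elim: s => [|i s IHs].
  by under eq_fun do rewrite big_nil; rewrite big_nil bernstein0.
rewrite big_cons -IHs -[D (u i)]mul1r -bernstein_lin//; last exact: test_function_sum.
by congr D; apply/funext => x; rewrite big_cons mul1r.
Qed.

(* Conjugation-invariance of D, applied to the test function                 *)
(* y |-> h (a y^-1 g b).                                                     *)
Lemma dconv_twist h a b g : test_function h ->
  dconv D h (a * g * b)%g = dconv D (fun z => h (a * z * b)%g) g.
Proof.
move=> th; have [_ inv _] := hD; rewrite /dconv.
have tk : test_function (fun x => h (x^-1 * (a * g * b))%g).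
  have := test_function_mulV 1%g (a * g * b)%g th.
  by under eq_fun do rewrite mul1g.
rewrite -(inv _ a tk); congr D; apply/funext => x; congr h.
by rewrite !invgM invgK !mulgA mulgVK.
Qed.

Lemma test_function_dconv h : test_function h -> test_function (dconv D h).
Proof. by have [_ _] := hD; apply. Qed.

End TestFunctions.

(** * Characters of finite tori *)

HB.instance Definition _ (d : nat) (k : finFieldType) := [Countable of Gm d k by <:].
HB.instance Definition _ (d : nat) (k : finFieldType) := [Finite of Gm d k by <:].

Section Characters.
Variables (R : realType) (d : nat) (F : local_field).
Local Notation k := (lf_k F).
Local Notation C := R[i].
Local Notation A := (Gm d k).
Local Notation dual := (@torus_dual F d R).

Lemma closed_prim_root n : (0 < n)%N -> exists w : C, n.-primitive_root w.
Proof.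
move=> n0; have [rs rsE] := closed_field_poly_normal ('X^n - 1 : {poly C}).
have lc : lead_coef ('X^n - 1 : {poly C}) = 1 by apply/eqP; rewrite -polyC1 -monicE monicXnsubC.
rewrite lc scale1r in rsE.
have : has n.-primitive_root rs.
  apply: has_prim_root => //.
  - apply/allP => x xs; apply/unity_rootP.
    have : root ('X^n - 1) x by rewrite rsE root_prod_XsubC.
    by rewrite rootE !hornerE subr_eq0 => /eqP.
  - by rewrite -separable_prod_XsubC -rsE separable_Xn_sub_1// pnatr_eq0 -lt0n.
  - have := congr1 (fun p : {poly C} => size p) rsE.
    by rewrite size_prod_XsubC -polyC1 size_XnsubC// => -[->].
by move=> /hasP[w _ wP]; exists w.
Qed.

Lemma Gm_mul0 (s t : A) i : (s * t)%g 0 i = s 0 i * t 0 i. Proof. by rewrite mxE. Qed.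

Lemma Gm_neq0 (t : A) i : t 0 i != 0.
Proof. by rewrite -unitfE Gm_unitE. Qed.

Lemma dual_prod chi chi' : dual chi -> dual chi' -> dual (fun t => chi t * chi' t).
Proof.
move=> [c1 cM] [c1' cM']; split=> [|s t]; first by rewrite c1 c1' mulr1.
by rewrite cM cM' mulrACA.
Qed.

Lemma dual_mulV chi t : dual chi -> chi t * chi t^-1%g = 1.
Proof. by move=> [c1 cM]; rewrite -cM mulgV c1. Qed.

Lemma dual_inv chi : dual chi -> dual (fun t => chi t^-1%g).
Proof.
move=> [c1 cM]; split=> [|s t]; first by rewrite invg1 c1.
by rewrite invgM cM mulrC.
Qed.

Lemma dual1 : dual (fun=> 1).
Proof. by split=> // *; rewrite mulr1. Qed.

(** The character is the discrete logarithm of a coordinate to base g, exponentiated in C with a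
    root of unity w of the same order as g. *)
Lemma dual_separates s : s != 1%g -> exists2 chi, dual chi & chi s != 1.
Proof.
move=> s1; have [i si] : exists i, s 0 i != 1.
  apply: contrapT => h; move/eqP: s1; apply; apply/val_inj/rowP => i; rewrite mxE.
  by apply/eqP; apply: contraT => si; exfalso; apply: h; exists i.
have [g gP] := prim_root_residue F.
have /choice[lg lgE] : forall x : k, exists m, x != 0 -> x = g ^+ m.
  move=> x; have [->|x0] := eqVneq x 0; first by exists 0%N.
  have x1 : x ^+ #|k|.-1 = 1.
    apply: (mulfI x0); rewrite -exprS prednK ?expf_card ?mulr1//.
    by rewrite (ltn_trans _ (finNzRing_gt1 k)).
  by have [m ->] := prim_rootP gP x1; exists m.
have [w wP] := closed_prim_root (prim_order_gt0 gP).
have lgX m m' : (g ^+ m == g ^+ m') = (w ^+ m == w ^+ m').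
  by rewrite (eq_prim_root_expr gP) (eq_prim_root_expr wP).
exists (fun t => w ^+ lg (t 0 i)).
  split=> [|t u].
    by apply/eqP; rewrite -(expr0 w) -lgX -lgE ?Gm_neq0 ?mxE ?expr0.
  apply/eqP; rewrite -exprD -lgX exprD -!lgE ?Gm_neq0//.
  by rewrite Gm_mul0.
by rewrite -(expr0 w) -lgX -lgE ?Gm_neq0// expr0.
Qed.

(** Characters take values in the roots of unity of order dividing |k| - 1. Finiteness turns the sum
    over [torus_dual] in [phi'_r1] into an actual finite sum. *)
Lemma finite_dual : finite_set dual.
Proof.
have q1 : (0 < #|k|.-1)%N by have [g /prim_order_gt0] := prim_root_residue F.
have [|rs rsP] := @closed_roots C ('X^(#|k|.-1) - 1).
  by apply: monic_neq0; rewrite -polyC1 monicXnsubC.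
pose phi (c : {ffun A -> seq_sub rs}) : A -> C := fun t => val (c t).
apply: (@sub_finite_set _ _ (phi @` setT)); last exact/finite_image/finite_finset.
move=> chi [c1 cM]; have cX t m : chi (t ^+ m)%g = chi t ^+ m.
  by elim: m => [|m IHm]; rewrite ?expg0 ?c1// expgS cM IHm exprS.
have vX (t : A) m i : (t ^+ m)%g 0 i = t 0 i ^+ m.
  elim: m => [|m IHm]; first by rewrite expg0 mxE.
  by rewrite expgS Gm_mul0 IHm exprS.
have cr t : chi t \in rs.
  apply: rsP; rewrite rootE !hornerE -cX.
  suff -> : (t ^+ #|k|.-1)%g = 1%g by rewrite c1 subrr.
  apply/val_inj/rowP => i; rewrite vX mxE; apply: (mulfI (Gm_neq0 t i)).
  rewrite -exprS prednK ?expf_card ?mulr1//.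
  by rewrite (ltn_trans _ (finNzRing_gt1 k)).
exists [ffun t => SeqSub (cr t)] => //.
by apply/funext => t; rewrite /phi ffunE.
Qed.

Lemma dual_sum_translate chi0 (u : A) : dual chi0 ->
  \sum_(chi \in dual) chi u = chi0 u * \sum_(chi \in dual) chi u.
Proof.
move=> d0; rewrite {1}(@reindex_fsbig _ _ _ _ _ (fun chi t => chi0 t * chi t) dual dual).
  rewrite !fsbig_finite ?big_distrr//; exact: finite_dual.
split.
- by move=> chi dchi; apply: dual_prod.
- move=> chi chi' _ _ /= /(congr1 (fun c : A -> C => (fun t => chi0 t^-1%g * c t))) E.
  apply/funext => t; have := congr1 (fun c : A -> C => c t) E.
  by rewrite /= !mulrA [chi0 t^-1%g * _]mulrC dual_mulV// !mul1r.
- move=> chi dchi; exists (fun t => chi0 t^-1%g * chi t).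
    by apply: dual_prod => //; apply: dual_inv.
  by apply/funext => t; rewrite mulrA dual_mulV// mul1r.
Qed.

Lemma dual_sum0 (u : A) : u != 1%g -> \sum_(chi \in dual) chi u = 0.
Proof.
move=> /dual_separates[chi0 d0 c0]; have := dual_sum_translate u d0.
move=> /eqP; rewrite -subr_eq0 -[X in X - _]mul1r -mulrBl mulf_eq0 subr_eq0 eq_sym.
by rewrite (negPf c0) => /eqP.
Qed.

Lemma dual_group_sum chi : dual chi -> chi <> (fun=> 1) -> \sum_(s : A) chi s = 0.
Proof.
move=> [c1 cM] cn1; have [t ct] : exists t, chi t != 1.
  apply: contrapT => h; apply: cn1; apply/funext => t; apply/eqP; apply: contraT => ct.
  by exfalso; apply: h; exists t.
have : \sum_(s : A) chi s = chi t * \sum_(s : A) chi s.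
  rewrite {1}(reindex_inj (mulgI t)) big_distrr /=; apply: eq_bigr => s _.
  exact: cM.
move=> /eqP; rewrite -subr_eq0 -[X in X - _]mul1r -mulrBl mulf_eq0 subr_eq0 eq_sym.
by rewrite (negPf ct) => /eqP.
Qed.

Lemma mem_dual chi : (chi \in enum_fset (fset_set dual)) <-> dual chi.
Proof.
have -> : (chi \in enum_fset (fset_set dual)) = (chi \in fset_set dual) by [].
by rewrite in_fset_set ?inE//; apply: finite_dual.
Qed.

(** The double sum of chi(s) over s and chi is evaluated in both orders: only s = 1 survives in one,
    only the trivial character in the other. *)
Lemma dual_sum1 : \sum_(chi \in dual) chi (1%g : A) = #|{: A}|%:R.
Proof.
have fd := finite_dual.
have E1 : \sum_(s : A) \sum_(chi \in dual) chi s = \sum_(chi \in dual) chi (1%g : A).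
  by rewrite (bigD1 1%g)//= [X in _ + X]big1 ?addr0// => s; apply: dual_sum0.
rewrite -E1; under eq_bigr do rewrite fsbig_finite//.
rewrite exchange_big /= (bigD1_seq (fun=> 1 : C)) ?fset_uniq//=; last first.
  exact/mem_dual/dual1.
rewrite [X in _ + X]big_seq_cond [X in _ + X]big1 ?addr0 ?sumr_const ?cardE ?enumT//.
move=> chi /andP[/mem_dual dchi /eqP cn1].
exact: dual_group_sum.
Qed.

Lemma dual_sumV (u : A) :
  \sum_(chi \in dual) (chi u)^-1 = if u == 1%g then #|{: A}|%:R else 0.
Proof.
have -> : \sum_(chi \in dual) (chi u)^-1 = \sum_(chi \in dual) chi u^-1%g.
  rewrite !fsbig_finite; try exact: finite_dual.
  apply: eq_big_seq => chi /mem_dual dchi; have E := dual_mulV u dchi.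
  by apply: (mulfI (x := chi u)); rewrite ?E ?divff//;
    apply: contra_eqN E => /eqP ->; rewrite mul0r eq_sym oner_neq0.
case: eqP => [->|/eqP u1]; first by rewrite invg1 dual_sum1.
by rewrite dual_sum0// invg_eq1.
Qed.

End Characters.

(** * The Iwahori subgroup *)

Section Theta.
Variables (F E : local_field) (r : nat) (X : unramified_ext F E r).
Variables (d : nat) (G : split_reductive (lf_O F) d).
Local Notation Gr := (padic_points G (str_E X)).
Local Notation theta := (@theta F E r X d G).

Lemma thetaM (x y : Gr) : theta (x * y)%g = (theta x * theta y)%g.
Proof. exact: pts_mapM. Qed.

Lemma theta1 : theta 1%g = 1%g. Proof. exact: pts_map1. Qed.

Lemma theta_congruence n (k : Gr) : congruence n.+1 k -> congruence n.+1 (theta k).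
Proof.
move=> hk; have [A AE] : exists A, map_mx (lf_inc E) A = pt_val k - 1%:M.
  by apply: mx_integral; apply: mx_vge_le hk.
rewrite /congruence /=.
have -> : map_mx (ue_theta X) (pt_val k) - 1%:M
    = map_mx (lf_inc E) (map_mx (ue_thetaO X) A).
  have -> : (1%:M : 'M[lf_K E]_(gs_dim G)) = map_mx (ue_theta X) 1%:M by rewrite map_mx1.
  rewrite -map_mxB -AE.
  by apply/matrixP => i j; rewrite !mxE ue_theta_compat.
move=> i j; rewrite !mxE; apply: Dge_theta.
by have := hk i j; rewrite -AE mxE.
Qed.

End Theta.

Section Iwahori.
Variables (F E : local_field) (r : nat) (X : unramified_ext F E r).
Variables (d : nat) (G : split_reductive (lf_O F) d).
Local Notation Gr := (padic_points G (str_E X)).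
Local Notation kF := (lf_k F).
Local Notation kE := (lf_k E).
Local Notation theta := (@theta F E r X d G).
Local Notation iwahori := (iwahori X G).
Local Notation iwahori_plus := (iwahori_plus X G).
Local Notation tor_O := (tor_O X G).

Lemma hyperspecialE : hyperspecial X G = bounded_pts 0.
Proof. exact: (@integral_ptsE _ G E (str_E X) (ue_O X) (fun=> erefl)). Qed.

Lemma compact_hyperspecial : compact (hyperspecial X G).
Proof. by rewrite hyperspecialE; apply: compact_bounded_pts. Qed.

Lemma incl_pts_inj : injective (@incl_pts F E r X d G).
Proof. by apply: pts_map_inj; apply: lf_inc_inj. Qed.

Lemma incl_ptsM (x y : pts G (ue_O X)) : incl_pts (x * y)%g = (incl_pts x * incl_pts y)%g.
Proof. exact: pts_mapM. Qed.

Lemma incl_ptsV (x : pts G (ue_O X)) : incl_pts x^-1%g = (incl_pts x)^-1%g.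
Proof. exact: pts_mapV. Qed.

Lemma iwahori_hyperspecial : iwahori `<=` hyperspecial X G.
Proof. by move=> _ [x _ <-]; exists x. Qed.

Lemma subgroup_iwahori : subgroup iwahori.
Proof.
have [B1 BM BV] := sr_bor_sub G (str_k X); split.
- by exists 1%g; [rewrite /= /red_pts pts_map1|exact: pts_map1].
- move=> _ _ [x Bx <-] [y By <-]; exists (x * y)%g; last exact: incl_ptsM.
  by rewrite /= /red_pts pts_mapM; apply: BM.
- move=> _ [x Bx <-]; exists x^-1%g; last exact: incl_ptsV.
  by rewrite /= /red_pts pts_mapV; apply: BV.
Qed.

Lemma tor_O_E (t : Gm d (lf_O E)) : tor_O t = sr_tor G (str_E X) (Gm_map (lf_inc E) t).
Proof. exact: sr_tor_nat. Qed.

Lemma theta_tor_O t : theta (tor_O t) = tor_O (Gm_map (ue_thetaO X) t).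
Proof.
rewrite !tor_O_E /theta (sr_tor_nat G (ue_theta_str X)); congr (sr_tor G _ _).
by apply/val_inj/rowP => i; rewrite !mxE ue_theta_compat.
Qed.

Lemma iwahori_tor t : iwahori (tor_O t).
Proof.
exists (sr_tor G (ue_O X) t) => //=; rewrite /red_pts sr_tor_nat.
by apply: (@sr_bor_tor _ _ G _ (str_k X)); exists (Gm_map (lf_red E) t).
Qed.

Variable tau : pts G (str_k X) -> Gm d kE.
Local Notation B := (closed_points G (sr_bor G) kE (str_k X)).
Hypothesis tauM : forall x y, B x -> B y -> tau (x * y)%g = (tau x * tau y)%g.
Hypothesis tau_tor : forall t, tau (sr_tor G (str_k X) t) = t.
Hypothesis tau_unip : forall x, B x -> unipotent x <-> tau x = 1%g.

Definition iwahori_torus (z : Gr) : Gm d kE :=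
  tau (red_pts (xget 1%g [set x : pts G (ue_O X) | incl_pts x = z])).

Lemma iwahori_torusE x : iwahori_torus (incl_pts x) = tau (red_pts x).
Proof.
rewrite /iwahori_torus; congr (tau (red_pts _)).
by apply: incl_pts_inj; have := @xgetPex _ 1%g [set y : pts G (ue_O X) | incl_pts y = incl_pts x];
   apply; exists x.
Qed.

Lemma iwahori_torusM z w : iwahori z -> iwahori w ->
  iwahori_torus (z * w)%g = (iwahori_torus z * iwahori_torus w)%g.
Proof.
move=> [x Bx <-] [y By <-]; rewrite -incl_ptsM !iwahori_torusE /red_pts pts_mapM.
exact: tauM.
Qed.

Lemma iwahori_torus1 : iwahori_torus 1%g = 1%g.
Proof.
have [I1 _ _] := subgroup_iwahori; apply: (mulgI (iwahori_torus 1%g)).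
by rewrite -iwahori_torusM// !mulg1.
Qed.

Lemma iwahori_torusV z : iwahori z -> iwahori_torus z^-1%g = (iwahori_torus z)^-1%g.
Proof.
move=> Iz; have [_ _ IV] := subgroup_iwahori; have IzV := IV _ Iz.
by apply: (mulgI (iwahori_torus z)); rewrite -iwahori_torusM// !mulgV iwahori_torus1.
Qed.

Lemma iwahori_torus_tor t : iwahori_torus (tor_O t) = Gm_map (lf_red E) t.
Proof. by rewrite iwahori_torusE /red_pts sr_tor_nat. Qed.

Lemma iwahori_plusP z : iwahori_plus z <-> iwahori z /\ iwahori_torus z = 1%g.
Proof.
split=> [[x [Bx ux] <-]|[[x Bx <-]]].
  by split; [exists x|rewrite iwahori_torusE; apply/tau_unip].
by rewrite iwahori_torusE => tx; exists x => //; split => //; apply/tau_unip.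
Qed.

(** The source of local constancy: functions on I_r that factor through T(k_r) are invariant under
    an open subgroup. *)
Lemma congruence_iwahori_plus k : congruence 1 k -> iwahori_plus k.
Proof.
move=> hk; have [k1 k2] := congruence_int hk.
have : bounded_pts 0 k by split; rewrite oppr0.
rewrite -hyperspecialE => -[x _ xk].
have rx : red_pts x = 1%g.
  apply/val_inj/eqP; rewrite /= -subr_eq0 -(map_mx1 (lf_red E)) -map_mxB; apply/eqP/mx_vge1_red.
  by move: hk; rewrite -xk /congruence /= map_mxB map_mx1.
have [B1 _ _] := sr_bor_sub G (str_k X).
rewrite -xk; exists x => //=; split; first by rewrite rx.
by rewrite rx; apply/tau_unip => //; rewrite -(tau_tor 1%g); congr tau;
  apply: (mulgI (sr_tor G (str_k X) 1%g)); rewrite -sr_torM !mulg1.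
Qed.

Lemma iwahori_congruence z k : congruence 1 k -> iwahori (z * k)%g <-> iwahori z.
Proof.
move=> /congruence_iwahori_plus/iwahori_plusP[Ik _].
have [_ IM IV] := subgroup_iwahori; split=> Iz; last exact: IM.
by rewrite -(mulgK k z); apply: IM => //; apply: IV.
Qed.

Lemma iwahori_torus_congruence z k : iwahori z -> congruence 1 k ->
  iwahori_torus (z * k)%g = iwahori_torus z.
Proof.
move=> Iz /congruence_iwahori_plus/iwahori_plusP[Ik tk].
by rewrite iwahori_torusM// tk mulg1.
Qed.

Definition torus_lift (s : Gm d kE) : Gm d (lf_O E) :=
  xget 1%g [set t : Gm d (lf_O E) | Gm_map (lf_red E) t = s].

Lemma torus_liftK s : Gm_map (lf_red E) (torus_lift s) = s.
Proof. by have := xgetPex 1%g (Gm_lift s). Qed.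

(** The lifts t_s represent the cosets. As [index_of] picks some number with [has_index], uniqueness
    is shown too: any system of representatives is in bijection with T(k_r). *)
Lemma iwahori_index : index_of iwahori iwahori_plus = #|{: Gm d kE}|.
Proof.
have [I1 IM IV] := subgroup_iwahori.
have uniq k : has_index iwahori iwahori_plus k -> k = #|{: Gm d kE}|.
  move=> [s [Is sU]]; rewrite -(card_ord k).
  apply: (@bij_eq_card _ _ (fun i => iwahori_torus (s i))).
  have ex (t : Gm d kE) : exists! i, iwahori_torus (s i) = t.
    have [i [Ii iU]] := sU _ (iwahori_tor (torus_lift t)).
    have key j : iwahori_plus ((s j)^-1 * tor_O (torus_lift t))%g <-> iwahori_torus (s j) = t.
      have It := iwahori_tor (torus_lift t); have IVj := IV _ (Is j).
      rewrite iwahori_plusP iwahori_torusM// iwahori_torusV// iwahori_torus_tor torus_liftK.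
      split=> [[_ E1]|->]; last by rewrite mulVg; split => //; apply: IM.
      by apply: (mulgI (iwahori_torus (s j))^-1%g); rewrite E1 mulVg.
    exists i; split; first exact/key.
    by move=> j /key/iU.
  have /choice[h hP] := ex.
  exists h => [i|t]; first by have [_ hU] := hP (iwahori_torus (s i)); apply: hU.
  by have [-> _] := hP t.
rewrite /index_of; apply: uniq.
have := @xgetPex _ 0%N [set k | has_index iwahori iwahori_plus k]; apply.
exists #|{: Gm d kE}|, (fun i => tor_O (torus_lift (enum_val i))); split.
  by move=> i; apply: iwahori_tor.
move=> x Ix.
have key i : iwahori_plus ((tor_O (torus_lift (enum_val i)))^-1 * x)%g <->
    enum_val i = iwahori_torus x.
  have It := iwahori_tor (torus_lift (enum_val i)); have IVt := IV _ It.
  rewrite iwahori_plusP iwahori_torusM// iwahori_torusV// iwahori_torus_tor torus_liftK.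
  split=> [[_ E1]|E1]; last by split; [apply: IM|rewrite E1 mulVg].
  by apply: (mulgI (enum_val i)^-1%g); rewrite E1 mulVg.
exists (enum_rank (iwahori_torus x)); split; first by apply/key; rewrite enum_rankK.
by move=> j /key <-; rewrite enum_valK.
Qed.

Definition torus_norm (s : Gm d kE) : Gm d kF := Gm_map (lf_red F) (norm_T X (torus_lift s)).

Lemma torus_normE s i : res_ext X (torus_norm s 0 i) = res_norm X (s 0 i).
Proof. by rewrite red_norm_T torus_liftK. Qed.

Lemma torus_norm_red t : Gm_map (lf_red F) (norm_T X t) = torus_norm (Gm_map (lf_red E) t).
Proof.
apply/val_inj/rowP => i; apply: (fmorph_inj (res_ext X)).
exact: (etrans (red_norm_T X t i) (esym (torus_normE _ i))).
Qed.

Variable R : realType.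
Local Notation C := R[i].

(** The choice in [rho_chi] is harmless: any admissible t reduces to the image of z in T(k_r), and
    the character depends only on that reduction. *)
Lemma rho_chiE (chi : Gm d kF -> C) z : iwahori z ->
  rho_chi chi z = chi (torus_norm (iwahori_torus z)).
Proof.
move=> Iz; have [I1 IM IV] := subgroup_iwahori.
have key t : iwahori_plus ((tor_O t)^-1 * z)%g <-> Gm_map (lf_red E) t = iwahori_torus z.
  have It := iwahori_tor t; have IVt := IV _ It.
  rewrite iwahori_plusP iwahori_torusM// iwahori_torusV// iwahori_torus_tor.
  split=> [[_ E1]|->]; last by rewrite mulVg; split => //; apply: IM.
  by apply: (mulgI (Gm_map (lf_red E) t)^-1%g); rewrite E1 mulVg.
rewrite /rho_chi; have := @xgetPex _ 0 [set c : C | exists t, iwahori_plus ((tor_O t)^-1 * z)%g /\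
  c = inflate chi (norm_T X t)].
case.
  exists (inflate chi (norm_T X (torus_lift (iwahori_torus z)))), (torus_lift (iwahori_torus z)).
  by split => //; apply/key; rewrite torus_liftK.
by move=> t [/key tz ->]; rewrite /inflate torus_norm_red tz.
Qed.

(* By Hilbert 90, with fibres the cosets of T(kF). *)
Lemma torus_twisted_count (a : Gm d kE) :
  #|[set s : Gm d kE | (s^-1 * a * Gm_map (res_theta X) s)%g == 1%g]%SET|
  = if torus_norm a == 1%g then #|{: Gm d kF}| else 0%N.
Proof.
have eqP' (s : Gm d kE) : (s^-1 * a * Gm_map (res_theta X) s)%g = 1%g <->
    forall i, a 0 i = s 0 i / res_theta X (s 0 i).
  have sn i : s 0 i != 0 by rewrite -unitfE Gm_unitE.
  have tn i : res_theta X (s 0 i) != 0 by rewrite fmorph_eq0.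
  split=> [E1 i|E1].
    have := congr1 (fun u : Gm d kE => u 0 i) E1; rewrite /= !mxE => E2.
    by apply: (mulIf (tn i)); rewrite divfK//; apply: (mulfI (invr_neq0 (sn i)));
      rewrite mulrA E2 mulVf.
  by apply/val_inj/rowP => i; rewrite !mxE E1 mulrA mulVf// mul1r mulVf.
case: eqP => [Na|Na].
  have /choice[y yP] : forall i, exists y, y != 0 /\ a 0 i = y / res_theta X y.
    move=> i; have a0 : a 0 i != 0 by rewrite -unitfE Gm_unitE.
    have [|y y0 yE] := hilbert90 (X := X) a0; last by exists y.
    by rewrite -torus_normE Na mxE rmorph1.
  have yu i : y i \is a GRing.unit by rewrite unitfE; have [] := yP i.
  pose s0 : Gm d kE := MkGm (Gm_rowP yu).
  have s0E : forall i, a 0 i = s0 0 i / res_theta X (s0 0 i).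
    by move=> i; rewrite mxE; have [] := yP i.
  pose emb (c : Gm d kF) := (s0 * Gm_map (res_ext X) c)%g.
  have embI : injective emb.
    move=> c c' /mulgI/(congr1 val)/rowP E1; apply/val_inj/rowP => i.
    by apply: (fmorph_inj (res_ext X)); have := E1 i; rewrite !mxE.
  rewrite -(card_codom embI); apply: eq_card => s; rewrite inE.
  have thext x : res_theta X (res_ext X x) = res_ext X x.
    by rewrite -[x]res_liftK res_extE res_thetaE thetaO_ue.
  apply/eqP/codomP => [/eqP' sE|[c ->]]; last first.
    apply/eqP' => i; rewrite !mxE rmorphM /= thext s0E mxE.
    have cn : res_ext X (c 0 i) != 0 by rewrite fmorph_eq0 -unitfE Gm_unitE.
    by rewrite -mulf_div divff// mulr1.
  have /choice[c cE] : forall i, exists c, s 0 i / s0 0 i = res_ext X c.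
    move=> i; apply: res_theta_fixed; rewrite rmorphM fmorphV /=.
    have := s0E i; rewrite (sE i).
    have sn : s 0 i != 0 by rewrite -unitfE Gm_unitE.
    have s0n : s0 0 i != 0 by rewrite -unitfE Gm_unitE.
    have tn : res_theta X (s 0 i) != 0 by rewrite fmorph_eq0.
    have tn0 : res_theta X (s0 0 i) != 0 by rewrite fmorph_eq0.
    move=> /eqP; rewrite eqr_div// => /eqP E2; apply/eqP.
    by rewrite eqr_div// mulrC -E2 mulrC.
  have cu i : c i \is a GRing.unit.
    rewrite unitfE -(fmorph_eq0 (res_ext X)) /= -cE mulf_neq0// ?invr_eq0 -?unitfE;
      exact: Gm_unitE.
  exists (MkGm (Gm_rowP cu)); apply/val_inj/rowP => i; rewrite !mxE /= -cE mxE mulrC divfK//.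
  by rewrite -unitfE.
apply: eq_card0 => s; rewrite !inE; apply/eqP => /eqP' sE.
apply: Na; apply/val_inj/rowP => i; apply: (fmorph_inj (res_ext X)).
have := torus_normE a i; rewrite sE res_norm_theta -?unitfE ?Gm_unitE// => E1.
have o : (1%g : Gm d kF) 0 i = 1 by rewrite mxE.
exact: (etrans E1 (esym (etrans (congr1 (res_ext X) o) (rmorph1 _)))).
Qed.

End Iwahori.

(** * The averaging identity for the test functions *)

Section Average.
Variables (F E : local_field) (r : nat) (X : unramified_ext F E r).
Variables (d : nat) (G : split_reductive (lf_O F) d) (R : realType).
Local Notation Gr := (padic_points G (str_E X)).
Local Notation C := R[i].
Local Notation kF := (lf_k F).
Local Notation kE := (lf_k E).
Local Notation theta := (@theta F E r X d G).
Local Notation iwahori := (iwahori X G).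
Local Notation iwahori_plus := (iwahori_plus X G).
Variable vol : {measure set (g_sigma_algebraType (@open Gr)) -> \bar R}.
Hypothesis volI : vol iwahori = 1%E.
Variable tau : pts G (str_k X) -> Gm d kE.
Local Notation B := (closed_points G (sr_bor G) kE (str_k X)).
Hypothesis tauM : forall x y, B x -> B y -> tau (x * y)%g = (tau x * tau y)%g.
Hypothesis tau_tor : forall t, tau (sr_tor G (str_k X) t) = t.
Hypothesis tau_unip : forall x, B x -> unipotent x <-> tau x = 1%g.

Definition torus_pt (s : Gm d kE) : Gr := tor_O X G (torus_lift s).

Lemma e_chiE chi z : e_chi vol chi z =
  if `[< iwahori z >] then (chi (torus_norm X (iwahori_torus tau z)))^-1 else 0.
Proof.
rewrite /e_chi volI; case: asboolP => // Iz.
by rewrite (rho_chiE tauM tau_tor tau_unip)// invr1 mul1r.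
Qed.

Lemma test_function_e_chi chi : test_function (e_chi vol chi).
Proof.
apply: (@test_function_right_invariant R _ G E (str_E X) _ 0 (hyperspecial X G)).
- move=> z k hk; rewrite !e_chiE.
  have Izk := iwahori_congruence tau_tor tau_unip z hk.
  case: asboolP => [/Izk Iz|nIz]; case: asboolP => //.
    by move=> _; rewrite (iwahori_torus_congruence tauM tau_tor tau_unip Iz hk).
  by move=> /Izk.
- exact: compact_hyperspecial.
- move=> z; rewrite e_chiE; case: asboolP => [Iz _|_]; last by rewrite eqxx.
  exact: iwahori_hyperspecial.
Qed.

Lemma test_function_iwahori_plus : test_function (char_fun R iwahori_plus).
Proof.
apply: (@test_function_right_invariant R _ G E (str_E X) _ 0 (hyperspecial X G)).
- move=> z k hk; rewrite /char_fun; congr ((_ : bool)%:R); apply: asbool_equiv_eq.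
  rewrite !(iwahori_plusP tau_unip) (iwahori_congruence tau_tor tau_unip z hk).
  by split=> -[Iz tz]; split => //; move: tz;
    rewrite (iwahori_torus_congruence tauM tau_tor tau_unip Iz hk).
- exact: compact_hyperspecial.
- move=> z; rewrite /char_fun; case: asboolP => [|_]; last by rewrite eqxx.
  by move=> /(iwahori_plusP tau_unip)[/iwahori_hyperspecial].
Qed.

Lemma iwahori_torus_theta s : iwahori_torus tau (theta (torus_pt s)) = Gm_map (res_theta X) s.
Proof.
rewrite theta_tor_O (iwahori_torus_tor tau_tor); rewrite -{2}(torus_liftK s).
by apply/val_inj/rowP => i; rewrite !mxE /= res_thetaE.
Qed.

(* Averaging 1_{I^+} over theta-conjugation by T(kE) projects onto the        *)
(* characters of T(kE) which are norms from T(kF).                            *)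
Lemma iwahori_average z :
  (index_of iwahori iwahori_plus)%:R^-1 * \sum_(chi \in @torus_dual F d R) e_chi vol chi z
  = #|{: Gm d kE}|%:R^-1 *
    \sum_(s : Gm d kE) char_fun R iwahori_plus ((torus_pt s)^-1 * z * theta (torus_pt s))%g.
Proof.
rewrite (iwahori_index tauM tau_tor tau_unip); congr (_ * _).
have [I1 IM IV] := subgroup_iwahori X G.
have Is s : iwahori (torus_pt s) by apply: iwahori_tor.
have Ith s : iwahori (theta (torus_pt s)) by rewrite theta_tor_O; apply: iwahori_tor.
(* Off I_r both sides vanish, because t_s and theta(t_s) lie in I_r. *)
have [Iz|nIz] := pselect (iwahori z); last first.
  rewrite fsbig1 ?big1// => [s _|chi _]; last by rewrite e_chiE asboolF.
  rewrite /char_fun asboolF// => /(iwahori_plusP tau_unip)[Isz _]; apply: nIz.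
  have := IM _ _ (IM _ _ (Is s) Isz) (IV _ (Ith s)).
  by rewrite !mulgA mulgV mul1g mulgK.
pose a := iwahori_torus tau z.
have -> : \sum_(chi \in @torus_dual F d R) e_chi vol chi z =
          \sum_(chi \in @torus_dual F d R) (chi (torus_norm X a))^-1.
  by apply: eq_fsbigr => chi _; rewrite e_chiE asboolT.
(* Both sides equal |T(k_F)| if a has norm 1, and 0 otherwise. *)
rewrite dual_sumV; transitivity
  (#|[set s : Gm d kE | (s^-1 * a * Gm_map (res_theta X) s)%g == 1%g]%SET|%:R : C).
  by rewrite torus_twisted_count; case: eqP.
rewrite -sum1_card natr_sum big_mkcond /=; apply: eq_bigr => s _.
rewrite inE /char_fun.
have E1 : iwahori_plus ((torus_pt s)^-1 * z * theta (torus_pt s))%g <->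
    (s^-1 * a * Gm_map (res_theta X) s)%g = 1%g.
  have IVs := IV _ (Is s); have IVz := IM _ _ IVs Iz; have Izt := IM _ _ IVz (Ith s).
  rewrite (iwahori_plusP tau_unip) !(iwahori_torusM tauM)//.
  rewrite (iwahori_torusV tauM)// (iwahori_torus_tor tau_tor) torus_liftK iwahori_torus_theta.
  by split=> [[]|].
case: eqP => [/E1 ?|nE]; first by rewrite asboolT.
by rewrite asboolF// => /E1.
Qed.

Variables (Z : (Gr -> C) -> C) (hZ : bernstein_center Z) (l : nat).

Lemma test_function_phi'_r1 : test_function (phi'_r1 vol Z l).
Proof.
rewrite /phi'_r1; apply: test_functionZ.
have -> : (fun g => \sum_(chi \in @torus_dual F d R) dconv Z (e_chi vol chi) g) =
          (fun g => \sum_(chi <- enum_fset (fset_set (@torus_dual F d R))) dconv Z (e_chi vol chi) g).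
  by apply/funext => g; rewrite fsbig_finite//; apply: finite_dual.
by apply: test_function_sum => chi; apply: test_function_dconv => //; apply: test_function_e_chi.
Qed.

Lemma test_function_phi_r1 : test_function (phi_r1 Z l : Gr -> C).
Proof.
by apply/test_functionZ/test_function_dconv => //; apply: test_function_iwahori_plus.
Qed.

(** Z applied to [iwahori_average]: linearity takes the finite sums out, and [dconv_twist] moves the
    translations by t_s and theta(t_s) across the convolution. *)
Lemma phi'_r1_average y : phi'_r1 vol Z l y = #|{: Gm d kE}|%:R^-1 *
  \sum_(s : Gm d kE) phi_r1 Z l ((torus_pt s)^-1 * y * theta (torus_pt s))%g.
Proof.
have fd := @finite_dual R d F.
rewrite /phi'_r1 /phi_r1 -big_distrr /= [X in _ = X]mulrCA mulrAC mulrC; congr (_ * _).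
have tconv (h : Gr -> C) : test_function h -> test_function (fun x => h (x^-1 * y)%g).
  by move=> /(test_function_mulV 1%g y); under eq_fun do rewrite mul1g.
rewrite fsbig_finite// -(bernstein_sum hZ); last first.
  by move=> chi; apply: tconv; apply: test_function_e_chi.
have E1 (s : Gm d kE) : dconv Z (char_fun R iwahori_plus)
      ((torus_pt s)^-1 * y * theta (torus_pt s))%g =
    Z (fun x => char_fun R iwahori_plus ((torus_pt s)^-1 * (x^-1 * y) * theta (torus_pt s))%g).
  by rewrite (dconv_twist hZ)//; apply: test_function_iwahori_plus.
under [in RHS]eq_bigr do rewrite E1.
rewrite -big_enum /= -(bernstein_sum hZ); last first.
  move=> s; have := test_function_mulV ((torus_pt s)^-1)%g (y * theta (torus_pt s))%g
    test_function_iwahori_plus.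
  by under eq_fun do rewrite !mulgA; under [in X in _ -> X]eq_fun do rewrite !mulgA.
congr Z; apply/funext => x; rewrite big_enum /= -iwahori_average fsbig_finite//.
Qed.

End Average.

(** * Integration over quotients *)

Section QuotientTranslation.
Variables (R : realType) (gT : TopGroup.type) (H : set gT).
Hypothesis open_mulr : forall (U : set gT) b, open U -> open [set x | U (x * b)%g].
Variable nu : {measure set (quot H) -> \bar R}.
Hypothesis hnu : is_quotient_haar nu.
Local Notation Q := (quot H).

Definition rtrans (g : gT) : Q -> Q := fun x => ((x : gT) * g)%g.

Lemma quot_open_measurable (U : set gT) : quot_open H U -> measurable (U : set Q).
Proof. exact: sub_sigma_algebra. Qed.

Lemma measurable_rtrans g : measurable_fun setT (rtrans g).
Proof.
apply: (@measurability _ _ Q Q setT (rtrans g) (quot_open H)) => //.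
move=> _ [U [oU iU] <-]; rewrite setTI; apply: quot_open_measurable; split; first exact: open_mulr.
by move=> h x Hh /= Ux; rewrite /rtrans -mulgA; apply: iU.
Qed.

Lemma rtrans_measure g (A : set Q) : measurable A -> pushforward nu (rtrans g) A = nu A.
Proof.
move=> mA; have [inv _ _] := hnu; rewrite /pushforward -(inv g^-1%g A mA); congr (nu _).
apply/seteqP; split=> [x Ax|_ [x Ax <-]]; first by exists (x * g)%g => //; rewrite mulgK.
by rewrite /= /rtrans mulgVK.
Qed.

Lemma ge0_integral_rtrans (g : gT) (D : set Q) (f : Q -> \bar R) : measurable D ->
  measurable_fun D f -> (forall y, D y -> (0 <= f y)%E) ->
  (\int[nu]_(x in rtrans g @^-1` D) f (rtrans g x) = \int[nu]_(x in D) f x)%E.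
Proof.
move=> mD mf f0; have mg := measurable_rtrans g.
transitivity (\int[pushforward nu (rtrans g)]_(x in D) f x)%E.
  by symmetry; apply: (ge0_integral_pushforward mg) => // y; rewrite inE; apply: f0.
by apply: eq_measure_integral => // A mA _; apply: rtrans_measure.
Qed.

Lemma integrable_rtrans (g : gT) (D : set Q) (f : Q -> R) : measurable D ->
  measurable_fun setT f -> nu.-integrable D (fun x => (f x)%:E) ->
  nu.-integrable (rtrans g @^-1` D) (fun x => (f (rtrans g x))%:E) /\
  Rintegral nu (rtrans g @^-1` D) (fun x => f (rtrans g x)) = Rintegral nu D f.
Proof.
move=> mD mf intf; have mg := measurable_rtrans g.
have mgD : measurable (rtrans g @^-1` D) by rewrite -[X in measurable X]setTI; exact: mg.
have intg : nu.-integrable (rtrans g @^-1` D) (fun x => (f (rtrans g x))%:E).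
  apply/integrableP; split.
    apply: measurable_funTS; apply/measurable_EFinP; exact: measurableT_comp.
  rewrite (@ge0_integral_rtrans g D (fun x => `|(f x)%:E|%E))//; first by have /integrableP[] := intf.
  by apply: measurable_funTS; apply: measurableT_comp => //; apply/measurable_EFinP.
split=> //; rewrite /Rintegral; congr fine.
transitivity (\int[pushforward nu (rtrans g)]_(x in D) (f x)%:E)%E.
  by symmetry; apply: (integral_pushforward mg) => //; apply/measurable_EFinP.
by apply: eq_measure_integral => // A mA _; apply: rtrans_measure.
Qed.

End QuotientTranslation.

(** * Improper integrals over exhaustions of the quotient *)

Section ImproperIntegral.
Variables (R : realType) (gT : TopGroup.type) (H K0 : set gT) (B : nat -> set gT).
Hypothesis open_mulr : forall (U : set gT) b, open U -> open [set x | U (x * b)%g].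
Hypothesis open_mull : forall (U : set gT) a, open U -> open [set x | U (a * x)%g].
Hypotheses (H1 : H 1%g) (HM : forall h k, H h -> H k -> H (h * k)%g).
Hypotheses (K1 : K0 1%g) (KV : forall k, K0 k -> K0 k^-1%g) (openK : open K0).
Hypotheses (compactB : forall N, compact (B N)) (BK : forall N x k, B N x -> K0 k -> B N (x * k)%g).
Hypotheses (B_le : forall M N, (M <= N)%N -> B M `<=` B N) (B_cover : forall x, exists N, B N x).
Variable nu : {measure set (quot H) -> \bar R}.
Hypothesis hnu : is_quotient_haar nu.
Local Notation Q := (quot H).
Local Notation exh := (exhausting H K0).

(** Asking this of all sets S, singletons included, says that f is locally constant and left
    H-invariant. *)
Definition quot_locally_constant (f : Q -> R) := forall S : set R, quot_open H (f @^-1` S).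

Lemma quot_locally_constant_measurable f : quot_locally_constant f -> measurable_fun setT f.
Proof. by move=> hf _ S mS; rewrite setTI; apply: quot_open_measurable. Qed.

Lemma exhausting_mulr W x k : exh W -> K0 k -> W (x * k)%g <-> W x.
Proof.
move=> [WK _] Kk; split=> Wx; last by rewrite -WK; exists x, k.
by rewrite -WK; exists (x * k)%g, k^-1%g; rewrite mulgK; split=> //; apply: KV.
Qed.

Lemma exhausting_mull W : exh W -> left_invariant H W.
Proof.
move=> [_ [A _ ->]] h x Hh [k [a [Hk Aa ->]]]; exists (h * k)%g, a.
by split=> //; [apply: HM|rewrite mulgA].
Qed.

Lemma exhausting_quot_open W : exh W -> quot_open H W.
Proof.
move=> eW; split; last exact: exhausting_mull.
have -> : W = \bigcup_(w in W) [set x | K0 (w^-1 * x)%g].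
  apply/seteqP; split=> [x Wx|x [w Ww /= Kx]]; first by exists x => //=; rewrite mulVg.
  by have /(exhausting_mulr w eW) [_ /(_ Ww)] := Kx; rewrite mulKVg.
by apply: bigcup_open => w _; apply: open_mull.
Qed.

Lemma exhausting_measurable W : exh W -> measurable (W : set Q).
Proof. by move=> eW; apply: quot_open_measurable; apply: exhausting_quot_open. Qed.

Lemma exhausting_finite W : exh W -> (nu W < +oo)%E.
Proof. by move=> [_ [A cA ->]]; case: hnu => _ + _; apply. Qed.

Lemma exhaustingU V W : exh V -> exh W -> exh (V `|` W).
Proof.
move=> eV eW; split; last first.
  have [[_ [A cA ->]] [_ [A' cA' ->]]] := (eV, eW).
  exists (A `|` A'); first exact: compactU.
  apply/seteqP; split=> [x [[h [a [Hh Aa ->]]]|[h [a [Hh Aa ->]]]]|x [h [a [Hh [Aa|Aa] ->]]]].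
  - by exists h, a; split=> //; left.
  - by exists h, a; split=> //; right.
  - by left; exists h, a.
  - by right; exists h, a.
apply/seteqP; split=> [x [v [k [+ Kk ->]]]|x VWx]; last by exists x, 1%g; rewrite mulg1.
by move=> [Vv|Wv]; [left; apply/(exhausting_mulr _ eV Kk)|right; apply/(exhausting_mulr _ eW Kk)].
Qed.

(** An increasing sequence covering the group, which gives access to monotone convergence along the
    filter [exhaustion]. *)
Definition exhausting_seq (N : nat) : set gT := mul_sets H (B N).

Lemma exhausting_seqP N : exh (exhausting_seq N).
Proof.
split; last by exists (B N).
apply/seteqP; split=> [x [_ [k [[h [b [Hh Bb ->]]] Kk ->]]]|x Vx]; last by exists x, 1%g; rewrite mulg1.
by exists h, (b * k)%g; rewrite mulgA; split=> //; apply: BK.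
Qed.

Lemma exhausting_seq_cover x : exists N, exhausting_seq N x.
Proof. by have [N BNx] := B_cover x; exists N, 1%g, x; rewrite mul1g. Qed.

Lemma exhausting_seq_le M N : (M <= N)%N -> exhausting_seq M `<=` exhausting_seq N.
Proof. by move=> MN _ [h [b [Hh Bb ->]]]; exists h, b; split=> //; apply: B_le MN _ Bb. Qed.

Instance exhaustion_filter : ProperFilter (exhaustion H K0).
Proof.
apply: filter_from_proper; last by move=> W eW; exists W; split.
apply: filter_from_filter; first by exists (exhausting_seq 0); apply: exhausting_seqP.
move=> V W eV eW; exists (V `|` W); first exact: exhaustingU.
by move=> Y [eY VWY]; split; split=> //; apply: subset_trans VWY; [apply: subsetUl|apply: subsetUr].
Qed.

(** W has finite measure, and f is bounded on W = H A because it is left H-invariant and continuous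
    on the compact set A. *)
Lemma exhausting_integrable W f : exh W -> quot_locally_constant f -> nu.-integrable W (EFin \o f).
Proof.
move=> eW hf; apply: measurable_bounded_integrable.
- exact: exhausting_measurable.
- exact: exhausting_finite.
- by apply: measurable_funTS; apply: quot_locally_constant_measurable.
have [_ [A cA WE]] := eW.
have ctf : continuous (f : gT -> R) by apply/continuousP => U _; have [] := hf U.
have /compact_bounded[M [Mr hM]] : compact ((f : gT -> R) @` A).
  by apply: continuous_compact => //; apply: continuous_subspaceT.
exists M; split=> // r Mr0 w; rewrite WE => -[h [a [Hh Aa ->]]].
have fha : f (h * a)%g = f a by have [_ fi] := hf [set f a]; exact: (fi h a Hh).
by apply: hM => //; exists a.
Qed.

(** The tail of |f| outside W is at most its tail outside a member of [exhausting_seq], which tends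
    to 0. This serves when the average of a function is integrable and the function itself is not:
    both ways of assigning a value must then agree. *)
Lemma improper_integral_cvg f : quot_locally_constant f -> nu.-integrable setT (EFin \o f) ->
  (fun W : set gT => Rintegral nu (W : set Q) f) @ exhaustion H K0 --> Rintegral nu setT f.
Proof.
move=> hf intf; have mf := quot_locally_constant_measurable hf.
have intn := integrable_norm intf.
have mV N : measurable (exhausting_seq N : set Q) by apply: exhausting_measurable; apply: exhausting_seqP.
pose I := Rintegral nu setT (Num.Def.normr \o f).
have IV : Rintegral nu (exhausting_seq N : set Q) (Num.Def.normr \o f) @[N --> \oo] --> I.
  have VT : [set: Q] = \bigcup_N (exhausting_seq N : set Q).
    by apply/seteqP; split=> // x _; have [N VN] := exhausting_seq_cover x; exists N => //; exact: VN.
  apply: fine_cvg; rewrite /= fineK; last by apply: (integrable_fin_num _ intn).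
  rewrite VT.
  apply: ge0_nondecreasing_set_cvg_integral => //.
  - by apply/nondecreasing_seqP => N; rewrite subsetEset; apply: exhausting_seq_le.
  - move=> N; apply: measurable_funTS; exact: (measurable_int _ intn).
apply/cvgrPdist_le => e e0.
have /cvgrPdist_le/(_ e e0) [N _ /(_ N (leqnn N)) hN] := IV.
exists (exhausting_seq N); first exact: exhausting_seqP.
move=> W [eW VW]; have mW := exhausting_measurable eW.
have split_int g : nu.-integrable setT (EFin \o g) ->
    Rintegral nu setT g - Rintegral nu (W : set Q) g = Rintegral nu (~` W : set Q) g.
  move=> intg; rewrite -(setUv (W : set Q)) Rintegral_setU ?setUv//.
  - by rewrite addrC addKr.
  - exact: measurableC.
  - by rewrite disj_set2E setICr.
rewrite split_int//; apply: le_trans hN.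
have mCW : measurable (~` W : set Q) by apply: measurableC.
have intS (D : set Q) : measurable D -> nu.-integrable D (EFin \o (Num.Def.normr \o f)).
  by move=> mD; apply: integrableS intn.
apply: le_trans (le_normr_Rintegral mCW _) _; first exact: integrableS intf.
have hIW : Rintegral nu (exhausting_seq N : set Q) (Num.Def.normr \o f) <= Rintegral nu (W : set Q) (Num.Def.normr \o f).
  apply: fine_le; [exact: integrable_fin_num (intS _ _)|exact: integrable_fin_num (intS _ _)|].
  apply: ge0_subset_integral => //; last by move=> x _; rewrite lee_fin; apply: normr_ge0.
  exact: measurable_int (intS _ _).
rewrite -(split_int _ intn); apply: le_trans (ler_norm _).
by rewrite lerB.
Qed.

Variables (I : finType) (t : I -> gT).
Hypotheses (I_gt0 : (0 < #|I|)%N) (Kt : forall i, K0 (t i)).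

Definition average (f : Q -> R) : Q -> R :=
  fun x => #|I|%:R^-1 * \sum_i f (rtrans (H := H) (t i) x).

Lemma average_integral (W : set Q) f : measurable W ->
  (forall i, rtrans (t i) @^-1` W = W) -> measurable_fun setT f ->
  nu.-integrable W (EFin \o f) ->
  nu.-integrable W (EFin \o average f) /\ Rintegral nu W (average f) = Rintegral nu W f.
Proof.
move=> mW tW mf intf.
have tr i : nu.-integrable W (fun x : Q => (f (rtrans (t i) x))%:E) /\
    Rintegral nu W (fun x : Q => f (rtrans (t i) x)) = Rintegral nu W f.
  by have := integrable_rtrans open_mulr hnu (t i) mW mf intf; rewrite tW.
have sum_int (s : seq I) :
    nu.-integrable W (EFin \o (fun x : Q => \sum_(i <- s) f (rtrans (t i) x))) /\
    Rintegral nu W (fun x : Q => \sum_(i <- s) f (rtrans (t i) x)) = (size s)%:R * Rintegral nu W f.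
  elim: s => [|i s [ints ints_eq]].
    split.
      apply: (eq_integrable mW (cst 0%E)); last exact: integrable0.
      by move=> x _; rewrite /= big_nil.
    rewrite mul0r /Rintegral integral0_eq// => x _; by rewrite big_nil.
  have [inti inti_eq] := tr i.
  have E : (fun x : Q => \sum_(j <- i :: s) f (rtrans (t j) x)) =
      (fun x : Q => f (rtrans (t i) x) + \sum_(j <- s) f (rtrans (t j) x)).
    by apply/funext => x; rewrite big_cons.
  rewrite E; split; last by rewrite RintegralD// inti_eq ints_eq /= -natr1 mulrDl mul1r addrC.
  apply: (eq_integrable mW (fun x : Q =>
    (f (rtrans (t i) x))%:E + (\sum_(j <- s) f (rtrans (t j) x))%R%:E)%E); last exact: integrableD.
  by move=> x _; rewrite /= EFinD.
have [ints ints_eq] := sum_int (index_enum I); split.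
  apply: (eq_integrable mW (fun x : Q => (#|I|%:R^-1)%:E * (\sum_i f (rtrans (t i) x))%R%:E)%E).
    by move=> x _; rewrite /= EFinM.
  exact: integrableZl.
have sizeI : size (index_enum I) = #|I| by rewrite -sum1_size sum1_card.
by rewrite /average RintegralZl// ints_eq sizeI mulrA mulVf ?mul1r// pnatr_eq0 -lt0n.
Qed.

(** On each exhausting W the integrals of f and of its average agree, as W is stable under K0, which
    contains the translating elements. If f is integrable so is its average, so three cases
    remain. *)
Lemma quotient_integral_average f : quot_locally_constant f -> quot_locally_constant (average f) ->
  quotient_integral_real K0 nu f = quotient_integral_real K0 nu (average f).
Proof.
move=> hf hf'; have mf := quot_locally_constant_measurable hf.
have tT i : rtrans (H := H) (t i) @^-1` setT = setT by [].
rewrite /quotient_integral_real; case: asboolP => intf.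
  have [intf' eq_int] := average_integral measurableT tT mf intf.
  by rewrite asboolT.
have near_eq : \forall W \near exhaustion H K0,
    Rintegral nu (W : set Q) f = Rintegral nu (W : set Q) (average f).
  exists (exhausting_seq 0); first exact: exhausting_seqP.
  move=> W [eW _] /=; have tW i : rtrans (H := H) (t i) @^-1` W = W.
    by apply/seteqP; split=> x /(exhausting_mulr _ eW (Kt i)).
  by have [] := average_integral (exhausting_measurable eW) tW mf (exhausting_integrable eW hf).
case: asboolP => intf'.
  apply/cvg_lim => //; apply: cvg_trans (improper_integral_cvg hf' intf').
  by apply: near_eq_cvg; apply: filterS near_eq.
(* Neither function is integrable: the two image filters are equal, so their [lim] agree whether or
   not they converge. *)
congr (lim _); apply/seteqP; split; apply: near_eq_cvg => //.
by apply: filterS near_eq.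
Qed.

End ImproperIntegral.

(** * Twisted orbital integrals *)

Lemma zconnected_image (K : fieldType) (T T' : Type) (N N' : nat)
    (coord : T -> 'I_N -> K) (coord' : T' -> 'I_N' -> K) (F : T -> T') (Y : set T) :
  (forall k, exists q : mpoly.mpoly N K, forall x, coord' (F x) k = mpoly.meval (coord x) q) ->
  zconnected coord Y -> zconnected coord' (F @` Y).
Proof.
move=> /choice[q qE] cY.
have preim_closed Z : zclosed coord' Z -> zclosed coord (F @^-1` Z).
  move=> [P PZ]; exists [set mpoly.comp_mpoly [tuple q k | k < N'] p | p in P] => x.
  have evalE p : mpoly.meval (coord x) (mpoly.comp_mpoly [tuple q k | k < N'] p) =
      mpoly.meval (coord' (F x)) p.
    rewrite mpoly.comp_mpoly_meval; congr (mpoly.meval _ p).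
    by apply/funext => k; rewrite tnth_mktuple qE.
  split=> [/PZ h _ [p Pp <-]|h]; first by rewrite evalE h.
  by apply/PZ => p Pp; rewrite -evalE h//; exists p.
move=> Z1 Z2 /preim_closed c1 /preim_closed c2 sub dis.
have [x Yx||s1|s2] := cY _ _ c1 c2.
- by apply: sub; exists x.
- rewrite -subset0 => x [[Yx Z1x] Z2x]; suff : (F @` Y `&` Z1 `&` Z2) (F x) by rewrite dis.
  by split=> //; split=> //; exists x.
- by left=> _ [x Yx <-]; apply: s1.
- by right=> _ [x Yx <-]; apply: s2.
Qed.

(** * The identity component of the twisted centralizer *)

Section TwistedCentralizer.
Variables (F E : local_field) (r : nat) (X : unramified_ext F E r).
Variables (d : nat) (G : split_reductive (lf_O F) d).
Variables (Fbar : closedFieldType) (iota : {rmorphism lf_K E -> Fbar}).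
Local Notation Gr := (padic_points G (str_E X)).
Local Notation theta := (@theta F E r X d G).
Local Notation res_pts := (res_pts X G iota).
Local Notation res_embed := (@res_embed F E r X d G Fbar iota).
Local Notation res_coord := (@res_coord F E r X d G Fbar iota).

Lemma zconnected_mulr (Y : set res_pts) (b : res_pts) : zconnected res_coord Y ->
  zconnected res_coord [set (fun i => (g i * b i)%g) | g in Y].
Proof.
apply: zconnected_image => k; case/mxvec_indexP: k => i j; case/mxvec_indexP: j => a c.
exists (\sum_e mpoly.mpolyX _ (mpoly.mnm1 (mxvec_index i (mxvec_index a e))) *
  mpoly.mpolyC _ (pt_val (b i) e c)) => g.
rewrite /res_coord mxvecE mxE /pt_coord mxvecE /= mxE rmorph_sum; apply: eq_bigr => e _.
by rewrite rmorphM /= mpoly.mevalXU mpoly.mevalC mxvecE mxE /pt_coord mxvecE.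
Qed.

Lemma res_embedM x y : res_embed (x * y)%g = fun i => (res_embed x i * res_embed y i)%g.
Proof.
apply/funext => i; rewrite /res_embed.
have -> : iter i theta (x * y)%g = (iter i theta x * iter i theta y)%g.
  by elim: (i : nat) => //= m ->; rewrite thetaM.
exact: pts_mapM.
Qed.

Lemma res_embed1 : res_embed 1%g = fun=> 1%g.
Proof.
apply/funext => i; rewrite /res_embed.
have -> : iter i theta 1%g = 1%g by elim: (i : nat) => //= m ->; rewrite theta1.
exact: pts_map1.
Qed.

Variable delta : Gr.
Local Notation I := (twisted_centralizer_id iota delta).

Lemma twisted_centralizer_id1 : I 1%g.
Proof.
split; first by rewrite invg1 mul1g theta1 mulg1.
exists [set fun=> 1%g]; split=> //; last by rewrite res_embed1.
  exact: zconnected1.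
by move=> _ -> i; rewrite invg1 mul1g mulg1.
Qed.

Lemma twisted_centralizer_barM (x y : res_pts) : twisted_centralizer_bar (iota := iota) delta x ->
  twisted_centralizer_bar (iota := iota) delta y ->
  twisted_centralizer_bar (iota := iota) delta (fun i => (x i * y i)%g).
Proof.
move=> hx hy i; rewrite invMg -!mulgA (mulgA (res_embed delta i)) (mulgA (x i)^-1%g).
by rewrite (mulgA (x i)^-1%g) hx mulgA hy.
Qed.

(** If Y1 joins 1 to x and Y2 joins 1 to y, then Y1 translated by y joins y to xy, and its union
    with Y2 is connected because both contain y. *)
Lemma twisted_centralizer_idM x y : I x -> I y -> I (x * y)%g.
Proof.
move=> [xd [Y1 [c1 s1 o1 x1]]] [yd [Y2 [c2 s2 o2 y2]]]; split.
  by rewrite invMg thetaM -!mulgA (mulgA delta) (mulgA x^-1%g) (mulgA x^-1%g) xd mulgA yd.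
pose Y1y := [set (fun i => (g i * res_embed y i)%g) | g in Y1].
have Y1y_y : Y1y (res_embed y).
  by exists (fun=> 1%g) => //; apply/funext => i; rewrite mul1g.
exists (Y2 `|` \bigcup_(_ in [set: unit]) Y1y); split.
- apply: zconnected_bigcup_meet => // _; first exact: zconnected_mulr.
  by exists (res_embed y).
- move=> g [/s2//|[_ _ [h Y1h <-]]]; apply: twisted_centralizer_barM; [exact: s1|exact: s2].
- by left.
- by right; exists tt => //; rewrite res_embedM; exists (res_embed x).
Qed.

End TwistedCentralizer.

Section TwistedAverage.
Variables (F E : local_field) (r : nat) (X : unramified_ext F E r).
Variables (d : nat) (G : split_reductive (lf_O F) d).
Variables (Fbar : closedFieldType) (iota : {rmorphism lf_K E -> Fbar}) (R : realType).
Local Notation Gr := (padic_points G (str_E X)).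
Local Notation theta := (@theta F E r X d G).
Local Notation C := R[i].

Lemma congruenceM n (x y : Gr) : congruence n.+1 x -> congruence n.+1 y -> congruence n.+1 (x * y)%g.
Proof.
move=> hx hy; have [ix _] := congruence_int hx; rewrite /congruence /=.
have -> : pt_val (x * y)%g - 1%:M = pt_val x *m (pt_val y - 1%:M) + (pt_val x - 1%:M).
  by rewrite pvalM mulmxBr mulmx1 addrA subrK.
by apply: mx_vgeD => //; rewrite -(add0r (Posz n.+1)); apply: mx_vgeM.
Qed.

(** Replacing g by g k multiplies y = g^-1 delta theta(g) on the right by (y^-1 k^-1 y) theta(k),
    which is close to 1 when k is. *)
Lemma open_preim_twist (delta : Gr) (U : set Gr) : open U ->
  open [set g | U (g^-1 * delta * theta g)%g].
Proof.
move=> /padic_openP oU; apply/padic_openP => g /= /oU[n hn].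
set y := (g^-1 * delta * theta g)%g in hn.
have [m hm] := congruenceJ n.+1 y^-1%g.
exists (m + n)%N => k hk.
have -> : ((g * k)^-1 * delta * theta (g * k) = y * ((y^-1 * k^-1 * y^-1^-1) * theta k))%g.
  by rewrite /y thetaM !invMg !invgK -!mulgA !(mulKVg, mulVKg, mulKg).
apply: hn; apply: congruenceM.
  by apply: hm; apply: congruenceV; apply: congruence_le hk; rewrite ltnS leq_addr.
by apply: theta_congruence; apply: congruence_le hk; rewrite ltnS leq_addl.
Qed.

Variable delta : Gr.
Local Notation H := (twisted_centralizer_id iota delta).
Local Notation twist phi := (fun g : Gr => phi (g^-1 * delta * theta g)%g).

Lemma twisted_orbit_locally_constant (phi : Gr -> C) (part : C -> R) : test_function phi ->
  quot_locally_constant (fun g : quot H => part (twist phi g)).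
Proof.
move=> [lc _] S; split.
  apply: (@open_preim_twist delta ((part \o phi) @^-1` S)).
  have -> : (part \o phi) @^-1` S = \bigcup_(U in [set U | open U /\ U `<=` (part \o phi) @^-1` S]) U.
    apply/seteqP; split=> [y Sy|y [U [_ US]]]; last exact: US.
    have [U [oU Uy hU]] := lc y; exists U => //; split=> // z Uz.
    by rewrite /preimage /= hU.
  by apply: bigcup_open => U [].
move=> h x [hd _]; rewrite /preimage /=; congr (S (part (phi _))).
by rewrite invMg thetaM -!mulgA (mulgA delta) (mulgA h^-1%g) (mulgA h^-1%g) hd.
Qed.

Variable nu : {measure set (quot H) -> \bar R}.
Hypothesis hnu : is_quotient_haar nu.

Lemma TO_average (I : finType) (t : I -> Gr) (phi phi' : Gr -> C) :
  (0 < #|I|)%N -> (forall i, hyperspecial X G (t i)) ->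
  test_function phi -> test_function phi' ->
  (forall y, phi' y = #|I|%:R^-1 * \sum_i phi ((t i)^-1 * y * theta (t i))%g) ->
  TO nu phi = TO nu phi'.
Proof.
move=> I0 Kt tphi tphi' phi'E.
have Kmul N (x k : Gr) : bounded_pts N x -> hyperspecial X G k -> bounded_pts N (x * k)%g.
  rewrite hyperspecialE => -[x1 x2] [k1 k2]; split.
    by rewrite pvalM -[- _]addr0; apply: mx_vgeM.
  by rewrite invMg pvalM -[- _]add0r; apply: mx_vgeM.
have K1 : hyperspecial X G 1%g by rewrite hyperspecialE; split; rewrite ?invg1; apply: mx_vge_1.
have KV k : hyperspecial X G k -> hyperspecial X G k^-1%g.
  by rewrite hyperspecialE => -[k1 k2]; split; rewrite ?invgK.
have openK : open (hyperspecial X G).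
  apply: (@open_right_invariant _ _ _ _ _ 0) => x k; rewrite hyperspecialE => Kx /congruence_int[k1 k2].
  by apply: Kmul => //; rewrite hyperspecialE.
(* [part] stands for the real or the imaginary part; complex integrals are defined through these
   two. *)
have real_part (part : {additive C -> R}) :
    (forall (a : R) (z : C), part (a%:C%C * z) = a * part z) ->
    quotient_integral_real (hyperspecial X G) nu (fun g => part (twist phi g)) =
    quotient_integral_real (hyperspecial X G) nu (fun g => part (twist phi' g)).
  move=> partZ; pose f g := part (twist phi g).
  have fE : (fun g : quot H => part (twist phi' g)) = average (H := H) t f.
    apply/funext => g; rewrite /average /f phi'E.
    have -> : #|I|%:R^-1 = (#|I|%:R^-1)%:C%C :> C by rewrite rmorphV/= ?rmorph_nat// unitfE pnatr_eq0 -lt0n.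
    rewrite partZ raddf_sum; congr (_ * _); apply: eq_bigr => i _.
    by rewrite /rtrans thetaM invMg !mulgA.
  rewrite fE; change (quotient_integral_real (hyperspecial X G) nu f = quotient_integral_real (hyperspecial X G) nu (average (H := H) t f)).
  apply: (quotient_integral_average (B := fun N => bounded_pts N) (t := t)
    (fun U b => @open_preim_mulr _ _ _ _ U b) (fun U a => @open_preim_mull _ _ _ _ U a)
    (twisted_centralizer_id1 iota delta) (@twisted_centralizer_idM _ _ _ _ _ _ _ iota delta)
    K1 KV openK (compact_bounded_pts (f := str_E X)) Kmul
    (@bounded_pts_le _ _ _ _) (@bounded_pts_cover _ _ _ _) hnu I0 Kt).
    exact: twisted_orbit_locally_constant.
  by rewrite -fE; apply: (@twisted_orbit_locally_constant _ part).
rewrite /TO /quotient_integral; congr (_ +i* _)%C; apply: real_part => a [x y] /=;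
  by rewrite mul0r ?subr0 ?addr0.
Qed.

End TwistedAverage.

Theorem corollary2p38 (R : realType)
  (F E : local_field) (r : nat) (X : unramified_ext F E r)
  (Fbar : closedFieldType) (iota : {rmorphism lf_K E -> Fbar})
  (hiota : is_algebraic_closure iota)
  (d : nat) (G : split_reductive (lf_O F) d)
  (hcenter : connected_center G (str_bar X iota))
  (hder : simply_connected_derived G (str_bar X iota))
  (Ghat : split_reductive R[i] d)
  (hdual : dual_group Ghat G (lf_inc F))
  (hW : forall chi : Gm d (lf_k F) -> R[i], torus_dual chi ->
          stabilizer_generated_by_reflections G chi)
  (mu : 'rV[int]_d)
  (hdom : dominant G (lf_inc F) mu) (hmin : minuscule G (lf_inc F) mu)
  (l : nat) (hl : affine_length G (lf_inc F) (translation mu) l)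
  (m : nat) (rep : Ghat_pts Ghat -> 'M[R[i]]_m)
  (hrep : algebraic_rep rep) (hirr : irreducible_rep rep)
  (hweight : highest_weight rep mu)
  (L : LLC_plus X G Ghat iota)
  (Z : (padic_points G (str_E X) -> R[i]) -> R[i]) (hZ : is_Z_V L rep Z)
  (vol : {measure set (g_sigma_algebraType (@open (padic_points G (str_E X))))
            -> \bar R})
  (hvol : is_haar vol) (hvolI : vol (iwahori X G) = 1%E) :
  test_function (phi'_r1 vol Z l) /\
  forall (delta : padic_points G (str_E X)) (gamma : pts G (lf_inc F)),
    is_norm iota delta gamma -> semisimple X iota gamma ->
    forall nu : {measure set (quot (twisted_centralizer_id iota delta))
                   -> \bar R},
      is_quotient_haar nu ->
      TO nu (phi_r1 Z l) = TO nu (phi'_r1 vol Z l).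
Proof.
have [tau [tauM tau_tor tau_unip]] := borel_retraction G (str_k X).
have [bZ _] := hZ.
have tphi' := test_function_phi'_r1 hvolI tauM tau_tor tau_unip bZ l.
split=> // delta gamma _ _ nu hnu.
have := phi'_r1_average hvolI tauM tau_tor tau_unip bZ l.
apply: TO_average => //.
- by apply/card_gt0P; exists 1%g.
(* The lifts t_s lie in G(O_r), under which the exhausting sets in the definition of [TO] are
   stable. *)
- by move=> s; apply: iwahori_hyperspecial; apply: iwahori_tor.
- exact: (test_function_phi_r1 tauM tau_tor tau_unip bZ l).
Qed.
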